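(* Let $(M,F)$ be a homogeneous Finsler surface (i.e. $\dim M=2$) which is a Landsberg surface, that is, its Landsberg curvature ${\bf L}$ vanishes identically. Then $F$ is Riemannian or $F$ is locally Minkowskian.
   Context: A Finsler metric on a smooth manifold $M$ is a continuous function $F:TM\to[0,\infty)$, smooth on the slit tangent bundle $TM_0=TM\setminus\{0\}$, positively $1$-homogeneous on each fibre ($F(x,\lambda y)=\lambda F(x,y)$ for $\lambda>0$), with positive definite fundamental tensor $g_{ij}(x,y)=\frac12\frac{\partial^2 F^2}{\partial y^i\partial y^j}$ on $TM_0$; write $(g^{ij})=(g_{ij})^{-1}$ and $\mathbf{g}_y(u,v)=g_{ij}(x,y)u^iv^j$. Here $(x^i,y^i)$ are standard local coordinates on $TM$, and the summation convention is used. A Finsler surface is a Finsler manifold of dimension $2$. The spray coefficients of $F$ are $G^i=\frac14 g^{ij}\left\{\frac{\partial^2 F^2}{\partial x^k\partial y^j}y^k-\frac{\partial F^2}{\partial x^j}\right\}$. The Berwald curvature is $B^i_{\ jkl}=\frac{\partial^3G^i}{\partial y^j\partial y^k\partial y^l}$, i.e. ${\bf B}_y(u,v,w)=B^i_{\ jkl}(y)u^jv^kw^l\frac{\partial}{\partial x^i}$. The Landsberg curvature is ${\bf L}_y(u,v,w)=-\frac12\mathbf{g}_y({\bf B}_y(u,v,w),y)$ for $y\in T_xM\setminus\{0\}$, $u,v,w\in T_xM$. $F$ is a Landsberg metric if ${\bf L}=0$. $(M,F)$ is homogeneous if its group of isometries (diffeomorphisms $\varphi$ of $M$ with $F\circ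 d\varphi=F$) acts transitively on $M$. $F$ is Riemannian if $g_{ij}(x,y)$ does not depend on $y$ (equivalently, $F(x,y)^2$ is quadratic in $y$). $F$ is locally Minkowskian if around every point of $M$ there are local coordinates $(x^i)$ in which $F=F(y)$ does not depend on $x$. *)

(* Defs.v *)
From HB Require Import structures.
From mathcomp Require Import all_boot all_order all_algebra.
From mathcomp Require Import all_classical all_reals all_analysis.

Set Implicit Arguments.
Unset Strict Implicit.
Unset Printing Implicit Defensive.

Import Order.TTheory GRing.Theory Num.Theory.
Import numFieldNormedType.Exports.

Local Open Scope classical_set_scope.
Local Open Scope ring_scope.

Section Smoothness.
Context {R : realType} {V W : normedModType R}.

(* Meant for A open and V, W finite-dimensional, where asking for iterated
   directional derivatives in all directions is the same as asking for iterated
   partial derivatives. *)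
Fixpoint Ck_on (k : nat) (A : set V) (f : V -> W) : Prop :=
  if k is k'.+1 then
    (forall x, A x -> differentiable f x) /\
    (forall v, Ck_on k' A (fun x => 'D_v f x))
  else forall x, A x -> {for x, continuous f}.

Definition smooth_on (A : set V) (f : V -> W) : Prop :=
  forall k, Ck_on k A f.

End Smoothness.

Section Charts.
Context {R : realType} {n : nat} {T : topologicalType}.

(* A homeomorphism between an open subset of T and an open subset of R^n.  The
   values of cfun and cinv outside cdom and cimg are irrelevant. *)
Record chart := Chart {
  cdom : set T;
  cfun : T -> 'rV[R]_n;
  cinv : 'rV[R]_n -> T;
  open_cdom : open cdom;
  open_cimg : open (cfun @` cdom);
  cfunK : {in cdom, cancel cfun cinv};
  cfun_continuous : forall p, cdom p -> {for p, continuous cfun};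
  cinv_continuous : forall x, (cfun @` cdom) x -> {for x, continuous cinv} }.

Definition cimg (c : chart) : set 'rV[R]_n := cfun c @` cdom c.

Definition smooth_transition (c d : chart) : Prop :=
  smooth_on (cfun c @` (cdom c `&` cdom d)) (cfun d \o cinv c).

End Charts.

Arguments chart R n T : clear implicits.

Record manifold (R : realType) (n : nat) := Manifold {
  points :> topologicalType;
  points_hausdorff : hausdorff_space points;
  points_second_countable : @second_countable points;
  atlas : set (chart R n points);
  atlas_smooth : forall c d, atlas c -> atlas d -> smooth_transition c d;
  chart_at : points -> chart R n points;
  atlas_chart_at : forall p, atlas (chart_at p);
  cdom_chart_at : forall p, cdom (chart_at p) p }.

Section Manifolds.
Context {R : realType} {n : nat}.
Implicit Type M : manifold R n.

(* The charts of the maximal atlas, i.e. all local coordinate systems of M. *)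
Definition smooth_chart M (c : chart R n M) : Prop :=
  forall d, atlas d -> smooth_transition c d /\ smooth_transition d c.

(* A tangent vector at p is given by its components in the preferred chart
   chart_at p; tangent_of_coord below passes from the components in any other
   chart to these. *)
Definition tangent M (p : M) : Type := 'rV[R]_n.

(* The tangent vector y^i d/dx^i at the point of coordinates x in the chart c. *)
Definition tangent_of_coord M (c : chart R n M) (x y : 'rV[R]_n) :
    tangent (cinv c x) :=
  'd (cfun (chart_at (cinv c x)) \o cinv c) x y.

Definition smooth_map M (phi : M -> M) : Prop :=
  continuous phi /\
  forall c d : chart R n M, smooth_chart c -> smooth_chart d ->
    smooth_on (cfun c @` (cdom c `&` phi @^-1` cdom d))
      (cfun d \o phi \o cinv c).

Definition diffeomorphism M (phi : M -> M) : Prop :=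
  smooth_map phi /\
  exists psi : M -> M, [/\ cancel phi psi, cancel psi phi & smooth_map psi].

Definition tangent_map M (phi : M -> M) (p : M) (v : tangent p) :
    tangent (phi p) :=
  'd (cfun (chart_at (phi p)) \o phi \o cinv (chart_at p))
    (cfun (chart_at p) p) (v : 'rV[R]_n).

End Manifolds.

Section LocalFormulas.
Context {R : realType} {n : nat}.

Local Notation E := 'rV[R]_n.

(* For functions of (x, y), where x are the coordinates of the point and y those
   of the tangent vector. *)
Definition partial_x (i : 'I_n) (f : E * E -> R) : E * E -> R :=
  fun z => 'D_(delta_mx 0 i, 0) f z.

Definition partial_y (i : 'I_n) (f : E * E -> R) : E * E -> R :=
  fun z => 'D_(0, delta_mx 0 i) f z.

Variable f : E * E -> R.

Definition metric_sq : E * E -> R := fun z => f z ^+ 2.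

Definition fundamental_tensor (z : E * E) : 'M[R]_n :=
  \matrix_(i, j) (2^-1 * partial_y i (partial_y j metric_sq) z).

Definition fundamental_form (z : E * E) (u v : E) : R :=
  \sum_i \sum_j fundamental_tensor z i j * u 0 i * v 0 j.

Definition spray (i : 'I_n) (z : E * E) : R :=
  4^-1 * \sum_j invmx (fundamental_tensor z) i j *
    (\sum_k partial_x k (partial_y j metric_sq) z * z.2 0 k
      - partial_x j metric_sq z).

Definition berwald_coef (i j k l : 'I_n) : E * E -> R :=
  partial_y j (partial_y k (partial_y l (spray i))).

Definition berwald (z : E * E) (u v w : E) : E :=
  \row_i \sum_j \sum_k \sum_l
    berwald_coef i j k l z * u 0 j * v 0 k * w 0 l.

Definition landsberg (z : E * E) (u v w : E) : R :=
  - 2^-1 * fundamental_form z (berwald z u v w) z.2.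

End LocalFormulas.

Section Finsler.
Context {R : realType} {n : nat} {M : manifold R n}.

Definition in_coord (F : forall p : M, tangent p -> R) (c : chart R n M) :
    'rV[R]_n * 'rV[R]_n -> R :=
  fun z => F (cinv c z.1) (tangent_of_coord c z.1 z.2).

Definition coord_tangent (c : chart R n M) : set ('rV[R]_n * 'rV[R]_n) :=
  [set z | cimg c z.1].

Definition coord_slit_tangent (c : chart R n M) :
    set ('rV[R]_n * 'rV[R]_n) :=
  [set z | cimg c z.1 /\ z.2 != 0].

Record finsler_metric := FinslerMetric {
  finsler_fun :> forall p : M, tangent p -> R;
  finsler_ge0 : forall (p : M) (v : tangent p), 0 <= finsler_fun v;
  finsler_continuous : forall c : chart R n M, smooth_chart c ->
    forall z, coord_tangent c z -> {for z, continuous (in_coord finsler_fun c)};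
  finsler_smooth : forall c : chart R n M, smooth_chart c ->
    smooth_on (coord_slit_tangent c) (in_coord finsler_fun c);
  finsler_homogeneous : forall (p : M) (v : 'rV[R]_n) (a : R), 0 < a ->
    finsler_fun (a *: v : tangent p) = a * finsler_fun (v : tangent p);
  finsler_posdef : forall c : chart R n M, smooth_chart c ->
    forall z, coord_slit_tangent c z -> forall u : 'rV[R]_n, u != 0 ->
    0 < fundamental_form (in_coord finsler_fun c) z u u }.

Variable F : finsler_metric.

Definition is_isometry (phi : M -> M) : Prop :=
  diffeomorphism phi /\
  forall (p : M) (v : tangent p), F (phi p) (tangent_map phi v) = F p v.

Definition is_homogeneous : Prop :=
  forall p q : M, exists2 phi : M -> M, is_isometry phi & phi p = q.

Definition is_landsberg : Prop :=
  forall c : chart R n M, smooth_chart c ->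
  forall z, coord_slit_tangent c z ->
  forall u v w : 'rV[R]_n, landsberg (in_coord F c) z u v w = 0.

Definition is_riemannian : Prop :=
  forall c : chart R n M, smooth_chart c ->
  forall x y y' : 'rV[R]_n, cimg c x -> y != 0 -> y' != 0 ->
  fundamental_tensor (in_coord F c) (x, y) =
  fundamental_tensor (in_coord F c) (x, y').

Definition locally_minkowskian : Prop :=
  forall p : M, exists c : chart R n M,
    [/\ smooth_chart c, cdom c p &
        forall x x' y : 'rV[R]_n, cimg c x -> cimg c x' ->
        in_coord F c (x, y) = in_coord F c (x', y)].

End Finsler.

Arguments finsler_metric {R n} M.

(* Main.v *)
Require Import Defs.
From HB Require Import structures.
From mathcomp Require Import all_boot all_order all_algebra.
From mathcomp Require Import all_classical all_reals all_analysis.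
From mathcomp Require Import ring lra.

(** Homogeneity enters through one consequence only: any two tangent planes,
    with their norms, are linearly isometric.  Let Q be the square of F in a
    chart.

    If some tangent plane is Euclidean then all of them are, and F is
    Riemannian.  Otherwise every tangent plane is rigid: no nonzero
    endomorphism S satisfies dQ_y(y S) = 0 for all y
    ([infinitesimal_isometry_eq0]).  Hence a linear isometry between two
    neighbouring tangent planes which is close to the identity is unique and
    depends differentiably on the base points.  Its derivative is a linear
    connection Gam whose parallel transport preserves Q, in the sense that the
    derivative of Q in the direction v of the base is dQ_y(y Gam(v))
    ([exists_transport]).

    A priori Gam has torsion.  The Euler-Lagrange equations say that twice the
    spray is the quadratic map y |-> y Gam(y) plus a term which is linear in
    the torsion ([hess_spray]).  The Landsberg condition says that dQ
    annihilates the third derivatives of the spray.  On an affine line of the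
    tangent plane this is an ordinary differential equation for the restriction
    f of Q to the line.  Where the torsion does not vanish it gives a first
    integral (f D')^2 / D^3 = const, where D = 2 f f'' - f'^2 and
    D' = 2 f f'''.  If the line starts at a direction where the determinant of
    the Hessian of Q is maximal, the constant is 0, so f''' = 0 along the line
    and the Hessian is constant along it.  The lines through this direction
    reach all other directions in the limit, so the plane is Euclidean
    ([hess_cst_of_propagation]), which is excluded.  So the torsion vanishes
    ([landsberg_torsion_eq0]).  The rigidity used above rests on the same
    criterion.

    Now Gam is symmetric; it is also smooth, because the spray determines it by
    polarization.  Let B x be the isometry from the tangent plane at x onto
    the one at a fixed point p.  It satisfies 'D_v B = Gam(v) B
    ([exists_frame]), so symmetry of Gam says that the columns of B are closed
    1-forms.  By the Poincare lemma B is the Jacobian matrix of a map z, which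
    is a local diffeomorphism, and in the coordinates z the norm is, at every
    point, the norm of the plane at p ([minkowski_chart]): F is locally
    Minkowskian.  The frame B is obtained from the given isometries rather than
    by integrating the connection, which avoids solving differential
    equations. *)


Set Implicit Arguments.
Unset Strict Implicit.
Unset Printing Implicit Defensive.

Import Order.TTheory GRing.Theory Num.Theory.
Import numFieldNormedType.Exports.

Local Open Scope classical_set_scope.
Local Open Scope ring_scope.

(** * Calculus of maps of class C^k *)

Section Calculus.
Context {R : realType}.

(** The epsilon form of differentiability, used in both directions instead of
    the little-o form. *)
Lemma diff_eps (V W : normedModType R) (f : V -> W) x : differentiable f x ->
  forall e, 0 < e -> \forall k \near (0 : V), `|f (k + x) - f x - 'd f x k| <= e * `|k|.
Proof.
move=> /diff_locally /eqaddoP dfx e e0; have := dfx e e0.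
by apply: filterS => k /=; rewrite !fctE/= -addrA -opprD.
Qed.

Lemma eps_is_diff (V W : normedModType R) (f : V -> W) x (L : {linear V -> W}) :
  continuous L ->
  (forall e, 0 < e -> \forall k \near (0 : V), `|f (k + x) - f x - L k| <= e * `|k|) ->
  is_diff x f L.
Proof.
move=> Lc fL.
have fE : f \o shift x = cst (f x) + L +o_ 0 id.
  apply/eqaddoP => e e0; have := fL e e0.
  by apply: filterS => k /=; rewrite !fctE/= -addrA -opprD.
have dE := diff_unique Lc fE.
by split => //; apply/diff_locallyP; rewrite dE.
Qed.

End Calculus.

Section CkCalculus.
Context {R : realType}.

Section General.
Context {V W : normedModType R}.
Implicit Types (A B : set V) (f g : V -> W).

Lemma Ck_onS A B k f : B `<=` A -> Ck_on k A f -> Ck_on k B f.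
Proof.
move=> BA; elim: k f => [|k IH] f /=; first by move=> fA x /BA/fA.
by move=> [df Df]; split=> [x /BA/df//|v]; exact/IH/Df.
Qed.

Lemma Ck_on_pred k A f : Ck_on k.+1 A f -> Ck_on k A f.
Proof.
elim: k f => [|k IH] f [df Df]; first by move=> x /df/differentiable_continuous.
by split=> // v; apply/IH/Df.
Qed.

Lemma open_near_eq A f g x : open A -> A x -> (forall y, A y -> f y = g y) ->
  \forall y \near x, f y = g y.
Proof. by move=> oA Ax fg; apply: filterS (open_nbhs_nbhs (conj oA Ax)). Qed.

Lemma open_derive_eq A f g x v : open A -> A x -> (forall y, A y -> f y = g y) ->
  'D_v f x = 'D_v g x.
Proof. by move=> oA Ax fg; apply/near_eq_derive/(open_near_eq oA Ax). Qed.

Lemma near_eq_differentiable f g x : (\forall y \near x, f y = g y) ->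
  differentiable f x -> differentiable g x.
Proof.
move=> fg df; suff : is_diff x g ('d f x) by case.
apply: eps_is_diff => [|e e0]; first exact: diff_continuous.
have fg0 := nbhs_singleton fg.
have : \forall k \near (0 : V), f (k + x) = g (k + x).
  by move: fg; rewrite (near_shift 0 x); apply: filterS => k /=; rewrite subr0.
by apply: filterS2 (diff_eps df e0) => k + fgk; rewrite fgk fg0.
Qed.

Lemma Ck_on_eq k A f g : open A -> (forall x, A x -> f x = g x) ->
  Ck_on k A f -> Ck_on k A g.
Proof.
move=> oA; elim: k f g => [|k IH] f g fg /=.
  move=> fA x Ax; have := fA x Ax; rewrite /prop_for/continuous_at -fg//.
  apply: cvg_trans; apply: near_eq_cvg.
  by apply: filterS (open_near_eq oA Ax fg) => y ->.
move=> [df Df]; split=> [x Ax|v].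
  exact: near_eq_differentiable (open_near_eq oA Ax fg) (df _ Ax).
by apply: IH (Df v) => x Ax; exact: open_derive_eq oA Ax fg.
Qed.

Lemma Ck_on_cst k A (c : W) : Ck_on k A (cst c).
Proof.
elim: k c => [|k IH] c /=; first by move=> x _; exact: cst_continuous.
split=> // v; suff -> : (fun x => 'D_v (cst c) x) = cst (0 : W) by [].
by apply/funext => x /=; rewrite derive_cst.
Qed.

End General.

Section Scalar.
Context {V : normedModType R}.
Implicit Types (A : set V) (f g : V -> R).

Lemma Ck_onD k A f g : open A -> Ck_on k A f -> Ck_on k A g ->
  Ck_on k A (fun x => f x + g x).
Proof.
move=> oA; elim: k f g => [|k IH] f g /=.
  by move=> fA gA x Ax; apply: continuousD; [exact: fA|exact: gA].
move=> [df Df] [dg Dg]; split=> [x Ax|v].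
  by apply: differentiableD; [exact: df|exact: dg].
apply: Ck_on_eq (IH _ _ (Df v) (Dg v)) => // x Ax.
by rewrite -deriveD//; apply: diff_derivable; [exact: df|exact: dg].
Qed.

Lemma Ck_onM k A f g : open A -> Ck_on k A f -> Ck_on k A g ->
  Ck_on k A (fun x => f x * g x).
Proof.
move=> oA; elim: k f g => [|k IH] f g.
  by move=> fA gA x Ax; apply: continuousM; [exact: fA|exact: gA].
move=> kf kg; have [df Df] := kf; have [dg Dg] := kg; split=> [x Ax|v].
  by apply: differentiableM; [exact: df|exact: dg].
have /(Ck_onD oA) := IH _ _ (Ck_on_pred kf) (Dg v).
move=> /(_ _ (IH _ _ (Ck_on_pred kg) (Df v))).
apply: Ck_on_eq => // x Ax.
by rewrite -[RHS]/('D_v (f * g) x) deriveM//; apply: diff_derivable; [exact: df|exact: dg].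
Qed.

Lemma Ck_onV k A f : open A -> (forall x, A x -> f x != 0) -> Ck_on k A f ->
  Ck_on k A (fun x => (f x)^-1).
Proof.
move=> oA f0; elim: k f f0 => [|k IH] f f0.
  by move=> fA x Ax; apply: continuousV; [exact: f0|exact: fA].
move=> kf; have [df Df] := kf; split=> [x Ax|v].
  by apply: differentiableV; [exact: df|exact: f0].
have If := IH _ f0 (Ck_on_pred kf).
have := Ck_onM oA (Ck_on_cst (W := R) k A (-1)) (Ck_onM oA (Ck_onM oA If If) (Df v)).
apply: Ck_on_eq => // x Ax.
rewrite deriveV ?f0//; last by apply: diff_derivable; exact: df.
by rewrite /cst -exprVn expr2 mulN1r scaleNr.
Qed.

Lemma Ck_onN k A f : open A -> Ck_on k A f -> Ck_on k A (fun x => - f x).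
Proof.
move=> oA kf; apply: Ck_on_eq (Ck_onM oA (Ck_on_cst (W := R) k A (-1)) kf) => // x _.
by rewrite /cst mulN1r.
Qed.

Lemma Ck_on_sum k A (I : Type) (r : seq I) (P : pred I) (f : I -> V -> R) : open A ->
  (forall i, P i -> Ck_on k A (f i)) -> Ck_on k A (fun x => \sum_(i <- r | P i) f i x).
Proof.
move=> oA kf; elim: r => [|i r IH].
  by apply: Ck_on_eq (Ck_on_cst (W := R) k A 0) => // x _; rewrite big_nil.
have [Pi|Pi] := boolP (P i); last first.
  by apply: Ck_on_eq IH => // x _; rewrite big_cons (negbTE Pi).
by apply: Ck_on_eq (Ck_onD oA (kf i Pi) IH) => // x _; rewrite big_cons Pi.
Qed.

End Scalar.

Section Composition.
Context {U V : normedModType R}.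

(** A map whose differential is the same linear map at every point: an affine
    substitution, such as freezing one argument or restricting to a line. *)
Lemma Ck_on_affine k (A : set U) (B : set V) (f : V -> R) (g L : U -> V) :
  open A -> (forall x, is_diff x g L) -> (forall x, A x -> B (g x)) ->
  Ck_on k B f -> Ck_on k A (f \o g).
Proof.
move=> oA dg AB; have dgx x : differentiable g x by case: (dg x).
elim: k f => [|k IH] f.
  move=> fB x Ax; apply: continuous_comp; last exact/fB/AB.
  exact: differentiable_continuous.
move=> [df Df]; split=> [x Ax|v].
  by apply: differentiable_comp; [exact: dgx|exact/df/AB].
apply: Ck_on_eq (IH _ (Df (L v))) => // x Ax /=.
rewrite deriveE; last exact/df/AB.
rewrite deriveE; last by apply: differentiable_comp; [exact: dgx|exact/df/AB].
rewrite [in RHS]diff_comp/=; [|exact: dgx|exact/df/AB].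
by rewrite (@diff_val _ _ _ _ _ _ _ (dg x)).
Qed.

Lemma diff_row n (f : 'rV[R]_n -> R) x w :
  'd f x w = \sum_i w 0 i * 'd f x (delta_mx 0 i).
Proof.
by rewrite {1}(row_sum_delta w) linear_sum; apply: eq_bigr => i _; rewrite linearZ.
Qed.

Lemma derive_row n (f : 'rV[R]_n -> R) x w : differentiable f x ->
  'D_w f x = \sum_i w 0 i * 'D_(delta_mx 0 i) f x.
Proof. by move=> df; rewrite deriveE// diff_row; apply: eq_bigr => i _; rewrite deriveE. Qed.

End Composition.

Section CompositionRow.
Context {U : normedModType R} {n : nat}.

Lemma differentiable_row (A : U -> 'rV[R]_n) x :
  (forall i, differentiable (fun y => A y 0 i) x) -> differentiable A x.
Proof.
move=> dA; have -> : A = (fun y => \sum_i (A y 0 i) *: (delta_mx 0 i : 'rV[R]_n)).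
  by apply/funext => y; rewrite -row_sum_delta.
have -> : (fun y => \sum_i (A y 0 i) *: (delta_mx 0 i : 'rV[R]_n)) =
  (\sum_i (fun y => (A y 0 i) *: (delta_mx 0 i : 'rV[R]_n))).
  by apply/funext => y; rewrite fct_sumE.
by apply: differentiable_sum => i; apply: differentiableZl.
Qed.

Lemma derive_coord (A : U -> 'rV[R]_n) x v i : derivable A x v ->
  ('D_v A x) 0 i = 'D_v (fun y => A y 0 i) x.
Proof. by move=> dA; rewrite derive_mx// mxE. Qed.

Lemma Ck_on_coord k (A : set U) (f : U -> 'rV[R]_n) : open A ->
  (forall i, Ck_on k A (fun y => f y 0 i)) <-> Ck_on k A f.
Proof.
move=> oA; elim: k f => [|k IH] f.
  split=> fA; last first.
    move=> i x Ax; have fx := fA x Ax.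
    exact: (@continuous_comp _ _ _ f (fun M : 'rV[R]_n => M 0 i) x fx (@coord_continuous R _ _ 0 i _)).
  move=> x Ax; apply/cvgrPdist_lt => e e0.
  have : \forall y \near x, forall i, `|f x 0 i - f y 0 i| < e.
    by apply: filter_forall => i; have /cvgrPdist_lt := fA i x Ax; exact.
  apply: filterS => y H; rewrite [ltLHS]/Num.Def.normr/= mx_normrE.
  by apply/bigmax_ltP; split=> // -[i j] _; rewrite !mxE ord1; exact: H.
split=> [kf|[df Df] i].
  have df x : A x -> differentiable f x.
    by move=> Ax; apply: differentiable_row => i; have [df _] := kf i; exact: df.
  split=> // v; apply/IH => i; have [_ Df] := kf i.
  apply: Ck_on_eq (Df v) => // x Ax.
  by rewrite derive_coord//; apply: diff_derivable; exact: df.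
split=> [x Ax|v].
  apply: (@differentiable_comp _ _ _ _ f (fun M : 'rV[R]_n => M 0 i)); first exact: df.
  exact: differentiable_coord.
move/IH : (Df v) => /(_ i); apply: Ck_on_eq => // x Ax.
by rewrite derive_coord//; apply: diff_derivable; exact: df.
Qed.

(** Chain rule in coordinates: each derivative of the composite is a sum of
    products of first derivatives of g with composites of first derivatives of
    f, so the order of differentiability goes up by induction. *)
Lemma Ck_on_comp_scalar k (A : set U) (B : set 'rV[R]_n) (f : 'rV[R]_n -> R) (g : U -> 'rV[R]_n) :
  open A -> (forall x, A x -> B (g x)) ->
  Ck_on k B f -> Ck_on k A g -> Ck_on k A (f \o g).
Proof.
move=> oA AB; elim: k f => [|k IH] f.
  move=> fB gA x Ax; apply: continuous_comp; first exact: gA.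
  exact/fB/AB.
move=> [df Df] kg; have [dg Dg] := kg; split=> [x Ax|v].
  by apply: differentiable_comp; [exact: dg|exact/df/AB].
have : Ck_on k A (fun x => \sum_i ('D_v g x) 0 i * ('D_(delta_mx 0 i) f \o g) x).
  apply: Ck_on_sum => // i _; apply: Ck_onM => //.
    by move/(Ck_on_coord _ _ oA) : (Dg v).
  by apply: IH; [exact: Df|exact: Ck_on_pred].
apply: Ck_on_eq => // x Ax.
rewrite [RHS]deriveE; last by apply: differentiable_comp; [exact: dg|exact/df/AB].
rewrite [in RHS]diff_comp; [|exact: dg|exact/df/AB].
rewrite /= diff_row; apply: eq_bigr => i _; congr (_ * _).
  by rewrite deriveE; [|exact: dg].
by rewrite deriveE//; exact/df/AB.
Qed.

End CompositionRow.

Lemma Ck_on_comp (U : normedModType R) n k m (A : set U) (B : set 'rV[R]_n) (f : 'rV[R]_n -> 'rV[R]_m) (g : U -> 'rV[R]_n) :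
  open A -> open B -> (forall x, A x -> B (g x)) ->
  Ck_on k B f -> Ck_on k A g -> Ck_on k A (f \o g).
Proof.
move=> oA oB AB /(Ck_on_coord _ _ oB) kf kg; apply/Ck_on_coord => // i.
exact: (@Ck_on_comp_scalar _ _ k A B (fun y => f y 0 i)).
Qed.

End CkCalculus.

(** * Restriction to lines and symmetry of second derivatives *)

Section Lines.
Context {R : realType} {V W : normedModType R}.

Lemma growth_line (f : V -> W) (x v : V) (t h : R) :
  f (x + (h *: (1 : R) + t) *: v) = f (h *: v + (x + t *: v)).
Proof. by rewrite scaler1 scalerDl addrCA. Qed.

Lemma derive_line (f : V -> W) (x v : V) (t : R) :
  'D_1 (fun s : R => f (x + s *: v)) t = 'D_v f (x + t *: v).
Proof.
rewrite /derive; set g1 := fun h => h^-1 *: _; set g2 := fun h => h^-1 *: _.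
suff -> : g1 = g2 by [].
by apply/funext => h; rewrite /g1 /g2 /= growth_line.
Qed.

Lemma derivable_line (f : V -> W) (x v : V) (t : R) :
  derivable f (x + t *: v) v -> derivable (fun s : R => f (x + s *: v)) t 1.
Proof.
rewrite /derivable; set g1 := fun h => h^-1 *: _; set g2 := fun h => h^-1 *: _.
suff -> : g1 = g2 by [].
by apply/funext => h; rewrite /g1 /g2 /= growth_line.
Qed.

End Lines.

Lemma mean_value_line (R : realType) (V : normedModType R) (f : V -> R) (x v : V) :
  (forall t : R, 0 <= t <= 1 -> derivable f (x + t *: v) v) ->
  exists2 t : R, 0 < t < 1 & f (x + v) - f x = 'D_v f (x + t *: v).
Proof.
move=> df; pose g (s : R) : R := f (x + s *: v).
have dg s : 0 <= s <= 1 -> derivable g s 1 by move=> /df/derivable_line.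
have [s||t] := @MVT R g (fun s => 'D_v f (x + s *: v)) 0 1 ltr01.
- rewrite in_itv/= => /andP[s0 s1]; apply: DeriveDef; last exact: derive_line.
  by apply: dg; rewrite !ltW.
- have : {within `[0, 1], continuous g}.
    by apply: derivable_within_continuous => s; rewrite in_itv/=; exact: dg.
  exact.
rewrite in_itv/= => t01; rewrite /g scale1r scale0r addr0 subr0 mulr1 => H.
by exists t.
Qed.

(** Schwarz: both mixed derivatives are the limit of the second difference of f
    along v and w, which is symmetric in v and w. *)
Lemma derive_swap (R : realType) (V : normedModType R) (A : set V) (f : V -> R) (x v w : V) :
  open A -> A x -> Ck_on 2 A f -> 'D_v ('D_w f) x = 'D_w ('D_v f) x.
Proof.
move=> oA Ax [df Df].
have S u z (e : R) : 0 < e -> \forall h \near (0:R)^'+,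
  `|(f (x + h *: u + h *: z) - f (x + h *: u) - f (x + h *: z) + f x) - h ^+ 2 * 'D_z ('D_u f) x|
    <= e * h ^+ 2.
  move=> e0.
  have [Dd _] := Df u; have {Dd} Dd := Dd x Ax.
  set C := `|u| + `|z| + 1.
  have C0 : 0 < C by rewrite /C ltr_wpDl// addr_ge0.
  have eC0 : 0 < e / (C *+ 2) by rewrite divr_gt0// mulrn_wgt0.
  have /nbhs_ballP[r/= r0 Br] := diff_eps Dd eC0.
  have [s/= s0 Bs] : exists2 s : R, 0 < s & forall k, `|k| < s -> A (x + k).
    have /nbhs_ballP[s/= s0 Bs] : nbhs x A by exact: open_nbhs_nbhs.
    exists s => // k ks; apply: Bs; rewrite -ball_normE/= opprD addNKr normrN//.
  near=> h.
  have h0 : 0 < h by near: h; exact: nbhs_right_gt.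
  have hr : h * C < Num.min r s.
    rewrite -ltr_pdivlMr//; near: h; apply: nbhs_right_lt.
    by rewrite divr_gt0// lt_min r0 s0.
  move: hr; rewrite lt_min => /andP[hr hs].
  have small (t a : R) : 0 <= t <= 1 -> 0 <= a <= 1 -> `|t *: (h *: u) + a *: (h *: z)| <= h * C.
    move=> /andP[t0 t1] /andP[a0 a1]; rewrite (le_trans (ler_normD _ _))// !normrZ.
    rewrite !ger0_norm ?(ltW h0)// /C.
    have := normr_ge0 u; have := normr_ge0 z => ? ?.
    apply: (@le_trans _ _ (1 * (h * `|u|) + 1 * (h * `|z|))).
      by rewrite lerD// ler_wpM2r// mulr_ge0// ltW.
    by nra.
  pose g y := f (y + h *: z) - f y.
  have Asm (t a : R) : 0 <= t <= 1 -> 0 <= a <= 1 -> A (x + t *: (h *: u) + a *: (h *: z)).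
    move=> t01 a01; rewrite -addrA; apply: Bs; apply: le_lt_trans (small _ _ t01 a01) hs.
  have i01 : 0 <= (1 : R) <= 1 by rewrite ler01 lexx.
  have i00 : 0 <= (0 : R) <= 1 by rewrite ler01 lexx.
  have fsh y a : differentiable f (y + a) -> is_diff y (fun y => f (y + a)) ('d f (y + a)).
    move=> dfy; apply: eps_is_diff; first exact: diff_continuous.
    by move=> e' e'0; have := diff_eps dfy e'0; apply: filterS => k; rewrite addrA.
  have dfsh y a q : differentiable f (y + a) -> 'D_q (fun y => f (y + a)) y = 'D_q f (y + a).
    by move=> dfy; have [d1 d2] := fsh _ _ dfy; rewrite deriveE// d2 deriveE.
  have [] := @mean_value_line R V g x (h *: u).
    move=> t t01; apply: diff_derivable; apply: differentiableB.
      have /fsh[] // : differentiable f (x + t *: (h *: u) + h *: z).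
      by apply: df; have := Asm t 1 t01 i01; rewrite scale1r.
    by apply: df; have := Asm t 0 t01 i00; rewrite scale0r addr0.
  move=> t t01'; have t01 : 0 <= t <= 1 by case/andP: t01' => ? ?; rewrite !ltW.
  set y := x + t *: (h *: u).
  have dy1 : differentiable f (y + h *: z).
    by apply: df; have := Asm t 1 t01 i01; rewrite scale1r.
  have dy : differentiable f y by apply: df; have := Asm t 0 t01 i00; rewrite scale0r addr0.
  have -> : 'D_(h *: u) g y = h * ('D_u f (y + h *: z) - 'D_u f y).
    have [d1 d2] := fsh _ _ dy1.
    rewrite /g deriveB; [|exact: diff_derivable|exact: diff_derivable].
    by rewrite dfsh// !deriveE// !linearZ/= -scalerDr.
  rewrite /g => H.
  have -> : f (x + h *: u + h *: z) - f (x + h *: u) - f (x + h *: z) + f x =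
    h * ('D_u f (y + h *: z) - 'D_u f y) by rewrite -H; ring.
  pose k1 := t *: (h *: u) + 1 *: (h *: z); pose k2 := t *: (h *: u) + 0 *: (h *: z).
  have b1 : `|k1| <= h * C by exact: small.
  have b2 : `|k2| <= h * C by exact: small.
  have := Br k1; rewrite -ball_normE/= sub0r normrN => /(_ (le_lt_trans b1 hr)).
  have := Br k2; rewrite -ball_normE/= sub0r normrN => /(_ (le_lt_trans b2 hr)).
  have -> : k1 + x = y + h *: z by rewrite /k1 /y scale1r addrC addrA.
  have -> : k2 + x = y by rewrite /k2 /y scale0r addr0 addrC.
  have -> : 'D_z ('D_u f) x = 'd ('D_u f) x z by rewrite deriveE.
  have -> : 'd ('D_u f) x k1 = t * (h * 'd ('D_u f) x u) + h * 'd ('D_u f) x z.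
    by rewrite /k1 scale1r linearD !linearZ.
  have -> : 'd ('D_u f) x k2 = t * (h * 'd ('D_u f) x u).
    by rewrite /k2 scale0r addr0 !linearZ.
  set a := 'D_u f (y + h *: z); set b := 'D_u f y; set c := 'D_u f x.
  set p := 'd _ x u; set q := 'd _ x z => H2 H1.
  have E1 : e / (C *+ 2) * `|k1| <= e * h / 2.
    apply: (@le_trans _ _ (e / (C *+ 2) * (h * C))); first by rewrite ler_pM2l.
    by rewrite le_eqVlt; apply/orP; left; apply/eqP; rewrite -mulr_natr; field; rewrite gt_eqF.
  have E2 : e / (C *+ 2) * `|k2| <= e * h / 2.
    apply: (@le_trans _ _ (e / (C *+ 2) * (h * C))); first by rewrite ler_pM2l.
    by rewrite le_eqVlt; apply/orP; left; apply/eqP; rewrite -mulr_natr; field; rewrite gt_eqF.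
  have K : `|a - b - h * q| <= e * h.
    have -> : a - b - h * q = (a - c - (t * (h * p) + h * q)) - (b - c - t * (h * p)) by ring.
    rewrite (le_trans (ler_normB _ _))//; lra.
  have -> : h * (a - b) - h ^+ 2 * q = h * (a - b - h * q) by ring.
  by rewrite normrM gtr0_norm// expr2 mulrCA ler_pM2l.
apply/eqP; rewrite -subr_eq0 -normr_eq0; apply/eqP/le_anti/andP; split=> //.
apply/ler_addgt0Pl => e e0; rewrite addr0.
have e20 : 0 < e / 2 by rewrite divr_gt0.
have S1 := S v w _ e20; have S2 := S w v _ e20.
have [h [/= H1 [/= H2 /= h0]]] := filter_ex (filterI S1 (filterI S2 (nbhs_right_gt (0 : R)))).
have E : x + h *: w + h *: v = x + h *: v + h *: w by exact: addrAC.
move: H1 H2; rewrite {}E.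
set a := f (_ + _ + _); set b := f (x + h *: v); set c := f (x + h *: w).
set p := 'D_w _ x; set q := 'D_v _ x => H1 H2.
have h20 : 0 < h ^+ 2 by rewrite exprn_gt0.
rewrite -(ler_pM2l h20) -{1}(gtr0_norm h20) -normrM.
have -> : h ^+ 2 * (q - p) = (a - b - c + f x - h ^+ 2 * p) - (a - c - b + f x - h ^+ 2 * q) by ring.
rewrite (le_trans (ler_normB _ _))// (le_trans (lerD H1 H2))// -mulrDl -splitr.
by rewrite mulrC.
Unshelve. all: by end_near. Qed.

(** * Norm and compactness in spaces of matrices *)

Section MatrixNorm.
Context {R : realType}.

Lemma mx_subE m n (A B : 'M[R]_(m, n)) i j : (A - B) i j = A i j - B i j.
Proof. by rewrite !mxE. Qed.

Lemma mx_norm_le m n (A : 'M[R]_(m, n)) (c : R) : 0 <= c -> (forall i j, `|A i j| <= c) -> `|A| <= c.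
Proof.
by move=> c0 Ac; rewrite [leLHS]/Num.Def.normr/= mx_normrE (bigmax_le _ c0).
Qed.

Lemma entry_le_norm m n (A : 'M[R]_(m, n)) i j : `|A i j| <= `|A|.
Proof.
by rewrite [leRHS]/Num.Def.normr/= mx_normrE; exact: (le_bigmax _ (fun ij => `|A ij.1 ij.2|) (i, j)).
Qed.

Lemma mx_norm_mul m n p (A : 'M[R]_(m, n)) (B : 'M[R]_(n, p)) : `|A *m B| <= n%:R * `|A| * `|B|.
Proof.
apply: mx_norm_le => [|i j]; first by rewrite !mulr_ge0.
rewrite mxE (le_trans (ler_norm_sum _ _ _))//.
apply: (@le_trans _ _ (\sum_(k < n) `|A| * `|B|)).
  by apply: ler_sum => k _; rewrite normrM ler_pM// entry_le_norm.
by rewrite sumr_const card_ord -[leRHS]mulrA [leRHS]mulr_natl.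
Qed.

Lemma closed_ball_mx_compact m n (c : R) : compact [set A : 'M[R]_(m, n) | `|A| <= c].
Proof.
pose K := [set v : 'rV[R]_(m * n) | `|v| <= c].
have cK : compact K.
  apply: bounded_closed_compact.
    exists c; split => [|M cM v /= vc]; first exact: num_real.
    exact: le_trans vc (ltW cM).
  rewrite (_ : K = (fun y => `|y|) @^-1` [set x | x <= c]); last by apply/seteqP; split.
  by apply: closed_comp => [y _|]; [exact: norm_continuous|exact: closed_le].
pose f (w : 'rV[R]_(m * n)) : 'M[R]_(m, n) := vec_mx w.
have cv : continuous f.
  move=> v A /= /nbhs_ballP[e /= e0 eA]; apply/nbhs_ballP; exists e => //= w.
  rewrite -ball_normE/= => vw; apply: eA; rewrite -ball_normE/= /f -linearB.
  by apply: le_lt_trans vw; apply: mx_norm_le => // i j; rewrite mxE entry_le_norm.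
suff <- : f @` K = [set A : 'M[R]_(m, n) | `|A| <= c].
  by apply: continuous_compact => //; apply: continuous_subspaceT.
apply/seteqP; split => [_ [v vc <-]|A /= Ac].
  by apply: le_trans vc; apply: mx_norm_le => // i j; rewrite mxE entry_le_norm.
exists (mxvec A); last exact: mxvecK.
apply: le_trans Ac; apply: mx_norm_le => // i j.
by rewrite -[A in leRHS]mxvecK; case/mxvec_indexP: j => k l; rewrite ord1 mxvecK mxvecE entry_le_norm.
Qed.

(** Bolzano-Weierstrass, in the form of a cluster point. *)
Lemma seq_cluster m n (c : R) (u : nat -> 'M[R]_(m, n)) : (forall k, `|u k| <= c) ->
  exists A, forall e N, 0 < e -> exists2 k, (N <= k)%N & `|u k - A| < e.
Proof.
move=> uc.
have [|A [_ clA]] := @closed_ball_mx_compact m n c (u @ \oo) _.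
  by exists 0%N => // k _; exact: uc.
exists A => e N e0.
have [||B [/= [k Nk <-] uA]] := clA (u @` [set k | (N <= k)%N]) [set B | `|B - A| < e].
- by apply: (filterS _ (nbhs_infty_ge N)) => k Nk; exists k.
- by apply/nbhs_ballP; exists e => //= B; rewrite -ball_normE/= distrC.
by exists k.
Qed.

Lemma sphere_mx_compact m n : compact [set A : 'M[R]_(m, n) | `|A| = 1].
Proof.
apply: (subclosed_compact _ (@closed_ball_mx_compact m n 1)) => [|A /= ->//].
rewrite (_ : [set A : 'M[R]_(m, n) | `|A| = 1] = (fun y : 'M[R]_(m, n) => `|y|) @^-1` [set 1]); last by apply/seteqP; split.
apply: closed_comp => [y _|]; first exact: norm_continuous.
by apply: accessible_closed_set1; apply: hausdorff_accessible; exact: norm_hausdorff.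
Qed.

End MatrixNorm.

(** * Determinants in the plane and functions of one variable *)

Lemma ord2P (i : 'I_2) : i = 0 \/ i = 1.
Proof. by case: i => -[|[|//]] ?; [left|right]; apply/val_inj. Qed.

Lemma sum_ord2 (V : nmodType) (F : 'I_2 -> V) : \sum_i F i = F 0 + F 1.
Proof. by rewrite big_ord_recl big_ord1; congr (_ + F _); apply/val_inj. Qed.

Section Plane.
Context {R : realType}.
Implicit Types u v w h : 'rV[R]_2.

Definition det2 u v : R := u 0 0 * v 0 1 - u 0 1 * v 0 0.

Lemma det2_decomp u h w : det2 u h != 0 ->
  w = (det2 w h / det2 u h) *: u + (det2 u w / det2 u h) *: h.
Proof.
move=> d0; apply/rowP => i; rewrite !mxE.
have [->|->] := ord2P i.
  by rewrite /det2 in d0 *; field.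
by rewrite /det2 in d0 *; field.
Qed.

Lemma det2_lin u h (t : R) : det2 (u + t *: h) h = det2 u h.
Proof. by rewrite /det2 !mxE; ring. Qed.

Lemma det2_neq0l u h : det2 u h != 0 -> u != 0.
Proof. by apply: contraNneq => ->; rewrite /det2 !mxE; apply/eqP; ring. Qed.

Lemma det2_neq0r u h : det2 u h != 0 -> h != 0.
Proof. by apply: contraNneq => ->; rewrite /det2 !mxE; apply/eqP; ring. Qed.

Lemma det2C u h : det2 u h = - det2 h u.
Proof. by rewrite /det2; ring. Qed.

Lemma line_neq0 u h (t : R) : det2 u h != 0 -> u + t *: h != 0.
Proof. by rewrite -(det2_lin u h t); exact: det2_neq0l. Qed.

Lemma row2_eq0 u : (u == 0) = (u 0 0 == 0) && (u 0 1 == 0).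
Proof.
apply/eqP/andP => [->|[/eqP a /eqP b]]; first by rewrite !mxE eqxx.
apply/rowP => i; rewrite !mxE.
by have [->|->] := ord2P i.
Qed.

Lemma exists_indep u : u != 0 -> exists h, det2 u h != 0.
Proof.
move=> u0; exists (\row_i if i == 0 then - u 0 1 else u 0 0).
rewrite /det2 !mxE/= mulrN opprK -!expr2.
apply: contraNneq u0 => /eqP.
by rewrite paddr_eq0 ?sqr_ge0// !sqrf_eq0 -row2_eq0.
Qed.

Lemma det2_dep u w v : u != 0 -> w != 0 -> det2 u w = 0 -> det2 u v != 0 -> det2 w v != 0.
Proof.
move=> u0 w0; rewrite /det2 => uw uv; apply: contraNneq w0 => wv.
have e1 : (u 0 0 * v 0 1 - u 0 1 * v 0 0) * w 0 0 = 0.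
  transitivity (u 0 0 * (w 0 0 * v 0 1 - w 0 1 * v 0 0) + v 0 0 * (u 0 0 * w 0 1 - u 0 1 * w 0 0)); first by ring.
  by rewrite wv uw !mulr0 addr0.
have e2 : (u 0 0 * v 0 1 - u 0 1 * v 0 0) * w 0 1 = 0.
  transitivity (u 0 1 * (w 0 0 * v 0 1 - w 0 1 * v 0 0) + v 0 1 * (u 0 0 * w 0 1 - u 0 1 * w 0 0)); first by ring.
  by rewrite wv uw !mulr0 addr0.
rewrite row2_eq0; move/eqP: e1; move/eqP : e2; rewrite !mulf_eq0 (negbTE uv)/=.
by move=> -> ->.
Qed.

End Plane.

Section OneVariable.
Context {R : realType}.
Implicit Types f g : R -> R.

(** Global derivatives of real functions, in a form in which derivatives of
    composite expressions are computed by applying lemmas. *)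
Definition der f f' := forall t : R, is_derive t 1 f (f' t).

Lemma derD f f' g g' : der f f' -> der g g' -> der (fun t => f t + g t) (fun t => f' t + g' t).
Proof. by move=> df dg t; have := df t; have := dg t => ? ?; exact: is_deriveD. Qed.

Lemma derB f f' g g' : der f f' -> der g g' -> der (fun t => f t - g t) (fun t => f' t - g' t).
Proof. by move=> df dg t; have := df t; have := dg t => ? ?; exact: is_deriveB. Qed.

Lemma derM f f' g g' : der f f' -> der g g' ->
  der (fun t => f t * g t) (fun t => f' t * g t + f t * g' t).
Proof.
move=> df dg t; have := df t; have := dg t => ? ?.
by apply: is_derive_eq (is_deriveM _ _) _; rewrite /GRing.scale/= addrC mulrC.
Qed.

Lemma derC (c : R) : der (fun=> c) (fun=> 0).
Proof. by move=> t; exact: is_derive_cst. Qed.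

Lemma der_id : der id (fun=> 1).
Proof. by move=> t; exact: is_derive_id. Qed.

Lemma derV f f' : (forall t, f t != 0) -> der f f' ->
  der (fun t => (f t)^-1) (fun t => - f' t / f t ^+ 2).
Proof.
move=> f0 df t; have [d1 d2] := df t; apply: DeriveDef; first exact: derivableV.
by rewrite deriveV// d2 /GRing.scale/= mulNr mulrC mulNr.
Qed.

Lemma der_ext f g f' g' : der f f' -> (forall t, f t = g t) -> (forall t, f' t = g' t) -> der g g'.
Proof. by move=> d /funext <- /funext <-. Qed.

Lemma der_cont f f' : der f f' -> continuous f.
Proof.
by move=> df t; apply: differentiable_continuous; apply/derivable1_diffP; have [] := df t.
Qed.

Lemma der0_cst f : der f (fun=> 0) -> forall s t, f s = f t.
Proof. by move=> df s t; apply: is_derive_0_is_cst => x; exact: df. Qed.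

Lemma der_max f f' t : der f f' -> (forall s, f s <= f t) -> f' t = 0.
Proof.
move=> df fmax; have [_ <-] := df t.
by have [] : is_derive t 1 f 0;
  first by apply: (@derive1_at_max R f (t - 1) (t + 1)) => [|s _||s _];
    [lra|have [] := df s|rewrite in_itv/=; lra|exact: fmax].
Qed.

Lemma cont_punctured0 f t : continuous f -> (\forall s \near t^', f s = 0) -> f t = 0.
Proof.
move=> cf fs; have f0 : f @ t^' --> (0 : R) by exact: cvg_near_cst.
have ft : f @ t^' --> f t by apply: cvg_trans (cf t); apply: cvg_app; exact: nbhs_dnbhs.
exact: (cvg_unique _ ft f0).
Qed.

(** A simple zero is isolated. *)
Lemma der_punctured f f' t : der f f' -> f t = 0 -> f' t != 0 -> \forall s \near t^', f s != 0.
Proof.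
move=> df ft f't; have [d e] := df t.
have : h^-1 *: (f (h *: (1:R) + t) - f t) @[h --> (0:R)^'] --> f' t by rewrite -e; exact: d.
move=> /cvgr_neq0 => /(_ f't); rewrite ft.
move=> H0; have H : \forall h \near (0 : R), h != 0 -> h^-1 *: (f (h *: (1 : R) + t) - 0) != 0.
  exact: H0.
have : \forall s \near t, s != t -> f s != 0.
  rewrite (near_shift 0 t) subr0; apply: filterS H => h /= H hn.
  have h0 : h != 0 by apply: contra hn => /eqP ->; rewrite add0r.
  by have := H h0; rewrite subr0 [_%:A]mulr1; apply: contraNneq => ->; rewrite scaler0.
exact.
Qed.

End OneVariable.

(** * Squares of norms on the plane and their restrictions to lines *)

Section Homogeneous.
Context {R : realType}.
Implicit Types (e g : 'rV[R]_2 -> R) (y u v w h : 'rV[R]_2).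

Definition slit : set 'rV[R]_2 := [set y | y != 0].

Definition pos_homogeneous (k : nat) g :=
  forall y (a : R), y != 0 -> 0 < a -> g (a *: y) = a ^+ k * g y.

Lemma open_slit : open slit.
Proof.
rewrite /slit (_ : [set y | y != 0] = ~` [set 0]).
  by apply: closed_openC; apply: accessible_closed_set1; apply: hausdorff_accessible; exact: norm_hausdorff.
by apply/seteqP; split=> y /= /eqP.
Qed.

Lemma slit_scale y (a : R) : y != 0 -> 0 < a -> a *: y != 0.
Proof. by move=> y0 a0; rewrite scaler_eq0 negb_or y0 gt_eqF. Qed.

Lemma is_diff_scale (V : normedModType R) (a : R) (y : V) : is_diff y (fun z => a *: z) ( *:%R a).
Proof. exact: is_diff_scaler. Qed.

Lemma derive_pos_homogeneous k g v : (forall y, y != 0 -> differentiable g y) ->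
  pos_homogeneous k.+1 g -> pos_homogeneous k ('D_v g).
Proof.
move=> dg hg y a y0 a0.
have d1 : 'D_v (fun z => g (a *: z)) y = a * 'D_v g (a *: y).
  have dga : differentiable g (a *: y) by apply/dg/slit_scale.
  have [da ea] := is_diff_scale a y.
  rewrite deriveE; last exact: (@differentiable_comp _ _ _ _ (fun z => a *: z) g y).
  rewrite (_ : (fun z => g (a *: z)) = g \o ( *:%R a)); last by [].
  rewrite [in LHS]diff_comp// /= ea linearZ/= deriveE//.
have : 'D_v (fun z => g (a *: z)) y = 'D_v (fun z => a ^+ k.+1 * g z) y.
  by apply: (@open_derive_eq _ _ _ slit) => //; [exact: open_slit|move=> z z0; exact: hg].
rewrite d1 [RHS](_ : _ = a ^+ k.+1 * 'D_v g y).
  by rewrite exprS -mulrA => /mulfI; apply; rewrite gt_eqF.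
by rewrite -[LHS]/('D_v (a ^+ k.+1 *: g) y) deriveZ//; apply/diff_derivable/dg.
Qed.

Lemma euler_homogeneous k g y : pos_homogeneous k g -> y != 0 ->
  'D_y g y = k%:R * g y.
Proof.
move=> hg y0.
have -> : 'D_y g y = 'D_1 (fun s : R => g (y + s *: y)) 0.
  by rewrite derive_line scale0r addr0.
have -> : 'D_1 (fun s : R => g (y + s *: y)) 0 = 'D_1 (fun s : R => (1 + s) ^+ k * g y) 0.
  apply: near_eq_derive; near=> s; rewrite -{1}(scale1r y) -scalerDl hg//.
  rewrite -ltrBlDl sub0r; near: s; apply: lt_nbhsr; exact: ltrN10.
have d1 : is_derive (0 : R) 1 (fun s : R => 1 + s) 1.
  by apply: is_derive_eq (is_deriveD _ _) _; rewrite add0r.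
have -> : (fun s : R => (1 + s) ^+ k * g y) = g y *: ((fun s : R => 1 + s) ^+ k).
  by apply/funext => s; rewrite mulrC !fctE.
have [_ ->] := is_deriveZ (g y) (is_deriveX k d1).
by rewrite addr0 expr1n /GRing.scale/= !mulr1 mulrC.
Unshelve. all: by end_near. Qed.

(** Squares of Minkowski norms: the last condition is the positive
    definiteness of the fundamental tensor. *)
Definition norm_sq e := [/\ smooth_on slit e, pos_homogeneous 2 e &
  forall y u, y != 0 -> u != 0 -> 0 < 'D_u ('D_u e) y].

Section NormSq.
Variables (e : 'rV[R]_2 -> R) (he : norm_sq e).

Let es k : Ck_on k slit e. Proof. by have [+ _ _] := he; apply. Qed.

Lemma norm_sq_diff y : y != 0 -> differentiable e y.
Proof. by have [+ _] := es 1; apply. Qed.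

Lemma norm_sq_diff1 v y : y != 0 -> differentiable ('D_v e) y.
Proof. by have [_ /(_ v)[+ _]] := es 2; apply. Qed.

Lemma norm_sq_diff2 v w y : y != 0 -> differentiable ('D_v ('D_w e)) y.
Proof. by have [_ /(_ w)[_ /(_ v)[+ _]]] := es 3; apply. Qed.

Lemma euler_sq y : y != 0 -> 'D_y e y = 2 * e y.
Proof. by have [_ + _] := he => /euler_homogeneous; apply. Qed.

Lemma derive_hom v : pos_homogeneous 1 ('D_v e).
Proof. by apply: derive_pos_homogeneous; [exact: norm_sq_diff|have [] := he]. Qed.

Lemma hess_hom v w : pos_homogeneous 0 ('D_v ('D_w e)).
Proof. by apply: derive_pos_homogeneous; [exact: norm_sq_diff1|exact: derive_hom]. Qed.

Definition hess y v w : R := 'D_v ('D_w e) y.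

Lemma hess_pos y u : y != 0 -> u != 0 -> 0 < hess y u u.
Proof. by have [_ _] := he; apply. Qed.

Lemma hessC y v w : y != 0 -> hess y v w = hess y w v.
Proof. by move=> y0; exact: (derive_swap _ _ open_slit y0 (es 2)). Qed.

Lemma hessDl y v v' w : y != 0 -> hess y (v + v') w = hess y v w + hess y v' w.
Proof.
by move=> y0; rewrite /hess !deriveE ?linearD//; exact: norm_sq_diff1.
Qed.

Lemma hessZl y (a : R) v w : y != 0 -> hess y (a *: v) w = a * hess y v w.
Proof. by move=> y0; rewrite /hess !deriveE ?linearZ//; exact: norm_sq_diff1. Qed.

Lemma hessDr y v w w' : y != 0 -> hess y v (w + w') = hess y v w + hess y v w'.
Proof. by move=> y0; rewrite !(hessC v)// hessDl. Qed.

Lemma hessZr y (a : R) v w : y != 0 -> hess y v (a *: w) = a * hess y v w.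
Proof. by move=> y0; rewrite !(hessC v)// hessZl. Qed.

Lemma hess_euler y v : y != 0 -> hess y y v = 'D_v e y.
Proof. by move=> y0; rewrite /hess (euler_homogeneous (@derive_hom v) y0) mul1r. Qed.

Lemma norm_sq_gt0 y : y != 0 -> 0 < e y.
Proof.
move=> y0; have := hess_pos y0 y0; rewrite hess_euler// euler_sq//.
by rewrite pmulr_rgt0.
Qed.

Lemma deriveDv y u v : y != 0 -> 'D_(u + v) e y = 'D_u e y + 'D_v e y.
Proof. by move=> y0; rewrite !deriveE ?linearD//; exact: norm_sq_diff. Qed.

Lemma deriveZv y (a : R) v : y != 0 -> 'D_(a *: v) e y = a * 'D_v e y.
Proof. by move=> y0; rewrite !deriveE ?linearZ//; exact: norm_sq_diff. Qed.

Lemma hess_scale y (a : R) v w : y != 0 -> 0 < a -> hess (a *: y) v w = hess y v w.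
Proof. by move=> y0 a0; rewrite /hess hess_hom// mul1r. Qed.

Lemma hessE y v w : hess y v w = 'D_v ('D_w e) y. Proof. by []. Qed.

#[local] Opaque hess.

Lemma hess_bil y (a b c d : R) p q : y != 0 ->
  hess y (a *: p + b *: q) (c *: p + d *: q) =
  a * c * hess y p p + (a * d + b * c) * hess y p q + b * d * hess y q q.
Proof.
move=> y0; rewrite (hessDl _ _ _ y0) !(hessZl _ _ _ y0) !(hessDr _ _ _ y0) !(hessZr _ _ _ y0) (hessC q p y0).
move: (hess y p p) (hess y p q) (hess y q q) => P Q S; ring.
Qed.

Definition e1 : 'rV[R]_2 := delta_mx 0 0.
Definition e2 : 'rV[R]_2 := delta_mx 0 1.

Lemma e1_neq0 : e1 != 0.
Proof. by apply/eqP => /rowP/(_ 0); rewrite !mxE/= => /eqP; rewrite oner_eq0. Qed.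

Lemma e2_neq0 : e2 != 0.
Proof. by apply/eqP => /rowP/(_ 1); rewrite !mxE/= => /eqP; rewrite oner_eq0. Qed.

Lemma row2E u : u = u 0 0 *: e1 + u 0 1 *: e2.
Proof.
by rewrite {1}(row_sum_delta u) sum_ord2.
Qed.

(** The determinant of the Hessian in the standard basis; the Gram determinant
    in any basis is a multiple of it, see [gramE]. *)
Definition disc y : R := hess y e1 e1 * hess y e2 e2 - hess y e1 e2 ^+ 2.

Lemma gramE y u h : y != 0 ->
  hess y u u * hess y h h - hess y u h ^+ 2 = det2 u h ^+ 2 * disc y.
Proof.
move=> y0; rewrite /det2 /disc.
have E v w : hess y v w = v 0 0 * w 0 0 * hess y e1 e1 + (v 0 0 * w 0 1 + v 0 1 * w 0 0) * hess y e1 e2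
    + v 0 1 * w 0 1 * hess y e2 e2.
  rewrite {1}(row2E v) {1}(row2E w); exact: hess_bil.
rewrite (E u u) (E h h) (E u h).
move: (hess y e1 e1) (hess y e1 e2) (hess y e2 e2) => P Q S; ring.
Qed.

Section Line.
Variables (u h : 'rV[R]_2) (uh : det2 u h != 0).

Let y (t : R) := u + t *: h.
Let y0 t : y t != 0. Proof. exact: line_neq0. Qed.

(** The n-th derivative of t |-> e (u + t h). *)
Definition phi n (t : R) : R := iter n (fun g => 'D_h g) e (u + t *: h).

Lemma phi_Ck n k : Ck_on k slit (iter n (fun g => 'D_h g) e).
Proof.
elim: n k => [|n IH] k; first exact: es.
by have [_ /(_ h)] := IH k.+1.
Qed.

Lemma der_line g : (forall z, z != 0 -> differentiable g z) ->
  der (fun t => g (u + t *: h)) (fun t => 'D_h g (u + t *: h)).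
Proof.
move=> dg t; apply: DeriveDef; last exact: derive_line.
by apply/derivable_line/diff_derivable/dg/y0.
Qed.

Lemma der_phi n : der (phi n) (phi n.+1).
Proof. by apply: der_line; have [+ _] := phi_Ck n 1; apply. Qed.

Lemma phi0_gt0 t : 0 < phi 0 t. Proof. exact: norm_sq_gt0 (y0 t). Qed.

Lemma hess_hh t : hess (y t) h h = phi 2 t.
Proof. by rewrite hessE. Qed.

Lemma phi1E t : 'D_h e (y t) = phi 1 t. Proof. by []. Qed.

(** Euler's relation, solved for the derivative in the direction u. *)
Lemma derive_u t : 'D_u e (y t) = 2 * phi 0 t - t * phi 1 t.
Proof.
have : 'D_(u + t *: h) e (y t) = 2 * e (y t) by exact: euler_sq.
rewrite deriveDv// deriveZv//.
by rewrite phi1E -[e _]/(phi 0 t) => <-; rewrite addrK.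
Qed.

#[local] Opaque phi.

Lemma hess_uh t : hess (y t) u h = phi 1 t - t * phi 2 t.
Proof.
have := hess_euler h (y0 t); rewrite {2}/y hessDl// hessZl// hess_hh phi1E => <-.
by rewrite addrK.
Qed.

Lemma hess_uu t : hess (y t) u u = 2 * phi 0 t - 2 * t * phi 1 t + t ^+ 2 * phi 2 t.
Proof.
have := hess_euler u (y0 t); rewrite {2}/y hessDl// hessZl// derive_u.
by rewrite (hessC h)// hess_uh => H; rewrite -[LHS](addrK (t * (phi 1 t - t * phi 2 t))) H; ring.
Qed.

(** Up to the factor det2 u h ^+ 2, the determinant of the Hessian at u + t h.
    The Hessian in the basis (u, h) depends on phi 0, phi 1 and phi 2 only, by
    homogeneity. *)
Definition line_disc (t : R) := 2 * phi 0 t * phi 2 t - phi 1 t ^+ 2.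

Lemma line_discE t : line_disc t = det2 u h ^+ 2 * disc (y t).
Proof. by rewrite -gramE// hess_hh hess_uh hess_uu /line_disc; ring. Qed.

(** The vector - phi 1 u + (2 phi 0 - t phi 1) h spans the kernel of the
    differential of e at u + t h; the Hessian evaluated on it is
    2 phi 0 line_disc. *)
Lemma line_disc_gt0 t : 0 < line_disc t.
Proof.
have n0 : - phi 1 t *: u + (2 * phi 0 t - t * phi 1 t) *: h != 0.
  apply: contraTneq (phi0_gt0 t) => H; rewrite -leNgt.
  have D1 : det2 (- phi 1 t *: u + (2 * phi 0 t - t * phi 1 t) *: h) h = - phi 1 t * det2 u h.
    by rewrite /det2 !mxE; ring.
  have D2 : det2 u (- phi 1 t *: u + (2 * phi 0 t - t * phi 1 t) *: h) =
      (2 * phi 0 t - t * phi 1 t) * det2 u h by rewrite /det2 !mxE; ring.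
  have Z1 v : det2 0 v = 0 by rewrite /det2 !mxE; ring.
  have Z2 v : det2 v 0 = 0 by rewrite /det2 !mxE; ring.
  move/eqP: D1; rewrite H Z1 eq_sym mulf_eq0 (negbTE uh) orbF oppr_eq0 => /eqP p1.
  move/eqP: D2; rewrite H Z2 eq_sym mulf_eq0 (negbTE uh) orbF p1 mulr0 subr0 mulf_eq0.
  by rewrite pnatr_eq0/= => /eqP ->.
have := hess_pos (y0 t) n0.
rewrite hess_bil// hess_hh hess_uh hess_uu.
rewrite [ltRHS](_ : _ = 2 * phi 0 t * line_disc t); last by rewrite /line_disc; ring.
by rewrite pmulr_rgt0// pmulr_rgt0// phi0_gt0.
Qed.

Lemma der_line_disc : der line_disc (fun t => 2 * phi 0 t * phi 3 t).
Proof.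
apply: der_ext (derB (derM (derM (derC 2) (der_phi 0)) (der_phi 2)) (derM (der_phi 1) (der_phi 1))) _ _ => t.
  by rewrite /line_disc expr2.
by move: (phi 0 t) (phi 1 t) (phi 2 t) (phi 3 t) => f0 f1 f2 f3; ring.
Qed.

(** By homogeneity the Hessian on the line is determined by phi 0, phi 1 and
    phi 2, so it is constant as soon as phi 2 is. *)
Lemma hess_line : (forall t, phi 3 t = 0) -> forall s t v w, hess (y s) v w = hess (y t) v w.
Proof.
move=> p3 s t v w.
have c2 : phi 2 s = phi 2 t.
  by apply: der0_cst; apply: der_ext (der_phi 2) _ p3.
have c1 : phi 1 s - s * phi 2 s = phi 1 t - t * phi 2 t.
  apply: (der0_cst (f := fun t => phi 1 t - t * phi 2 t)).
  have D := derB (der_phi 1) (derM der_id (der_phi 2)).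
  apply: (der_ext D) => x; first exact: erefl.
  by rewrite p3; move: (phi 2 x) => f2; ring.
have c0 : 2 * phi 0 s - 2 * s * phi 1 s + s ^+ 2 * phi 2 s = 2 * phi 0 t - 2 * t * phi 1 t + t ^+ 2 * phi 2 t.
  apply: (der0_cst (f := fun t => 2 * phi 0 t - 2 * t * phi 1 t + t ^+ 2 * phi 2 t)).
  apply: der_ext (derD (derB (derM (derC 2) (der_phi 0)) (derM (derM (derC 2) der_id) (der_phi 1)))
    (derM (derM der_id der_id) (der_phi 2))) _ _ => x; first by rewrite expr2.
  by rewrite p3; ring.
rewrite (det2_decomp v uh) (det2_decomp w uh).
rewrite (hess_bil _ _ _ _ u h (y0 s)) (hess_bil _ _ _ _ u h (y0 t)).
by rewrite !hess_hh !hess_uh !hess_uu c0 c1 c2.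
Qed.

End Line.
End NormSq.
End Homogeneous.

(** * A criterion for a norm to be Euclidean *)

#[local] Opaque hess phi.

Section Spread.
Context {R : realType}.
Variables (e : 'rV[R]_2 -> R) (he : norm_sq e).

Lemma hess_cont y v w : y != 0 -> {for y, continuous (fun z => hess e z v w)}.
Proof.
move=> y0; apply: (@differentiable_continuous _ _ _ _ (fun z => hess e z v w)).
exact: (norm_sq_diff2 he).
Qed.

Lemma disc_scale y (a : R) : y != 0 -> 0 < a -> disc e (a *: y) = disc e y.
Proof. by move=> y0 a0; rewrite /disc !(hess_scale he). Qed.

(** The determinant of the Hessian is 0-homogeneous, so the unit circle suffices. *)
Lemma disc_max : exists2 y, y != 0 & forall z, z != 0 -> disc e z <= disc e y.
Proof.
have [||c /=] := @EVT_max_rV R 2 (disc e) [set y | `|y| = 1] _ (@sphere_mx_compact R 1 2).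
- exists (`|e1|^-1 *: e1) => /=.
  by rewrite normrZ normfV normr_id mulVf// normr_eq0 e1_neq0.
- apply/continuous_in_subspaceT => y; rewrite inE/= => y1.
  have y0 : y != 0 by rewrite -normr_eq0 y1 oner_eq0.
  have c v w : hess e z v w @[z --> y] --> hess e y v w by exact: (@hess_cont y v w y0).
  exact: (cvgB (cvgM (c e1 e1) (c e2 e2)) (cvgM (c e1 e2) (c e1 e2))).
rewrite inE/= => c1 cmax; exists c; first by rewrite -normr_eq0 c1 oner_eq0.
move=> z z0; have nz0 : 0 < `|z|^-1 by rewrite invr_gt0 normr_gt0.
rewrite -(disc_scale z0 nz0); apply: cmax; rewrite inE/=.
by rewrite normrZ normfV normr_id mulVf// normr_eq0.
Qed.

Definition max_disc y := y != 0 /\ forall z, z != 0 -> disc e z <= disc e y.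

Lemma max_disc_phi3 u h : det2 u h != 0 -> max_disc u -> phi e u h 3 0 = 0.
Proof.
move=> uh [u0 umax].
have : 2 * phi e u h 0 0 * phi e u h 3 0 = 0.
  apply: (der_max (t := 0) (der_line_disc he uh)) => s.
  rewrite (line_discE he uh s) (line_discE he uh 0) scale0r addr0.
  by apply: ler_wpM2l; [exact: sqr_ge0|exact/umax/line_neq0].
move=> /eqP; rewrite mulf_eq0 => /orP[|/eqP//].
by rewrite mulf_eq0 pnatr_eq0/= gt_eqF// phi0_gt0.
Qed.

(** A norm is Euclidean as soon as, on every line issued from a maximum of the
    determinant of the Hessian, the third derivative vanishes (it vanishes at
    the maximum).  Indeed the Hessian is then constant on each such line; the
    direction of u + t h tends to that of h, so the Hessian at h is the one at
    u for all h independent of u, and h is again a maximum. *)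
Lemma hess_cst_of_propagation :
  (forall u h, det2 u h != 0 -> max_disc u -> forall t, phi e u h 3 t = 0) ->
  forall y z v w, y != 0 -> z != 0 -> hess e y v w = hess e z v w.
Proof.
move=> prop.
have step u h : det2 u h != 0 -> max_disc u -> forall v w, hess e h v w = hess e u v w.
  move=> uh um v w.
  have u0 := det2_neq0l uh; have h0 := det2_neq0r uh.
  have line t : hess e (u + t *: h) v w = hess e u v w.
    by have := hess_line he uh (prop _ _ uh um) t 0 v w; rewrite scale0r addr0.
  have lim1 : hess e (s *: u + h) v w @[s --> (0:R)^'+] --> hess e h v w.
    apply: (@cvg_comp _ _ _ (fun s => s *: u + h) (fun z => hess e z v w) _ (nbhs h)); last first.
      exact: hess_cont.
    have : (s *: u + h) @[s --> (0 : R)] --> 0 *: u + h.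
      by apply: cvgD; [apply: cvgZr_tmp; exact: cvg_id|exact: cvg_cst].
    rewrite scale0r add0r; apply: cvg_trans; apply: cvg_app; exact: cvg_within.
  have lim2 : hess e (s *: u + h) v w @[s --> (0:R)^'+] --> hess e u v w.
    apply: cvg_near_cst; near=> s.
    have s0 : 0 < s by near: s; exact: nbhs_right_gt.
    have -> : s *: u + h = s *: (u + s^-1 *: h).
      by rewrite scalerDr scalerA mulfV ?gt_eqF// scale1r.
    have ush : u + s^-1 *: h != 0 by exact: line_neq0.
    by rewrite (hess_scale he _ _ ush s0) line.
  exact: (cvg_unique _ lim1 lim2).
have spread u h : det2 u h != 0 -> max_disc u -> max_disc h.
  move=> uh um; split; first exact: det2_neq0r uh.
  by move=> z z0; rewrite /disc !(step _ _ uh um); apply: um.2.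
have [u u0 umax] := disc_max; have um : max_disc u by [].
have main z v w : z != 0 -> hess e z v w = hess e u v w.
  move=> z0; have [uz|uz] := eqVneq (det2 u z) 0; last exact: step.
  have [k uk] := exists_indep u0.
  rewrite -(step _ _ uk um); apply: step; last exact: spread uk um.
  by rewrite det2C oppr_eq0; exact: det2_dep uz uk.
by move=> y z v w y0 z0; rewrite !main.
Unshelve. all: by end_near. Qed.

End Spread.

(** * Rigidity of non-Euclidean planes *)

Lemma der_zero (R : realType) (f f' : R -> R) :
  der f f' -> (forall t, f t = 0) -> forall t, f' t = 0.
Proof.
move=> df f0 t; have [_ <-] := df t.
by rewrite (_ : f = cst 0) ?derive_cst//; exact/funext.
Qed.

Section Rigidity.
Context {R : realType}.
Variables (e : 'rV[R]_2 -> R) (he : norm_sq e).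

Definition euclidean_fibre := forall y z v w, y != 0 -> z != 0 -> hess e y v w = hess e z v w.

(** Only Euclidean planes have a nontrivial infinitesimal linear isometry S.  On
    the line u + t h, with f the restriction of e, the equation for S reads
    2 f (a + c t) + f' p = 0 for the quadratic polynomial p below.
    Differentiating it twice and eliminating gives
    f f''' p = - (trace S) (2 f f'' - f'^2).  At a maximum of the determinant
    f''' = 0, hence the trace is 0, and then f''' = 0 wherever p does not
    vanish. *)
Lemma infinitesimal_isometry_eq0 (S : 'M[R]_2) : ~ euclidean_fibre ->
  (forall y, y != 0 -> 'D_(y *m S) e y = 0) -> S = 0.
Proof.
move=> neucl dS; apply/eqP/negPn/negP => S0; apply: neucl.
apply: (hess_cst_of_propagation he) => u h uh um.
pose a := det2 (u *m S) h / det2 u h; pose b := det2 u (u *m S) / det2 u h.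
pose c := det2 (h *m S) h / det2 u h; pose d := det2 u (h *m S) / det2 u h.
have uS : u *m S = a *: u + b *: h by exact: det2_decomp.
have hS : h *m S = c *: u + d *: h by exact: det2_decomp.
pose f n t := phi e u h n t.
have df n : der (f n) (f n.+1) by exact: der_phi.
have f0 t : 0 < f 0 t by exact: phi0_gt0.
pose p t := b + (d - a) * t - c * t ^+ 2.
have dp : der p (fun t => (d - a) - 2 * c * t).
  have D := derB (derD (derC b) (derM (derC (d - a)) (@der_id R))) (derM (derC c) (derM (@der_id R) (@der_id R))).
  apply: (der_ext D) => t; first by rewrite /p expr2.
  by ring.
have ddp : der (fun t => (d - a) - 2 * c * t) (fun=> - 2 * c).
  have D := derB (derC (d - a)) (derM (derM (derC 2) (derC c)) (@der_id R)).
  apply: (der_ext D) => t; first by [].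
  by ring.
have E0 t : 2 * f 0 t * (a + c * t) + f 1 t * p t = 0.
  have yt0 := line_neq0 t uh.
  have yS : (u + t *: h) *m S = (a + c * t) *: u + (b + d * t) *: h.
    rewrite mulmxDl -scalemxAl uS hS scalerDr !scalerA addrACA -!scalerDl.
    by congr (_ *: _ + _ *: _); ring.
  have := dS _ yt0; rewrite yS (deriveDv he _ _ yt0) !(deriveZv he _ _ yt0).
  rewrite (derive_u he uh) phi1E -/(f 0 t) -/(f 1 t) /p => <-.
  by move: (f 0 t) (f 1 t) => x y; ring.
have E1 t : f 1 t * (a + d) + 2 * f 0 t * c + f 2 t * p t = 0.
  have D1 := derD (derM (derM (derC 2) (df 0%N)) (derD (derC a) (derM (derC c) (@der_id R)))) (derM (df 1%N) dp).
  rewrite -(der_zero D1 E0 t).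
  move: (f 0 t) (f 1 t) (f 2 t) (p t) => x y z q; ring.
have E2 t : f 2 t * (2 * d - 2 * c * t) + 2 * c * f 1 t + f 3 t * p t = 0.
  have D1 := derD (derD (derM (df 1%N) (derC (a + d))) (derM (derM (derC 2) (df 0%N)) (derC c))) (derM (df 2%N) dp).
  rewrite -(der_zero D1 E1 t).
  move: (f 0 t) (f 1 t) (f 2 t) (f 3 t) (p t) => x y z q r; ring.
have key t : 2 * f 0 t * f 3 t * p t = - 2 * (a + d) * line_disc e u h t.
  have := E0 t; have := E1 t; have := E2 t; rewrite /line_disc -/(f 0 t) -/(f 1 t) -/(f 2 t).
  rewrite /p; move: (f 0 t) (f 1 t) (f 2 t) (f 3 t) => x y z w H2 H1 H0.
  have -> : 2 * x * w * (b + (d - a) * t - c * t ^+ 2) =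
    2 * x * (z * (2 * d - 2 * c * t) + 2 * c * y + w * (b + (d - a) * t - c * t ^+ 2))
    - 2 * y * (y * (a + d) + 2 * x * c + z * (b + (d - a) * t - c * t ^+ 2))
    + 2 * z * (2 * x * (a + c * t) + y * (b + (d - a) * t - c * t ^+ 2))
    - 2 * (a + d) * (2 * x * z - y ^+ 2) by ring.
  by rewrite H0 H1 H2 !mulr0; ring.
have ad : a + d = 0.
  have := key 0; rewrite (max_disc_phi3 he uh um : f 3 0 = 0) mulr0 mul0r => /esym/eqP.
  rewrite mulf_eq0 (gt_eqF (line_disc_gt0 he uh 0)) orbF mulf_eq0 oppr_eq0 pnatr_eq0/=.
  by move/eqP.
have pf3 t : p t != 0 -> f 3 t = 0.
  move=> pt; have := key t; rewrite ad mulr0 mul0r => /eqP.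
  by rewrite !mulf_eq0 pnatr_eq0/= gt_eqF//= (negbTE pt) orbF => /eqP.
move=> t; have [pt|pt] := eqVneq (p t) 0; last exact: pf3.
(* At a zero of p the line meets the kernel of S; as its trace is 0, S is
   nilpotent, and the zero of p is double and isolated. *)
have act : a + c * t = 0.
  have /eqP := E0 t; rewrite pt mulr0 addr0 !mulf_eq0 pnatr_eq0/= gt_eqF//=.
  by move/eqP.
have ps s : p s = - c * (s - t) ^+ 2.
  have a_ : a = - c * t by apply/eqP; rewrite mulNr -addr_eq0 act.
  have d_ : d = c * t by apply/eqP; rewrite -subr_eq0 -mulNr -a_ addrC ad.
  have b_ : b = - c * t ^+ 2.
    by apply/eqP; rewrite mulNr -addr_eq0 -pt /p d_ a_; apply/eqP; ring.
  by rewrite /p d_ a_ b_; ring.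
have c0 : c != 0.
  apply: contraNneq S0 => c0; have a0 : a = 0 by rewrite -act c0 mul0r addr0.
  have d0 : d = 0 by rewrite -ad a0 add0r.
  have b0 : b = 0 by rewrite -pt /p a0 c0 d0 !mul0r; ring.
  apply/eqP/row_matrixP => i; rewrite row0 rowE (det2_decomp (delta_mx 0 i) uh) mulmxDl -!scalemxAl.
  by rewrite uS hS a0 b0 c0 d0 !scale0r addr0 !scaler0 addr0.
apply: (cont_punctured0 (der_cont (df 3%N))).
near=> s; apply: pf3; rewrite ps mulf_neq0 ?oppr_eq0// sqrf_eq0 subr_eq0.
near: s; exact: nbhs_dnbhs_neq.
Unshelve. all: by end_near. Qed.

End Rigidity.

(** * The Landsberg equation along a line *)

Lemma derive3_line (R : realType) (V : normedModType R) (g : V -> R) (u h : V) (f f1 f2 f3 : R -> R) :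
  (forall t, g (u + t *: h) = f t) -> der f f1 -> der f1 f2 -> der f2 f3 ->
  forall t, 'D_h ('D_h ('D_h g)) (u + t *: h) = f3 t.
Proof.
move=> gf d1 d2 d3.
have E k (k0 k1 : R -> R) : (forall s, k (u + s *: h) = k0 s) -> der k0 k1 ->
    forall s, 'D_h k (u + s *: h) = k1 s.
  by move=> /funext kE dk s; have [_ <-] := dk s; rewrite -derive_line kE.
exact: E (E _ _ _ (E _ _ _ gf d1) d2) d3.
Qed.

Lemma der_mul3 (R : realType) (f f1 f2 f3 g g1 g2 g3 : R -> R) :
  der f f1 -> der f1 f2 -> der f2 f3 -> der g g1 -> der g1 g2 -> der g2 g3 ->
  exists p1 p2, [/\ der (fun t => f t * g t) p1, der p1 p2 &
    der p2 (fun t => f3 t * g t + 3 * f2 t * g1 t + 3 * f1 t * g2 t + f t * g3 t)].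
Proof.
move=> d1 d2 d3 b1 b2 b3.
exists (fun t => f1 t * g t + f t * g1 t), (fun t => f2 t * g t + 2 * f1 t * g1 t + f t * g2 t).
split; first exact: derM.
- apply: (der_ext (derD (derM d2 b1) (derM d1 b2))) => // t; ring.
- apply: (der_ext (derD (derD (derM d3 b1) (derM (derM (derC 2) d2) b2)) (derM d1 b3))) => // t; ring.
Qed.

Lemma sq_quot_eq0 (F : fieldType) (a c m b n : F) : a != 0 -> m != 0 ->
  a * c * (a * c) * m^-1 = b * 0 * (b * 0) * n^-1 -> c = 0.
Proof.
move=> a0 m0; rewrite !mulr0 mul0r => /eqP.
by rewrite !mulf_eq0 invr_eq0 (negbTE a0) (negbTE m0) orbF orbb => /eqP.
Qed.

Section Landsberg.
Context {R : realType}.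
Variables (e : 'rV[R]_2 -> R) (he : norm_sq e).

(** Positive definiteness lets one recover a vector from its products with a basis. *)
Lemma hess_nondeg y h X X' : y != 0 -> det2 y h != 0 ->
  hess e y X h = hess e y X' h -> hess e y X y = hess e y X' y -> X = X'.
Proof.
move=> y0 yh Eh Ey; apply/eqP; rewrite -subr_eq0; apply/negPn/negP => Z0.
have Zv v : hess e y (X - X') v = hess e y X v - hess e y X' v.
  by rewrite -scaleN1r (hessDl he _ _ _ y0) (hessZl he _ _ _ y0) mulN1r.
have Zh : hess e y (X - X') h = 0 by apply: (etrans (Zv h)); apply/eqP; rewrite subr_eq0 Eh.
have Zy : hess e y (X - X') y = 0 by apply: (etrans (Zv y)); apply/eqP; rewrite subr_eq0 Ey.
have := hess_pos he y0 Z0; move: (X - X') Zh Zy => Z Zh Zy.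
have ZE := det2_decomp Z yh.
move: (det2 Z h / _) (det2 y Z / _) ZE => a b ZE.
have -> : hess e y Z Z = hess e y Z (a *: y + b *: h) by congr (hess e y Z _).
by rewrite (hessDr he Z _ _ y0) (hessZr he a Z y y0) (hessZr he b Z h y0) Zh Zy !mulr0 addr0 ltxx.
Qed.

Section OnLine.
(* Here tau stands for the torsion, G for twice the spray, Q for its quadratic
   part and W for the correction due to the torsion. *)
Variables (tau : 'rV[R]_2) (W : 'rV[R]_2 -> 'rV[R]_2) (G Q : 'I_2 -> 'rV[R]_2 -> R).
Hypothesis WE : forall y v, y != 0 -> hess e y (W y) v = det2 y v * 'D_tau e y.
Hypothesis GE : forall i y, y != 0 -> G i y = Q i y + W y 0 i.
Hypothesis Qquad : forall i (u h : 'rV[R]_2), exists a b c : R, forall t : R, Q i (u + t *: h) = a + b * t + c * t ^+ 2.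
Hypothesis LG : forall y h, y != 0 -> 'D_(\row_i 'D_h ('D_h ('D_h (G i))) y) e y = 0.

Variables (u h : 'rV[R]_2) (uh : det2 u h != 0).

Let f n t := phi e u h n t.
Let df n : der (f n) (f n.+1). Proof. exact: der_phi. Qed.
Let yt0 t : u + t *: h != 0. Proof. exact: line_neq0. Qed.
(* Along the line, psi and q are the derivatives of e in the directions u and
   tau, and r is the coefficient of W found in W_line; a digit is the order of
   differentiation. *)
Let tu := det2 tau h / det2 u h.
Let th := det2 u tau / det2 u h.
Let psi t := 2 * f 0 t - t * f 1 t.
Let psi1 t := f 1 t - t * f 2 t.
Let psi2 t := - t * f 3 t.
Let psi3 t := - f 3 t - t * f 4 t.
Let D t := 2 * f 0 t * f 2 t - f 1 t ^+ 2.
Let D1 t := 2 * f 0 t * f 3 t.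
Let D2 t := 2 * (f 1 t * f 3 t + f 0 t * f 4 t).
Let D3 t := 2 * (f 2 t * f 3 t + 2 * f 1 t * f 4 t + f 0 t * f 5 t).
Let q t := tu * psi t + th * f 1 t.
Let q1 t := tu * psi1 t + th * f 2 t.
Let q2 t := tu * psi2 t + th * f 3 t.
Let q3 t := tu * psi3 t + th * f 4 t.
Let r t := q t / D t.
Let r1 t := (q1 t - r t * D1 t) / D t.
Let r2 t := (q2 t - 2 * r1 t * D1 t - r t * D2 t) / D t.
Let r3 t := (q3 t - 3 * r2 t * D1 t - 3 * r1 t * D2 t - r t * D3 t) / D t.

Let dpsi : der psi psi1.
Proof.
apply: (der_ext (derB (derM (derC 2) (df 0)) (derM (@der_id R) (df 1)))) => t; first by [].
by rewrite /psi1; move: (f 0 t) (f 1 t) (f 2 t) => x y z; ring.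
Qed.
Let dpsi1 : der psi1 psi2.
Proof.
apply: (der_ext (derB (df 1) (derM (@der_id R) (df 2)))) => t; first by [].
by rewrite /psi2; move: (f 1 t) (f 2 t) (f 3 t) => x y z; ring.
Qed.
Let dpsi2 : der psi2 psi3.
Proof.
apply: (der_ext (derM (derM (derC (-1)) (@der_id R)) (df 3))) => t; first by rewrite /psi2 mulN1r.
by rewrite /psi3; move: (f 3 t) (f 4 t) => x y; ring.
Qed.
Let dq : der q q1. Proof.
apply: (der_ext (derD (derM (derC tu) dpsi) (derM (derC th) (df 1)))) => t; first by [].
by rewrite /q1; move: (psi1 t) (psi t) (f 1 t) (f 2 t) => x y z w; ring.
Qed.
Let dq1 : der q1 q2. Proof.
apply: (der_ext (derD (derM (derC tu) dpsi1) (derM (derC th) (df 2)))) => t; first by [].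
by rewrite /q2; move: (psi1 t) (psi2 t) (f 2 t) (f 3 t) => x y z w; ring.
Qed.
Let dq2 : der q2 q3. Proof.
apply: (der_ext (derD (derM (derC tu) dpsi2) (derM (derC th) (df 3)))) => t; first by [].
by rewrite /q3; move: (psi2 t) (psi3 t) (f 3 t) (f 4 t) => x y z w; ring.
Qed.
Let dD : der D D1.
Proof. exact: der_line_disc. Qed.
Let dD1 : der D1 D2. Proof.
apply: (der_ext (derM (derM (derC 2) (df 0)) (df 3))) => t; first by [].
by rewrite /D2; move: (f 0 t) (f 1 t) (f 3 t) (f 4 t) => x y z w; ring.
Qed.
Let dD2 : der D2 D3. Proof.
apply: (der_ext (derM (derC 2) (derD (derM (df 1) (df 3)) (derM (df 0) (df 4))))) => t; first by [].
by rewrite /D3; move: (f 0 t) (f 1 t) (f 2 t) (f 3 t) (f 4 t) (f 5 t) => x y z w a b; ring.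
Qed.
Let D_neq0 t : D t != 0.
Proof. by rewrite gt_eqF//; exact: (line_disc_gt0 he uh). Qed.

Let der_quot g g1 (n n1 : R -> R) : (forall t, g t = n t / D t) -> der n n1 ->
  (forall t, g1 t = (n1 t - g t * D1 t) / D t) -> der g g1.
Proof.
move=> gE dn g1E.
apply: (der_ext (derM dn (derV D_neq0 dD))) => t; first by rewrite gE.
rewrite g1E gE; have := D_neq0 t; move: (n t) (n1 t) (D t) (D1 t) => a b c d c0.
by field.
Qed.

Let dr : der r r1. Proof. exact: (der_quot (n := q) (n1 := q1)). Qed.
Let dr1 : der r1 r2.
Proof.
apply: (der_quot _ (derB dq1 (derM dr dD1))) => t; first by [].
by rewrite /r2; congr (_ / _); move: (r1 t) (r t) (D1 t) (D2 t) (q2 t) => a b c d x; ring.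
Qed.
Let dr2 : der r2 r3.
Proof.
apply: (der_quot _ (derB (derB dq2 (derM (derM (derC 2) dr1) dD1)) (derM dr dD2))) => t; first by [].
by rewrite /r3; congr (_ / _); move: (r2 t) (r1 t) (r t) (D1 t) (D2 t) (D3 t) (q3 t) => a b c d x y z; ring.
Qed.

Let qE t : 'D_tau e (u + t *: h) = q t.
Proof.
rewrite (det2_decomp tau uh) (deriveDv he _ _ (yt0 t)) !(deriveZv he _ _ (yt0 t)).
by rewrite (derive_u he uh) phi1E.
Qed.

(** W is orthogonal to y = u + t h for the Hessian at y, hence a multiple of the
    vector spanning the kernel of de at y. *)
Let W_line t : W (u + t *: h) = (det2 u h * r t) *: (- f 1 t *: u + psi t *: h).
Proof.
have yh : det2 (u + t *: h) h != 0 by rewrite det2_lin.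
apply: (hess_nondeg (yt0 t) yh).
  rewrite WE// qE det2_lin (hessZl he _ _ _ (yt0 t)) (hessDl he _ _ _ (yt0 t)) !(hessZl he _ _ _ (yt0 t)).
  rewrite (hess_uh he uh) (hess_hh e u h t) /r -mulrA; congr (_ * _).
  rewrite -/(f 1 t) -/(f 2 t) (_ : _ + _ = D t) ?divfK//.
  by rewrite /psi /D; move: (f 0 t) (f 1 t) (f 2 t) => a b c; ring.
rewrite WE// (_ : det2 _ (u + t *: h) = 0) ?mul0r; last by rewrite /det2; ring.
rewrite (hessZl he _ _ _ (yt0 t)) (hessC he _ _ (yt0 t)) (hess_euler he _ (yt0 t)).
rewrite (deriveDv he _ _ (yt0 t)) !(deriveZv he _ _ (yt0 t)) (derive_u he uh) phi1E.
by rewrite -/(f 1 t) -/(f 0 t) -/(psi t); move: (f 1 t) (psi t) => a b; ring.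
Qed.

(** The Landsberg equation on the line.  The quadratic part of G has no third
    derivative. *)
Let ode t : - psi t * (3 * r2 t * f 2 t + 3 * r1 t * f 3 t + r t * f 4 t)
  + f 1 t * (3 * r2 t * psi1 t + 3 * r1 t * psi2 t + r t * psi3 t) = 0.
Proof.
have [A1 [A2 [dA dA1]]] := der_mul3 dr dr1 dr2 (df 1) (df 2) (df 3).
set A3 := (X in der A2 X) => dA2.
have [B1 [B2 [dB dB1]]] := der_mul3 dr dr1 dr2 dpsi dpsi1 dpsi2.
set B3 := (X in der B2 X) => dB2.
have d0 := uh; set d := det2 u h in d0.
have GL i : 'D_h ('D_h ('D_h (G i))) (u + t *: h) = d * (- A3 t * u 0 i + B3 t * h 0 i).
  have [a [b [c QE]]] := Qquad i u h.
  have line s : G i (u + s *: h) =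
      (a + b * s + c * (s * s)) + d * (- (r s * f 1 s) * u 0 i + (r s * psi s) * h 0 i).
    rewrite GE// QE W_line !mxE expr2 -/d; congr (_ + _).
    by move: (f 1 s) (psi s) (r s) => ? ? ?; ring.
  pose id' := @der_id R.
  have e1' := derD (derD (derD (derC a) (derM (derC b) id')) (derM (derC c) (derM id' id')))
    (derM (derC d) (derD (derM (derM (derC (-1)) dA) (derC (u 0 i))) (derM dB (derC (h 0 i))))).
  have e1 : der (fun s => (a + b * s + c * (s * s)) + d * (- (r s * f 1 s) * u 0 i + (r s * psi s) * h 0 i))
      (fun s => (b + 2 * c * s) + d * (- A1 s * u 0 i + B1 s * h 0 i)).
    apply: (der_ext e1') => s; first by rewrite mulN1r.
    by move: (A1 s) (B1 s) (r s * _) (r s * psi s) => ? ? ? ?; ring.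
  have e2' := derD (derD (derC b) (derM (derM (derC 2) (derC c)) id'))
    (derM (derC d) (derD (derM (derM (derC (-1)) dA1) (derC (u 0 i))) (derM dB1 (derC (h 0 i))))).
  have e2 : der (fun s => (b + 2 * c * s) + d * (- A1 s * u 0 i + B1 s * h 0 i))
      (fun s => (2 * c) + d * (- A2 s * u 0 i + B2 s * h 0 i)).
    apply: (der_ext e2') => s; first by rewrite mulN1r.
    by move: (A2 s) (B2 s) (A1 s) (B1 s) => ? ? ? ?; ring.
  have e3' := derD (derC (2 * c))
    (derM (derC d) (derD (derM (derM (derC (-1)) dA2) (derC (u 0 i))) (derM dB2 (derC (h 0 i))))).
  have e3 : der (fun s => (2 * c) + d * (- A2 s * u 0 i + B2 s * h 0 i))
      (fun s => d * (- A3 s * u 0 i + B3 s * h 0 i)).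
    apply: (der_ext e3') => s; first by rewrite mulN1r.
    by move: (A3 s) (B3 s) (A2 s) (B2 s) => ? ? ? ?; ring.
  exact: (derive3_line line e1 e2 e3).
have := LG h (yt0 t).
rewrite (_ : \row_i _ = d *: (- A3 t *: u + B3 t *: h)); last first.
  by apply/rowP => i; rewrite !mxE GL.
rewrite (deriveZv he _ _ (yt0 t)) (deriveDv he _ _ (yt0 t)) !(deriveZv he _ _ (yt0 t)).
rewrite (derive_u he uh) phi1E -/(f 1 t) -/(f 0 t) -/(psi t) => /eqP.
rewrite mulf_eq0 (negbTE d0)/= => /eqP <-; rewrite /A3 /B3.
move: (f 1 t) (psi t) (r t) (r1 t) (r2 t) (r3 t) (f 2 t) (f 3 t) (f 4 t) (psi1 t) (psi2 t) (psi3 t) => *.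
ring.
Qed.

(** Clearing denominators, the Landsberg equation factors. *)
Let key t : q t * (2 * f 1 t * D1 t * D t + 2 * f 0 t * D t * D2 t - 3 * f 0 t * D1 t ^+ 2) = 0.
Proof.
have := ode t; have := D_neq0 t.
rewrite /r2 /r1 /r /q2 /q1 /q /psi /psi1 /psi2 /psi3 /D2 /D1 /D.
move: (f 0 t) (f 1 t) (f 2 t) (f 3 t) (f 4 t) tu th => a b c d k m n D0 /(congr1 (fun z => z * (a * (2 * a * c - b ^+ 2) ^+ 2))).
rewrite mul0r => <-; field.
exact: D0.
Qed.

(** The second factor in [key] is, up to factors f, D and D1, the logarithmic
    derivative of (f D')^2 / D^3.  The zeros of q are simple, since q and q'
    cannot vanish together when the torsion is nonzero, so the second factor
    vanishes everywhere by continuity and (f D')^2 / D^3 is constant; it is 0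
    at 0. *)
Lemma torsion_line : tau != 0 -> f 3 0 = 0 -> forall t, f 3 t = 0.
Proof.
move=> tau0 f30.
have Phi0 t : 2 * f 1 t * D1 t * D t + 2 * f 0 t * D t * D2 t - 3 * f 0 t * D1 t ^+ 2 = 0.
  have dPhi := derB (derD (derM (derM (derM (derC 2) (df 1)) dD1) dD) (derM (derM (derM (derC 2) (df 0)) dD) dD2))
    (derM (derM (derC 3) (df 0)) (derM dD1 dD1)).
  apply: (cont_punctured0 (der_cont dPhi)).
  have nz s : q s != 0 -> 2 * f 1 s * D1 s * D s + 2 * f 0 s * D s * D2 s - 3 * f 0 s * (D1 s * D1 s) = 0.
    by move=> qs; have /eqP := key s; rewrite mulf_eq0 (negbTE qs) expr2 => /eqP.
  have [qt|qt] := eqVneq (q t) 0; last first.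
    apply: filterS nz _; apply: nbhs_dnbhs.
    have cq : q @ t --> q t by exact: der_cont dq _.
    exact: cvgr_neq0 cq qt.
  apply: filterS nz _; apply: (der_punctured dq qt).
  apply: contraNneq tau0 => q1t.
  have e1 : tu * D t = 0.
    transitivity (q t * f 2 t - q1 t * f 1 t); last by rewrite qt q1t !mul0r subrr.
    by rewrite /D /q /q1 /psi /psi1; move: (f 0 t) (f 1 t) (f 2 t) => a b c; ring.
  have e2 : th * D t = 0.
    transitivity (q1 t * psi t - q t * psi1 t); last by rewrite qt q1t !mul0r subrr.
    by rewrite /D /q /q1 /psi /psi1; move: (f 0 t) (f 1 t) (f 2 t) => a b c; ring.
  have tu0 : tu = 0 by move/eqP: e1; rewrite mulf_eq0 (negbTE (D_neq0 t)) orbF => /eqP.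
  have th0 : th = 0 by move/eqP: e2; rewrite mulf_eq0 (negbTE (D_neq0 t)) orbF => /eqP.
  by rewrite (det2_decomp tau uh) -/tu -/th tu0 th0 !scale0r addr0.
have D3_neq0 t : D t * D t * D t != 0 by rewrite !mulf_neq0.
have dN := derM (derM (df 0) dD1) (derM (df 0) dD1).
have dK := derM dN (derV D3_neq0 (derM (derM dD dD) dD)).
have cK : der (fun t => f 0 t * D1 t * (f 0 t * D1 t) * (D t * D t * D t)^-1) (fun=> 0).
  apply: (der_ext dK) => t; first by [].
  have := Phi0 t; have := D_neq0 t.
  move: (f 0 t) (f 1 t) (D1 t) (D2 t) (D t) => a b c d k k0 H.
  transitivity (a * c * (2 * b * c * k + 2 * a * k * d - 3 * a * c ^+ 2) / k ^+ 4); last by rewrite H mulr0 mul0r.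
  by field.
move=> t.
have D10 : D1 0 = 0 by rewrite /D1 f30 mulr0.
have f0t s : f 0 s != 0 by rewrite gt_eqF//; exact: phi0_gt0.
have D1t : D1 t = 0.
  have := der0_cst cK t 0; rewrite D10; exact: sq_quot_eq0 (f0t t) (D3_neq0 t).
move: D1t; rewrite /D1; move: (f 0 t) (f 3 t) (f0t t) => x y x0 /eqP.
by rewrite !mulf_eq0 pnatr_eq0 (negbTE x0) => /eqP.
Qed.

End OnLine.
End Landsberg.

(** * Quantitative rigidity *)

Lemma lipschitz_cont (R : realType) (V W : normedModType R) (f : V -> W) (k : R) :
  (forall a b, `|f a - f b| <= k * `|a - b|) -> continuous f.
Proof.
move=> fk v A /= /nbhs_ballP[e /= e0 eA].
have k0 : 0 < `|k| + 1 by rewrite ltr_wpDl.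
apply/nbhs_ballP; exists (e / (`|k| + 1)) => /=; first exact: divr_gt0.
move=> w; rewrite -ball_normE/= ltr_pdivlMr// => vw; apply: eA; rewrite -ball_normE/=.
apply: le_lt_trans (fk _ _) _; apply: le_lt_trans vw.
by rewrite mulrC ler_wpM2l// (le_trans (ler_norm _))// lerDl.
Qed.

Section Coercivity.
Context {R : realType}.
Variables (e : 'rV[R]_2 -> R) (he : norm_sq e).

Definition derive_bound y : R := (`|'D_e1 e y| + `|'D_e2 e y|) * (2 * `|y|).

Lemma derive_boundP y (S : 'M[R]_2) : y != 0 -> `|'D_(y *m S) e y| <= derive_bound y * `|S|.
Proof.
move=> y0; rewrite {1}(row2E (y *m S)) (deriveDv he _ _ y0) !(deriveZv he _ _ y0).
rewrite (le_trans (ler_normD _ _))// !normrM /derive_bound -mulrA mulrDl.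
have := mx_norm_mul y S; set z := y *m S => zS.
by apply: lerD; rewrite mulrC ler_wpM2l// (le_trans _ zS)// entry_le_norm.
Qed.

Lemma infinitesimalB y (S T : 'M[R]_2) : y != 0 ->
  'D_(y *m S) e y - 'D_(y *m T) e y = 'D_(y *m (S - T)) e y.
Proof.
by move=> y0; rewrite mulmxBr -[- (y *m T)]scaleN1r (deriveDv he _ _ y0) (deriveZv he _ _ y0) mulN1r.
Qed.

Lemma infinitesimal_cont y : y != 0 -> continuous (fun S : 'M[R]_2 => 'D_(y *m S) e y).
Proof.
move=> y0; apply: (@lipschitz_cont _ _ _ _ (derive_bound y)) => A B.
by rewrite infinitesimalB// derive_boundP.
Qed.

(** Rigidity with a bound, by compactness of the unit sphere of matrices:
    finitely many vectors witness that an endomorphism is not an infinitesimal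
    isometry. *)
Lemma coercive : ~ euclidean_fibre e -> exists m : R, exists2 ys : seq 'rV[R]_2,
  0 < m /\ (forall y, y \in ys -> y != 0) &
  forall S : 'M[R]_2, m * `|S| <= \sum_(y <- ys) `|'D_(y *m S) e y|.
Proof.
move=> ne.
have : cover_compact [set S : 'M[R]_2 | `|S| = 1] by rewrite -compact_cover; exact: sphere_mx_compact.
move=> /(_ 'rV[R]_2 slit (fun y => [set S | 'D_(y *m S) e y != 0])) [].
- move=> y y0; apply: (@open_comp _ _ (fun S : 'M[R]_2 => 'D_(y *m S) e y) [set z | z != 0]).
    by move=> S _; exact: infinitesimal_cont.
  exact: open_neq.
- move=> S /= S1; apply: contrapT => nS.
  have S0 : S = 0.
    apply: (infinitesimal_isometry_eq0 he ne) => y y0; apply/eqP/negPn/negP => nz.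
    by apply: nS; exists y.
  by move/eqP: S1; rewrite S0 normr0 eq_sym oner_eq0.
move=> D Dslit Dcov; pose ys : seq 'rV[R]_2 := finmap.enum_fset D.
pose G (S : 'M[R]_2) : R := \sum_(y <- ys) `|'D_(y *m S) e y|.
have ys0 y : y \in ys -> y != 0.
  by move=> yys; have := Dslit y yys; rewrite inE.
have Gc : continuous G.
  apply: (@lipschitz_cont _ _ _ _ (\sum_(y <- ys) derive_bound y)) => A B.
  rewrite /G -sumrB mulr_suml (le_trans (ler_norm_sum _ _ _))// big_seq [leRHS]big_seq.
  apply: ler_sum => y /ys0 y0; rewrite (le_trans _ (derive_boundP (A - B) y0))//.
  by rewrite -infinitesimalB// ler_dist_dist.
have [||S0 /= S01 Smin] := @compact_EVT_min _ R G [set S | `|S| = 1] _ (@sphere_mx_compact R 2 2).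
- exists (`|1%:M : 'M[R]_2|^-1 *: 1%:M) => /=.
  rewrite normrZ normfV normr_id mulVf// normr_eq0.
  by apply/eqP => /matrixP/(_ 0 0); rewrite !mxE/= => /eqP; rewrite oner_eq0.
- exact: continuous_subspaceT.
exists (G S0), ys; first split => //.
- have [y/= yD yS] := Dcov S0 (set_mem S01).
  have yys : y \in ys by exact: yD.
  rewrite /G (big_rem y)//= ltr_wpDr ?normr_gt0//.
  by apply: sumr_ge0.
- move=> S; have [->|Sn0] := eqVneq S 0.
    by rewrite normr0 mulr0; apply: sumr_ge0.
  have S0' : `|S| != 0 by rewrite normr_eq0.
  rewrite -ler_pdivlMr ?normr_gt0//.
  have -> : (\sum_(y <- ys) `|'D_(y *m S) e y|) / `|S| = G (`|S|^-1 *: S).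
    rewrite /G mulr_suml; apply: eq_big_seq => y /ys0 y0.
    by rewrite -scalemxAr (deriveZv he)// normrM normfV normr_id mulrC.
  by apply: Smin; rewrite inE/= normrZ normfV normr_id mulVf.
Qed.

End Coercivity.

(** * Linear isometries between neighbouring fibres *)

Lemma near_delta (R : realType) (V : normedModType R) (x : V) (P : V -> Prop) :
  (\forall y \near x, P y) -> exists2 d : R, 0 < d & forall y, `|y - x| < d -> P y.
Proof.
move=> /nbhs_ballP[d /= d0 dP]; exists d => // y yx.
by apply: dP; rewrite -ball_normE/= distrC.
Qed.

Lemma cont_delta (R : realType) (V W : normedModType R) (f : V -> W) (x : V) :
  {for x, continuous f} -> forall e : R, 0 < e ->
  exists2 d : R, 0 < d & forall y, `|y - x| < d -> `|f y - f x| < e.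
Proof.
move=> fx e e0; apply: near_delta.
have H : \forall y \near x, ball (f x) e (f y) by apply: fx; exact: nbhsx_ballx.
by apply: filterS H => y; rewrite -ball_normE/= distrC.
Qed.

Section Isometries.
Context {R : realType}.
Variables (U : set 'rV[R]_2) (Q : 'rV[R]_2 * 'rV[R]_2 -> R).

Definition fib x y := Q (x, y).

(** y |-> y C is a linear isometry from the fibre at x onto the fibre at x0. *)
Definition fibre_iso x0 x (C : 'M[R]_2) := forall y, fib x0 (y *m C) = fib x y.

Hypothesis oU : open U.
Hypothesis Qcx : forall x y, U x -> {for x, continuous (fun x' => Q (x', y))}.
Hypothesis Qcy : forall x y, U x -> {for y, continuous (fib x)}.
Hypothesis Qdx : forall x y, U x -> y != 0 -> differentiable (fun x' => Q (x', y)) x.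
Hypothesis Q0 : forall x, U x -> Q (x, 0) = 0.
Hypothesis Qn : forall x, U x -> norm_sq (fib x).
Hypothesis Qne : forall x, U x -> ~ euclidean_fibre (fib x).
Hypothesis Qiso : forall x x', U x -> U x' -> exists C, fibre_iso x x' C.

Lemma U_delta x : U x -> exists2 d : R, 0 < d & forall x', `|x' - x| < d -> U x'.
Proof. by move=> Ux; apply: near_delta; exact: open_nbhs_nbhs. Qed.

Lemma fib_lower x : U x -> exists2 m : R, 0 < m & forall z, m * `|z| ^+ 2 <= fib x z.
Proof.
move=> Ux; have hx := Qn Ux.
have [||z0 /= z01 zmin] := @EVT_min_rV R 2 (fib x) [set y | `|y| = 1] _ (@sphere_mx_compact R 1 2).
- by exists (`|e1|^-1 *: e1) => /=; rewrite normrZ normfV normr_id mulVf// normr_eq0 e1_neq0.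
- by apply/continuous_in_subspaceT => y _; exact: Qcy.
have z00 : z0 != 0 by move: z01; rewrite inE/= -normr_eq0 => ->; rewrite oner_eq0.
exists (fib x z0); first exact: norm_sq_gt0.
move=> z; have [->|zn0] := eqVneq z 0.
  by rewrite normr0 expr0n mulr0 /fib Q0.
have nz : 0 < `|z| by rewrite normr_gt0.
have [_ hom _] := hx.
rewrite [leRHS](_ : _ = `|z| ^+ 2 * fib x (`|z|^-1 *: z)); last first.
  by rewrite hom ?invr_gt0// mulrA -exprMn mulfV ?gt_eqF// expr1n mul1r.
rewrite mulrC ler_wpM2l ?sqr_ge0//; apply: zmin; rewrite inE/=.
by rewrite normrZ normfV normr_id mulVf// gt_eqF.
Qed.

(** The isometries of a fixed fibre onto the nearby ones stay in a bounded set,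
    since they are determined by the images of two vectors. *)
Lemma iso_bound x0 : U x0 -> exists c d : R, 0 < d /\ forall x, `|x - x0| < d ->
  U x /\ forall C, fibre_iso x0 x C -> `|C| <= c.
Proof.
move=> Ux0; have [m m0 low] := fib_lower Ux0; have [d1 d10 dU] := U_delta Ux0.
have [d2 d20 B1] := cont_delta (@Qcx x0 e1 Ux0) ltr01.
have [d3 d30 B2] := cont_delta (@Qcx x0 e2 Ux0) ltr01.
pose M := Num.max (Q (x0, e1) + 1) (Q (x0, e2) + 1).
have M0 : 0 <= M.
  rewrite le_max; apply/orP; left; rewrite addr_ge0//.
  have := low e1; apply: le_trans; rewrite mulr_ge0// ?ltW// sqr_ge0//.
exists (1 + M / m), (Num.min d1 (Num.min d2 d3)).
split; first by rewrite !lt_min d10 d20 d30.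
move=> x; rewrite !lt_min => /and3P[/dU Ux /B1 X1 /B2 X2]; split => // C isoC.
have key z : fib x z <= M -> `|z *m C| <= 1 + M / m.
  move=> zM; set t := `|z *m C|; have t0 : 0 <= t by exact: normr_ge0.
  have : t ^+ 2 <= M / m.
    by rewrite ler_pdivlMr// mulrC (le_trans (low _))// isoC.
  have [t1|t1 tM] := leP t 1 => [_|].
    by rewrite (le_trans t1)// lerDl divr_ge0// ltW.
  apply: (@le_trans _ _ (t ^+ 2)); first by rewrite expr2 ler_peMl// ltW.
  by rewrite (le_trans tM)// lerDr.
apply: mx_norm_le => [|i j]; first by rewrite addr_ge0// divr_ge0// ltW.
have -> : C i j = (delta_mx 0 i *m C : 'rV[R]_2) 0 j by rewrite -rowE mxE.
apply: le_trans (entry_le_norm _ _ _) _; apply: key.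
have [->|->] := ord2P i.
  by move: X1; rewrite ltr_distl => /andP[_ /ltW]; rewrite /M le_max => ->.
by move: X2; rewrite ltr_distl => /andP[_ /ltW]; rewrite /M le_max => ->; rewrite orbT.
Qed.

Lemma iso_unit x0 x C : U x0 -> U x -> fibre_iso x0 x C -> C \in unitmx.
Proof.
move=> Ux0 Ux isoC; rewrite -row_free_unit -kermx_eq0; apply/eqP/row_matrixP => i.
rewrite row0; apply/eqP/negPn/negP => k0.
have := isoC (row i (kermx C)); rewrite -row_mul mulmx_ker row0 /fib Q0// => /esym/eqP.
by rewrite gt_eqF//; exact: (norm_sq_gt0 (Qn Ux)).
Qed.

(** Some isometry onto a nearby fibre is close to the identity: a limit of
    isometries is an isometry of the fibre itself, which can be divided out. *)
Lemma near_iso x0 e : U x0 -> 0 < e -> exists2 d : R, 0 < d & forall x, `|x - x0| < d ->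
  U x /\ exists2 C, fibre_iso x0 x C & `|C - 1%:M| < e.
Proof.
move=> Ux0 e0; have [c [d [d0 bnd]]] := iso_bound Ux0.
apply: contrapT => nex.
have seqx (k : nat) : exists x, [/\ `|x - x0| < d, `|x - x0| < k.+1%:R^-1 &
    forall C, fibre_iso x0 x C -> e <= `|C - 1%:M|].
  apply: contrapT => nx; apply: nex; exists (Num.min d k.+1%:R^-1).
    by rewrite lt_min d0 invr_gt0 ltr0n.
  move=> x; rewrite lt_min => /andP[xd xk]; have [Ux _] := bnd _ xd; split => //.
  apply: contrapT => nC; apply: nx; exists x; split => // C isoC.
  by rewrite leNgt; apply/negP => Ce; apply: nC; exists C.
have /choice[xs xsP] := seqx.
have /choice[Cs CsP] : forall k, exists C, fibre_iso x0 (xs k) C.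
  by move=> k; have [xd _ _] := xsP k; apply: Qiso => //; have [] := bnd _ xd.
have [|B clB] := @seq_cluster _ _ _ c Cs.
  by move=> k; have [xd _ _] := xsP k; have [_] := bnd _ xd; apply.
have isoB : fibre_iso x0 x0 B.
  move=> y; apply/eqP; rewrite -subr_eq0 -normr_le0; apply/ler_addgt0Pl => a a0; rewrite addr0.
  have a20 : 0 < a / 2 by rewrite divr_gt0.
  have [r r0 Hr] := cont_delta (@Qcy x0 (y *m B) Ux0) a20.
  have [s s0 Hs] := cont_delta (@Qcx x0 y Ux0) a20.
  have [N _ HN] := near_infty_natSinv_lt (PosNum s0).
  have r'0 : 0 < r / (2 * `|y| + 1) by rewrite divr_gt0// ltr_wpDl// mulr_ge0.
  have [k Nk kB] := clB _ N r'0.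
  have [_ xk _] := xsP k.
  have X1 : `|Q (xs k, y) - Q (x0, y)| < a / 2 by apply/Hs/(lt_trans xk)/HN.
  have X2 : `|fib x0 (y *m Cs k) - fib x0 (y *m B)| < a / 2.
    apply: Hr; rewrite -mulmxBr (le_lt_trans (mx_norm_mul _ _))//.
    move: kB; rewrite ltr_pdivlMr ?ltr_wpDl ?mulr_ge0//; apply: le_lt_trans.
    by rewrite mulrC ler_wpM2l// lerDl.
  move: X2; rewrite (CsP k) => X2.
  rewrite (splitr a) -[X in `|X|](subrKA (fib (xs k) y)) (le_trans (ler_normD _ _))//.
  by rewrite lerD// ltW// distrC.
have uB := iso_unit Ux0 Ux0 isoB.
have isoBV y : fib x0 (y *m invmx B) = fib x0 y by rewrite -isoB mulmxKV.
have e'0 : 0 < e / (2 * `|invmx B| + 1) by rewrite divr_gt0// ltr_wpDl// mulr_ge0.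
have [k _ kB] := clB _ 0%N e'0; have [_ _ /(_ (Cs k *m invmx B))] := xsP k.
have -> : Cs k *m invmx B - 1%:M = (Cs k - B) *m invmx B by rewrite mulmxBl mulmxV.
have isoC : fibre_iso x0 (xs k) (Cs k *m invmx B) by move=> y; rewrite mulmxA isoBV CsP.
move=> /(_ isoC); apply/negP; rewrite -ltNge (le_lt_trans (mx_norm_mul _ _))//.
move: kB; rewrite ltr_pdivlMr ?ltr_wpDl ?mulr_ge0//; apply: le_lt_trans.
by rewrite mulrDr mulr1 -mulrA mulrCA [leRHS]addrC -[_ * (2 * _)]mulrCA lerDr.
Qed.

Definition dxQ x y v : R := 'D_v (fun x' => Q (x', y)) x.

Lemma dxQ_bound x y : U x -> y != 0 -> exists2 K : R, 0 <= K & forall v, `|dxQ x y v| <= K * `|v|.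
Proof.
move=> Ux y0; have dQ := Qdx Ux y0.
exists (`|dxQ x y e1| + `|dxQ x y e2|) => [|v]; first by rewrite addr_ge0.
have -> : dxQ x y v = v 0 0 * dxQ x y e1 + v 0 1 * dxQ x y e2.
  by rewrite /dxQ !deriveE// {1}(row2E v) linearD !linearZ.
rewrite (le_trans (ler_normD _ _))// !normrM mulrDl.
by apply: lerD; rewrite mulrC ler_wpM2l// entry_le_norm.
Qed.

(** First-order expansion of the isometry equation at a vector y. *)
Lemma iso_expand x0 y : U x0 -> y != 0 -> forall eta : R, 0 < eta ->
  exists2 d : R, 0 < d & forall x C, `|x - x0| < d -> `|C - 1%:M| < d -> fibre_iso x0 x C ->
    `|'D_(y *m (C - 1%:M)) (fib x0) y - dxQ x0 y (x - x0)| <= eta * (`|C - 1%:M| + `|x - x0|).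
Proof.
move=> Ux0 y0 eta eta0.
have de := norm_sq_diff (Qn Ux0) y0; have dQ := Qdx Ux0 y0.
set c := 2 * `|y| + 1; have c0 : 0 < c by rewrite /c ltr_wpDl// mulr_ge0.
have [r1 r10 H1] := near_delta (diff_eps de (divr_gt0 eta0 c0)).
have [r2 r20 H2] := near_delta (diff_eps dQ eta0).
exists (Num.min (r1 / c) r2); first by rewrite lt_min r20 divr_gt0.
move=> x C; rewrite lt_min => /andP[_ xr]; rewrite lt_min => /andP[Cr _] isoC.
have yS : `|y *m (C - 1%:M)| <= c * `|C - 1%:M|.
  by rewrite (le_trans (mx_norm_mul _ _))// ler_wpM2r// lerDl.
have := H1 (y *m (C - 1%:M)); rewrite subr0 => /(_ (le_lt_trans yS _)); rewrite mulrC -ltr_pdivlMr// => /(_ Cr).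
rewrite (_ : y *m (C - 1%:M) + y = y *m C); last by rewrite mulmxBr mulmx1 subrK.
rewrite (isoC y) -deriveE// => X1.
have := H2 (x - x0); rewrite subr0 => /(_ xr); rewrite subrK -deriveE// => X2.
rewrite -/(dxQ x0 y _) in X2.
set D := 'D_(_) (fib x0) y in X1 *; set E := dxQ _ _ _ in X2 *.
have -> : D - E = (Q (x, y) - Q (x0, y) - E) - (fib x y - fib x0 y - D) by rewrite /fib; ring.
rewrite (le_trans (ler_normB _ _))// addrC mulrDr lerD//.
rewrite (le_trans X1)// -mulrA ler_wpM2l ?(ltW eta0)// mulrC ler_pdivrMr//.
by rewrite mulrC.
Qed.

Lemma iso_expand_sum x0 (ys : seq 'rV[R]_2) : U x0 -> (forall y, y \in ys -> y != 0) ->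
  forall eta : R, 0 < eta ->
  exists2 d : R, 0 < d & forall x C, `|x - x0| < d -> `|C - 1%:M| < d -> fibre_iso x0 x C ->
    \sum_(y <- ys) `|'D_(y *m (C - 1%:M)) (fib x0) y - dxQ x0 y (x - x0)|
      <= eta * (`|C - 1%:M| + `|x - x0|).
Proof.
move=> Ux0; elim: ys => [|y ys IH] ys0 eta eta0.
  exists 1 => // x C _ _ _; rewrite big_nil mulr_ge0 ?addr_ge0//; exact: ltW.
have y0 : y != 0 by apply: ys0; rewrite inE eqxx.
have eta20 : 0 < eta / 2 by rewrite divr_gt0.
have [z zys|d1 d10 H1] := IH _ _ eta20; first by apply: ys0; rewrite inE zys orbT.
have [d2 d20 H2] := iso_expand Ux0 y0 eta20.
exists (Num.min d1 d2); first by rewrite lt_min d10.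
move=> x C; rewrite !lt_min => /andP[x1 x2] /andP[C1 C2] isoC.
by rewrite big_cons [eta]splitr mulrDl lerD// ?H1// H2.
Qed.

(** An isometry onto a fibre at distance t which is close to the identity is at
    distance O(t) from it: by the first-order expansion its deviation from the
    identity is an infinitesimal isometry up to O(t) and small terms, and
    rigidity bounds it. *)
Lemma iso_lip x0 : U x0 -> exists K d : R, [/\ 0 <= K, 0 < d &
  forall x C, `|x - x0| < d -> `|C - 1%:M| < d -> fibre_iso x0 x C -> `|C - 1%:M| <= K * `|x - x0|].
Proof.
move=> Ux0; have [m [ys [m0 ys0] coer]] := coercive (Qn Ux0) (Qne Ux0).
have m20 : 0 < m / 2 by rewrite divr_gt0.
have [d d0 H] := iso_expand_sum Ux0 ys0 m20.
have [K K0 HK] : exists2 K : R, 0 <= K & forall v, \sum_(y <- ys) `|dxQ x0 y v| <= K * `|v|.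
  elim: ys ys0 {coer H} => [|y ys IH] ys0.
    by exists 0 => // v; rewrite big_nil mul0r.
  have [z zys|K1 K10 H1] := IH; first by apply: ys0; rewrite inE zys orbT.
  have [|K2 K20 H2] := @dxQ_bound x0 y Ux0; first by apply: ys0; rewrite inE eqxx.
  by exists (K2 + K1) => [|v]; [rewrite addr_ge0|rewrite big_cons mulrDl lerD].
exists (2 * K / m + 1), d; split => //; first by rewrite addr_ge0// divr_ge0 ?mulr_ge0// ltW.
move=> x C xd Cd isoC; have := H x C xd Cd isoC; have := coer (C - 1%:M); have := HK (x - x0).
set s := `|C - 1%:M|; set t := `|x - x0|.
set A := \sum_(y <- ys) _; set B := \sum_(y <- ys) _; set D := \sum_(y <- ys) _ => HA HB HD.
have BAD : B <= A + D.
  rewrite /A /B /D -big_split/=; apply: ler_sum => y _.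
  by rewrite addrC -lerBlDr (le_trans (lerB_dist _ _)).
have : m / 2 * s <= (K + m / 2) * t by rewrite mulrDr in HD; rewrite mulrDl; lra.
rewrite -ler_pdivlMl// => /le_trans; apply; rewrite le_eqVlt; apply/orP; left; apply/eqP.
by field; rewrite gt_eqF.
Qed.

(** Existence of the infinitesimal transport, as a limit of difference
    quotients of isometries; the bound iso_lip keeps them bounded. *)
Lemma exists_transport x0 v : U x0 -> exists S : 'M[R]_2, forall y, y != 0 ->
  dxQ x0 y v = 'D_(y *m S) (fib x0) y.
Proof.
move=> Ux0; have [K [d [K0 d0 lip]]] := iso_lip Ux0.
have step (k : nat) : exists tC : R * 'M[R]_2, [/\ 0 < tC.1, tC.1 * `|v| < Num.min d k.+1%:R^-1,
    `|tC.2 - 1%:M| < Num.min d k.+1%:R^-1 & fibre_iso x0 (x0 + tC.1 *: v) tC.2].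
  have e0 : 0 < Num.min d k.+1%:R^-1 by rewrite lt_min d0 invr_gt0 ltr0n.
  have [r r0 H] := near_iso Ux0 e0.
  have v0 : 0 < `|v| + 1 by rewrite ltr_wpDl.
  pose t := Num.min (Num.min d k.+1%:R^-1) r / (`|v| + 1).
  have t0 : 0 < t by rewrite divr_gt0// lt_min e0.
  have tv : t * `|v| < Num.min (Num.min d k.+1%:R^-1) r.
    by rewrite /t mulrAC ltr_pdivrMr// ltr_pM2l ?ltrDl// lt_min e0.
  move: tv; rewrite lt_min => /andP[tv1 tv2].
  have [] := H (x0 + t *: v); first by rewrite addrC addKr normrZ gtr0_norm.
  by move=> _ [C isoC C1]; exists (t, C); split.
have /choice[tC tCP] := step.
have xk k : x0 + (tC k).1 *: v - x0 = (tC k).1 *: v by rewrite addrC addKr.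
have nk k : `|x0 + (tC k).1 *: v - x0| = (tC k).1 * `|v|.
  by have [t0 _ _ _] := tCP k; rewrite xk normrZ gtr0_norm.
have Clip k : `|(tC k).2 - 1%:M| <= K * ((tC k).1 * `|v|).
  have [t0 tv C1 isoC] := tCP k; rewrite -nk; apply: lip => //.
    by rewrite nk; apply: lt_le_trans tv _; rewrite ge_min lexx.
  by apply: lt_le_trans C1 _; rewrite ge_min lexx.
pose Ss k := (tC k).1^-1 *: ((tC k).2 - 1%:M).
have [|S clS] := @seq_cluster _ _ _ (K * `|v|) Ss.
  move=> k; have [t0 _ _ _] := tCP k.
  by rewrite /Ss normrZ gtr0_norm ?invr_gt0// mulrC ler_pdivrMr// -mulrA [`|v| * _]mulrC.
exists S => y y0; apply/eqP; rewrite -subr_eq0 -normr_le0; apply/ler_addgt0Pl => a a0; rewrite addr0.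
have hx := Qn Ux0.
set c := (K + 1) * `|v| + 1; have c0 : 0 < c by rewrite /c ltr_wpDl// mulr_ge0// addr_ge0.
have a20 : 0 < a / 2 by rewrite divr_gt0.
have [r r0 Hr] := iso_expand Ux0 y0 (divr_gt0 a20 c0).
have [N _ HN] := near_infty_natSinv_lt (PosNum r0).
set b := derive_bound (fib x0) y + 1.
have b0 : 0 < b by rewrite /b ltr_wpDl// /derive_bound !mulr_ge0// addr_ge0.
have [k Nk kS] := clS _ N (divr_gt0 a20 b0).
have [t0 tv C1 isoC] := tCP k; have kr : k.+1%:R^-1 < r by exact: HN.
have mr : Num.min d k.+1%:R^-1 < r by rewrite gt_min kr orbT.
have := Hr _ _ _ (lt_trans C1 mr) isoC; rewrite nk => /(_ (lt_trans tv mr)).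
rewrite xk; set t := (tC k).1 in t0 *; set C := (tC k).2.
have -> : C - 1%:M = t *: Ss k by rewrite /Ss scalerA mulfV ?gt_eqF// scale1r.
have -> : dxQ x0 y (t *: v) = t * dxQ x0 y v.
  by rewrite /dxQ !deriveE ?linearZ//; exact: Qdx.
rewrite -scalemxAr (deriveZv hx _ _ y0) -mulrBr normrM normrZ gtr0_norm// -mulrDr mulrCA ler_pM2l//.
move=> X1.
have Sk : `|Ss k| <= K * `|v|.
  by rewrite /Ss normrZ gtr0_norm ?invr_gt0// mulrC ler_pdivrMr// -mulrA [`|v| * _]mulrC.
have X2 : `|'D_(y *m Ss k) (fib x0) y - dxQ x0 y v| <= a / 2.
  rewrite (le_trans X1)// -mulrA ler_piMr ?(ltW a20)// mulrC ler_pdivrMr// mul1r /c mulrDl mul1r.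
  by rewrite (le_trans (lerD Sk (lexx _)))// lerDl.
have X3 : `|'D_(y *m Ss k) (fib x0) y - 'D_(y *m S) (fib x0) y| <= a / 2.
  rewrite (infinitesimalB hx _ _ y0) (le_trans (derive_boundP hx _ y0))//.
  move: kS; rewrite ltr_pdivlMr// => /ltW; apply: le_trans.
  by rewrite mulrC ler_wpM2l// lerDl.
have -> : dxQ x0 y v - 'D_(y *m S) (fib x0) y =
  ('D_(y *m Ss k) (fib x0) y - 'D_(y *m S) (fib x0) y) - ('D_(y *m Ss k) (fib x0) y - dxQ x0 y v) by ring.
by rewrite (splitr a) (le_trans (ler_normB _ _))// lerD.
Qed.

(** The connection form at x: to first order y |-> y + y S(v) carries the norm
    of the fibre at x + v to that of the fibre at x. *)
Definition transport_at x (S : 'rV[R]_2 -> 'M[R]_2) :=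
  (forall v, S v = v 0 0 *: S e1 + v 0 1 *: S e2) /\
  forall v y, y != 0 -> dxQ x y v = 'D_(y *m S v) (fib x) y.

Lemma exists_connection : exists Gam : 'rV[R]_2 -> 'rV[R]_2 -> 'M[R]_2,
  forall x, U x -> transport_at x (Gam x).
Proof.
suff /choice[Gam GamP] : forall x, exists S, U x -> transport_at x S by exists Gam.
move=> x; have [Ux|nUx] := pselect (U x); last by exists (fun=> 0) => /nUx.
have [S1 H1] := exists_transport e1 Ux; have [S2 H2] := exists_transport e2 Ux.
exists (fun v => v 0 0 *: S1 + v 0 1 *: S2) => _.
have E1 : (e1 : 'rV[R]_2) 0 0 *: S1 + (e1 : 'rV[R]_2) 0 1 *: S2 = S1.
  by rewrite !mxE/= scale1r scale0r addr0.
have E2 : (e2 : 'rV[R]_2) 0 0 *: S1 + (e2 : 'rV[R]_2) 0 1 *: S2 = S2.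
  by rewrite !mxE/= scale1r scale0r add0r.
split=> [v|v y y0]; first by rewrite E1 E2.
rewrite mulmxDr -!scalemxAr (deriveDv (Qn Ux) _ _ y0) !(deriveZv (Qn Ux) _ _ y0).
rewrite -H1// -H2// /dxQ !deriveE; [|exact: Qdx..].
by rewrite {1}(row2E v) linearD !linearZ.
Qed.

(** The isometries close to the identity are differentiable at the diagonal,
    with derivative S: the difference is almost an infinitesimal isometry. *)
Lemma iso_derive x0 S : U x0 -> transport_at x0 S -> forall eta : R, 0 < eta ->
  exists2 d : R, 0 < d & forall x C, `|x - x0| < d -> `|C - 1%:M| < d -> fibre_iso x0 x C ->
    `|C - 1%:M - S (x - x0)| <= eta * `|x - x0|.
Proof.
move=> Ux0 [_ St] eta eta0.
have [m [ys [m0 ys0] coer]] := coercive (Qn Ux0) (Qne Ux0).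
have [K [d1 [K0 d10 lip]]] := iso_lip Ux0.
have K10 : 0 < K + 1 by rewrite ltr_wpDl.
have eta'0 : 0 < eta * m / (K + 1) by rewrite divr_gt0// mulr_gt0.
have [d2 d20 H] := iso_expand_sum Ux0 ys0 eta'0.
exists (Num.min d1 d2); first by rewrite lt_min d10.
move=> x C; rewrite !lt_min => /andP[x1 x2] /andP[C1 C2] isoC.
have := H x C x2 C2 isoC; have := lip x C x1 C1 isoC; have := coer (C - 1%:M - S (x - x0)).
rewrite (_ : \sum_(y <- ys) `|'D_(y *m (C - 1%:M - S (x - x0))) (fib x0) y| =
  \sum_(y <- ys) `|'D_(y *m (C - 1%:M)) (fib x0) y - dxQ x0 y (x - x0)|); last first.
  by apply: eq_big_seq => y /ys0 y0; rewrite St// (infinitesimalB (Qn Ux0) _ _ y0).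
set r := `|C - _ - _|; set s := `|C - _|; set t := `|x - x0| => Hr Hs /(le_trans Hr) Ht.
rewrite -(ler_pM2l m0) (le_trans Ht)// (le_trans (ler_wpM2l (ltW eta'0) (lerD Hs (lexx t))))//.
rewrite le_eqVlt; apply/orP; left; apply/eqP; move: (gt_eqF K10) => /negbT Kn.
by field.
Qed.

Lemma near1_inv (C : 'M[R]_2) : C \in unitmx -> `|C - 1%:M| <= 4^-1 -> `|invmx C| <= 2.
Proof.
move=> uC C1; have n1 : `|1%:M : 'M[R]_2| <= 1.
  apply: mx_norm_le => // i j; rewrite mxE.
  by case: (_ == _); rewrite ?normr1// normr0.
have E : invmx C = 1%:M - (C - 1%:M) *m invmx C by rewrite mulmxBl mulmxV// mul1mx opprB addrCA subrr addr0.
have := ler_normB 1%:M ((C - 1%:M) *m invmx C); rewrite -E => H1.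
have := mx_norm_mul (C - 1%:M) (invmx C); have := normr_ge0 (invmx C).
by move: (`|_ *m _|) (`|invmx C|) (`|C - _|) H1 C1 => a b c *; nra.
Qed.

Lemma eps_diff_mx m n k (f : 'rV[R]_k -> 'M[R]_(m, n)) x (M : 'I_k -> 'M[R]_(m, n)) :
  (forall e : R, 0 < e -> \forall w \near (0 : 'rV[R]_k), `|f (w + x) - f x - \sum_i w 0 i *: M i| <= e * `|w|) ->
  differentiable f x /\ forall v, 'D_v f x = \sum_i v 0 i *: M i.
Proof.
move=> H; pose A : 'M[R]_(k, m * n) := \matrix_i mxvec (M i).
pose L : {linear 'rV[R]_k -> 'M[R]_(m, n)} := vec_mx \o mulmxr A.
have LE v : L v = \sum_i v 0 i *: M i.
  rewrite /L/= mulmx_sum_row linear_sum; apply: eq_bigr => i _.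
  by rewrite linearZ/= rowK mxvecK.
have Lc : continuous L.
  apply: (@lipschitz_cont _ _ _ _ (k%:R * `|A|)) => v w.
  rewrite -linearB/= (le_trans _ (_ : `|(v - w) *m A| <= _))//.
    by apply: mx_norm_le => // i j; rewrite mxE entry_le_norm.
  by rewrite (le_trans (mx_norm_mul _ _))// mulrAC.
have [df dE] : is_diff x f L by apply: eps_is_diff => // e e0; apply: filterS (H e e0) => w; rewrite -LE.
by split=> // v; rewrite deriveE// dE LE.
Qed.

(** Parallel frames.  Near the identity there is exactly one isometry from the
    fibre at x onto the fibre at p, because linear isometries of a fibre are
    isolated; uniqueness makes it depend differentiably on x. *)
Lemma exists_frame p Gam (eps : R) : U p -> 0 < eps -> (forall x, U x -> transport_at x (Gam x)) ->
  exists B, exists2 d : R, 0 < d & forall x, `|x - p| < d ->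
    [/\ U x, fibre_iso p x (B x), `|B x - 1%:M| < eps, differentiable B x &
        forall v, 'D_v B x = Gam x v *m B x].
Proof.
move=> Up eps0 GamP.
have [K [d0 [K0 d00 lip]]] := iso_lip Up.
(* The bound 1/4 makes inverses at most 2, and d0 / 8 then puts the quotient of
   two isometries in the range of [iso_lip]. *)
pose r := Num.min eps (Num.min 4^-1 (d0 / 8)).
have r0 : 0 < r by rewrite !lt_min eps0 invr_gt0 ltr0n divr_gt0.
have uniq x C C' : U x -> fibre_iso p x C -> fibre_iso p x C' ->
    `|C - 1%:M| < r -> `|C' - 1%:M| < r -> C = C'.
  move=> Ux isoC isoC' Cr C'r.
  have uC := iso_unit Up Ux isoC.
  have C4 : `|C - 1%:M| <= 4^-1 by move: Cr; rewrite !lt_min => /and3P[_ /ltW].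
  have isoD : fibre_iso p p (invmx C *m C').
    by move=> y; rewrite mulmxA isoC' -isoC mulmxKV.
  have D1 : invmx C *m C' - 1%:M = invmx C *m (C' - C) by rewrite mulmxBr mulVmx.
  have nD : `|invmx C *m C' - 1%:M| < d0.
    rewrite D1 (le_lt_trans (mx_norm_mul _ _))//.
    have := near1_inv uC C4 => i2.
    have c8 : `|C' - C| < d0 / 4.
      have -> : C' - C = (C' - 1%:M) - (C - 1%:M) by rewrite opprB addrA subrK.
      rewrite (le_lt_trans (ler_normB _ _))//.
      move: Cr C'r; rewrite !lt_min => /and3P[_ _ a] /and3P[_ _ b]; lra.
    have := normr_ge0 (invmx C); move: (`|invmx C|) (`|C' - C|) (normr_ge0 (C' - C)) i2 c8 => a b *.
    nra.
  have := lip p _ _ nD isoD; rewrite subrr normr0 => /(_ d00); rewrite mulr0 normr_le0 D1 => /eqP.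
  move=> /(congr1 (mulmx C)); rewrite mulmxA mulmxV// mul1mx mulmx0 => /eqP.
  by rewrite subr_eq0 => /eqP.
have [d d_gt0 H] := near_iso Up r0.
have /choice[B BP] : forall x, exists C, `|x - p| < d -> fibre_iso p x C /\ `|C - 1%:M| < r.
  move=> x; have [xd|xd] := pselect (`|x - p| < d); last by exists 0 => /xd.
  by have [_ [C isoC Cr]] := H x xd; exists C.
exists B, d => // x1 x1d; have [Ux1 _] := H x1 x1d; have [iso1 B1] := BP _ x1d.
suff [dB DB] : differentiable B x1 /\ forall v, 'D_v B x1 = \sum_i v 0 i *: (Gam x1 (delta_mx 0 i) *m B x1).
  split=> //; first by move: B1; rewrite lt_min => /andP[].
  move=> v; have [lin _] := GamP _ Ux1.
  by rewrite DB sum_ord2 [in RHS]lin mulmxDl -!scalemxAl.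
apply: eps_diff_mx => e e0.
pose b := 2 * `|B x1| + 1.
have b0 : 0 < b by rewrite ltr_wpDl// mulr_ge0.
have [d1 d10 H1] := iso_derive Ux1 (GamP _ Ux1) (divr_gt0 e0 b0).
pose s := Num.min d1 ((r - `|B x1 - 1%:M|) / b).
have s0 : 0 < s by rewrite lt_min d10 divr_gt0// subr_gt0.
have [d2 d20 H2] := near_iso Ux1 s0.
apply/nbhs_ballP; exists (Num.min (d - `|x1 - p|) (Num.min d1 d2)) => /=.
  by rewrite !lt_min subr_gt0 x1d d10 d20.
move=> w; rewrite -ball_normE/= sub0r normrN !lt_min => /and3P[wd wd1 wd2].
have wx : w + x1 - x1 = w by rewrite addrK.
have xd : `|w + x1 - p| < d.
  by rewrite -addrA (le_lt_trans (ler_normD _ _))// -ltrBrDr.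
have [isox Bx] := BP _ xd.
have [] := H2 (w + x1); first by rewrite wx.
move=> Ux [C isoC]; rewrite lt_min => /andP[Cd1 Cb].
have nCB : `|(C - 1%:M) *m B x1| <= b * `|C - 1%:M|.
  by rewrite (le_trans (mx_norm_mul _ _))// mulrAC ler_wpM2r// lerDl.
have BE : B (w + x1) = C *m B x1.
  apply: (uniq (w + x1)) => //; first by move=> y; rewrite mulmxA iso1 isoC.
  have -> : C *m B x1 - 1%:M = (C - 1%:M) *m B x1 + (B x1 - 1%:M).
    by rewrite mulmxBl mul1mx addrA subrK.
  rewrite (le_lt_trans (ler_normD _ _))// -ltrBrDr (le_lt_trans nCB)//.
  by rewrite mulrC -ltr_pdivlMr.
have [lin _] := GamP _ Ux1.
have -> : B (w + x1) - B x1 - \sum_i w 0 i *: (Gam x1 (delta_mx 0 i) *m B x1) =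
    (C - 1%:M - Gam x1 w) *m B x1.
  by rewrite BE !mulmxBl mul1mx [in RHS]lin mulmxDl -!scalemxAl sum_ord2.
have := H1 (w + x1) C; rewrite wx => /(_ wd1 Cd1 isoC) X.
rewrite (le_trans (mx_norm_mul _ _))//.
have bB : 2 * `|B x1| <= b by rewrite lerDl.
rewrite mulrAC (le_trans (ler_pM _ _ bB X))// ?mulr_ge0//.
by rewrite mulrA mulrCA mulfV ?gt_eqF// mulr1.
Qed.

End Isometries.

(** * Smoothness of the spray *)

Lemma is_diff_snd (R : realType) (V W : normedModType R) (z : V * W) :
  is_diff z (@snd V W) (@snd V W).
Proof.
pose L : {linear (V * W)%type -> W} := @snd V W.
have Lc : continuous L by move=> x; exact: cvg_snd.
apply: (@eps_is_diff _ _ _ _ z L) => // e e0; apply/nbhs_ballP; exists 1 => //= k _.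
by rewrite addrK subrr normr0 mulr_ge0// ltW.
Qed.

Lemma Ck_on_entry (R : realType) m n i j k (A : set 'M[R]_(m, n)) : open A -> Ck_on k A (fun y => y i j).
Proof.
move=> oA; case: k => [x Ax|k]; first exact: coord_continuous.
split=> [x Ax|v]; first exact: differentiable_coord.
apply: Ck_on_eq (Ck_on_cst (W := R) k A (v i j)) => // x Ax /=.
have dx := @differentiable_coord R m n x i j.
rewrite -[RHS]/('D_v (fun y : 'M[R]_(m, n) => y i j) x).
have did : derivable (@id 'M[R]_(m, n)) x v by exact: derivable_id.
by have := derive_mx did; rewrite derive_id => /matrixP/(_ i j); rewrite mxE.
Qed.

Section SmoothMatrix.
Context {R : realType} {V : normedModType R}.

Lemma Ck_on_prod k (A : set V) (I : Type) (r : seq I) (P : pred I) (f : I -> V -> R) : open A ->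
  (forall i, P i -> Ck_on k A (f i)) -> Ck_on k A (fun x => \prod_(i <- r | P i) f i x).
Proof.
move=> oA kf; elim: r => [|i r IH].
  by apply: Ck_on_eq (Ck_on_cst (W := R) k A 1) => // x _; rewrite big_nil.
have [Pi|Pi] := boolP (P i); last first.
  by apply: Ck_on_eq IH => // x _; rewrite big_cons (negbTE Pi).
by apply: Ck_on_eq (Ck_onM oA (kf i Pi) IH) => // x _; rewrite big_cons Pi.
Qed.

Lemma Ck_on_det k (A : set V) n (M : V -> 'M[R]_n) : open A ->
  (forall i j, Ck_on k A (fun x => M x i j)) -> Ck_on k A (fun x => \det (M x)).
Proof.
move=> oA kM; apply: Ck_on_sum => // s _; apply: Ck_onM => //; first exact: Ck_on_cst.
exact: Ck_on_prod.
Qed.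

Lemma Ck_on_invmx k (A : set V) n (M : V -> 'M[R]_n) : open A ->
  (forall x, A x -> M x \in unitmx) ->
  (forall i j, Ck_on k A (fun x => M x i j)) ->
  forall i j, Ck_on k A (fun x => invmx (M x) i j).
Proof.
move=> oA uM kM i j.
have kd : Ck_on k A (fun x => (\det (M x))^-1).
  by apply: Ck_onV => // [x /uM|]; [rewrite unitmxE unitfE|exact: Ck_on_det].
have kc : Ck_on k A (fun x => cofactor (M x) j i).
  apply: Ck_onM => //; first exact: Ck_on_cst.
  apply: Ck_on_det => // i' j'.
  by apply: Ck_on_eq (kM (lift j i') (lift i j')) => // x _; rewrite !mxE.
apply: Ck_on_eq (Ck_onM oA kd kc) => // x /uM ux.
by rewrite /invmx ux !mxE.
Qed.

End SmoothMatrix.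

Section Spray.
Context {R : realType} (n : nat).
Local Notation E := 'rV[R]_n.
Variables (f : E * E -> R) (A : set (E * E)).
Hypothesis oA : open A.
Hypothesis sf : smooth_on A f.

Lemma smooth_metric_sq : smooth_on A (metric_sq f).
Proof. by move=> k; apply: Ck_on_eq (Ck_onM oA (sf k) (sf k)) => // z _; rewrite /metric_sq expr2. Qed.

Lemma smooth_fundamental i j : smooth_on A (fun z => fundamental_tensor f z i j).
Proof.
move=> k; have [_ /(_ (0, delta_mx 0 j))[_ /(_ (0, delta_mx 0 i))]] := smooth_metric_sq k.+2.
move=> H; apply: Ck_on_eq (Ck_onM oA (Ck_on_cst (W := R) k A 2^-1) H) => // z _.
by rewrite mxE.
Qed.

Lemma smooth_spray i : (forall z, A z -> fundamental_tensor f z \in unitmx) -> smooth_on A (spray f i).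
Proof.
move=> unitg k; apply: Ck_onM => //; first exact: Ck_on_cst.
apply: Ck_on_sum => // j _; apply: Ck_onM => //.
  by apply: Ck_on_invmx => // i' j'; exact: smooth_fundamental.
apply: Ck_onD => //; last first.
  by apply: Ck_onN => //; have [_ H] := smooth_metric_sq k.+1; exact: H.
apply: Ck_on_sum => // l _; apply: Ck_onM => //.
  have [_ /(_ (0, delta_mx 0 j))[_ H]] := smooth_metric_sq k.+2; exact: H.
have := @Ck_on_affine _ (E * E)%type E k A setT (fun y => y 0 l) snd snd oA (@is_diff_snd R E E).
by apply => //; apply: Ck_on_entry; exact: openT.
Qed.

End Spray.

Lemma derive_snd (R : realType) (V W Z : normedModType R) (g : V * W -> Z) x y v :
  'D_(0, v) g (x, y) = 'D_v (fun y' => g (x, y')) y.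
Proof.
rewrite /derive; set g1 := fun h => h^-1 *: _; set g2 := fun h => h^-1 *: _.
suff -> : g1 = g2 by [].
apply/funext => h; rewrite /g1 /g2 /=; congr (_ *: (g _ - _)).
by congr pair; rewrite /= scaler0 add0r.
Qed.

Lemma derive_fst (R : realType) (V W Z : normedModType R) (g : V * W -> Z) x y v :
  'D_(v, 0) g (x, y) = 'D_v (fun x' => g (x', y)) x.
Proof.
rewrite /derive; set g1 := fun h => h^-1 *: _; set g2 := fun h => h^-1 *: _.
suff -> : g1 = g2 by [].
apply/funext => h; rewrite /g1 /g2 /=; congr (_ *: (g _ - _)).
by congr pair; rewrite /= scaler0 add0r.
Qed.

Lemma derive_linear_mx (R : realType) m n (M : 'M[R]_(m, n)) (y v : 'rV[R]_m) :
  differentiable (fun z : 'rV[R]_m => z *m M) y /\ 'D_v (fun z : 'rV[R]_m => z *m M) y = v *m M.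
Proof.
pose L : {linear 'rV[R]_m -> 'rV[R]_n} := mulmxr M.
have Lc : continuous L.
  apply: (@lipschitz_cont _ _ _ _ (m%:R * `|M|)) => a b.
  by rewrite -linearB/= (le_trans (mx_norm_mul _ _))// mulrAC.
have [d e] : is_diff y L L.
  apply: eps_is_diff => // e e0; apply/nbhs_ballP; exists 1 => //= k _.
  by rewrite mulmxDl addrK subrr normr0 mulr_ge0// ltW.
split; first exact: d.
by rewrite -[LHS]/('D_v L y) deriveE// e.
Qed.

Section FibreDerivative.
Context {R : realType}.
Variables (e : 'rV[R]_2 -> R) (he : norm_sq e).

Lemma derive_infinitesimal (M : 'M[R]_2) y v : y != 0 ->
  'D_v (fun z => 'D_(z *m M) e z) y = hess e y v (y *m M) + 'D_(v *m M) e y.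
Proof.
move=> y0; have [dM DM] := derive_linear_mx M y v.
have dMi i : differentiable (fun z : 'rV[R]_2 => (z *m M) 0 i) y.
  by apply: (@differentiable_comp _ _ _ _ (fun z => z *m M) (fun w : 'rV[R]_2 => w 0 i)) => //; exact: differentiable_coord.
have DMi i : 'D_v (fun z : 'rV[R]_2 => (z *m M) 0 i) y = (v *m M) 0 i.
  by rewrite -DM derive_coord//; exact: diff_derivable.
pose g z : R := (z *m M) 0 0 * 'D_e1 e z + (z *m M) 0 1 * 'D_e2 e z.
have -> : 'D_v (fun z => 'D_(z *m M) e z) y = 'D_v g y.
  apply: (open_derive_eq _ open_slit y0) => z z0.
  by rewrite {1}(row2E (z *m M)) (deriveDv he _ _ z0) !(deriveZv he _ _ z0).
have dv1 : derivable (fun z => 'D_e1 e z) y v by apply/diff_derivable/(norm_sq_diff1 he).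
have dv2 : derivable (fun z => 'D_e2 e z) y v by apply/diff_derivable/(norm_sq_diff1 he).
have dm i : derivable (fun z : 'rV[R]_2 => (z *m M) 0 i) y v by apply/diff_derivable/dMi.
have D i : is_derive y v (fun z : 'rV[R]_2 => (z *m M) 0 i) ((v *m M) 0 i).
  by apply: DeriveDef; [exact: dm|exact: DMi].
have E1 : is_derive y v ('D_e1 e) (hess e y v e1) by exact: DeriveDef dv1 erefl.
have E2 : is_derive y v ('D_e2 e) (hess e y v e2) by exact: DeriveDef dv2 erefl.
have [_ ->] : is_derive y v g _ := is_deriveD (is_deriveM (D 0) E1) (is_deriveM (D 1) E2).
have -> : hess e y v (y *m M) = (y *m M) 0 0 * hess e y v e1 + (y *m M) 0 1 * hess e y v e2.
  by rewrite -(hessZr he _ _ _ y0) -(hessZr he _ _ _ y0) -(hessDr he _ _ _ y0) -row2E.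
have -> : 'D_(v *m M) e y = (v *m M) 0 0 * 'D_e1 e y + (v *m M) 0 1 * 'D_e2 e y.
  by rewrite {1}(row2E (v *m M)) (deriveDv he _ _ y0) !(deriveZv he _ _ y0).
rewrite /GRing.scale/=.
move: (hess e y v e1) (hess e y v e2) ('D_e1 e y) ('D_e2 e y) => a b c d.
move: ((y *m M) 0 0) ((y *m M) 0 1) ((v *m M) 0 0) ((v *m M) 0 1) => *; ring.
Qed.

Lemma derive_sumc (I : finType) (c : I -> R) (g : I -> 'rV[R]_2 -> R) y v :
  (forall i, differentiable (g i) y) ->
  'D_v (fun z => \sum_i c i * g i z) y = \sum_i c i * 'D_v (g i) y.
Proof.
move=> dg; have -> : (fun z => \sum_i c i * g i z) = \sum_i (c i *: g i).
  by apply/funext => z; rewrite fct_sumE.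
have [_ ->] : is_derive y v (\sum_i (c i *: g i)) (\sum_i c i *: 'D_v (g i) y).
  elim/big_ind2 : _ => [|f1 d1 f2 d2 H1 H2|i _]; [exact: is_derive_cst|exact: is_deriveD|].
  by apply: is_deriveZ; apply: DeriveDef => //; exact/diff_derivable.
by [].
Qed.

End FibreDerivative.

(** * Spray, torsion and the Landsberg condition *)

Lemma hess_fib (R : realType) (Q : 'rV[R]_2 * 'rV[R]_2 -> R) x y v w :
  'D_(0, v) ('D_(0, w) Q) (x, y) = hess (fib Q x) y v w.
Proof.
rewrite hessE; apply: (etrans (derive_snd _ _ _ _)).
have -> : (fun y' => 'D_(0, w) Q (x, y')) = 'D_w (fib Q x) by apply/funext => z; exact: derive_snd.
by [].
Qed.

Lemma is_diff_pairl (R : realType) (V W : normedModType R) (x : V) (y : W) :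
  is_diff y (fun y' : W => (x, y')) (fun v => (0, v)).
Proof.
have H := is_diff_pair (is_diff_cst x y) (is_diff_id y).
by apply: is_diff_eq H _.
Qed.

Lemma is_diff_pairr (R : realType) (V W : normedModType R) (x : V) (y : W) :
  is_diff x (fun x' : V => (x', y)) (fun v => (v, 0)).
Proof.
have H := is_diff_pair (is_diff_id x) (is_diff_cst y x).
by apply: is_diff_eq H _.
Qed.

Lemma derive3_sum (R : realType) (g : 'rV[R]_2 -> R) (h y : 'rV[R]_2) :
  Ck_on 3 slit g -> y != 0 ->
  'D_h ('D_h ('D_h g)) y = \sum_j \sum_k \sum_l
    h 0 j * h 0 k * h 0 l * 'D_(delta_mx 0 j) ('D_(delta_mx 0 k) ('D_(delta_mx 0 l) g)) y.
Proof.
move=> kg y0.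
have step k (f : 'rV[R]_2 -> R) (I : finType) (c : I -> R) (F : I -> 'rV[R]_2 -> R) :
    Ck_on k.+1 slit f -> (forall i, Ck_on k.+1 slit (F i)) ->
    (forall z, z != 0 -> f z = \sum_i c i * F i z) ->
    forall z, z != 0 -> 'D_h f z = \sum_j \sum_i h 0 j * c i * 'D_(delta_mx 0 j) (F i) z.
  move=> kf kF fE z z0; have df z' : z' != 0 -> differentiable f z' by have [+ _] := kf; apply.
  rewrite derive_row//; last exact: df.
  apply: eq_bigr => j _; rewrite (open_derive_eq _ open_slit z0 fE) derive_sumc; last first.
    by move=> i; have [+ _] := kF i; apply.
  by rewrite mulr_sumr; apply: eq_bigr => i _; rewrite mulrA.
have k1 v : Ck_on 2 slit ('D_v g) by have [_] := kg; apply.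
have k2 v w : Ck_on 1 slit ('D_v ('D_w g)) by have [_] := k1 w; apply.
have s1 z : z != 0 -> 'D_h g z = \sum_l h 0 l * 'D_(delta_mx 0 l) g z.
  by move=> z0; rewrite derive_row//; have [+ _] := kg; apply.
have s2 := step _ _ _ _ _ (k1 h) (fun l => k1 (delta_mx 0 l)) s1.
have s2' z : z != 0 -> 'D_h ('D_h g) z = \sum_(p : 'I_2 * 'I_2)
    (h 0 p.1 * h 0 p.2) * 'D_(delta_mx 0 p.1) ('D_(delta_mx 0 p.2) g) z.
  by move=> z0; rewrite s2// pair_big.
have s3 := step _ _ _ _ _ (k2 h h) (fun p => k2 (delta_mx 0 p.1) (delta_mx 0 p.2)) s2' y y0.
apply: (etrans s3); apply: eq_bigr => j _.
by rewrite [RHS]pair_big/=; apply: eq_bigr => p _; congr (_ * _); exact: mulrA.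
Qed.

(** Stated for any function of class C^2, so that it also serves to establish
    positivity of the Hessian from that of the fundamental tensor. *)
Lemma hess_sum (R : realType) (e : 'rV[R]_2 -> R) (y u v : 'rV[R]_2) :
  Ck_on 2 slit e -> y != 0 ->
  hess e y u v = \sum_i \sum_j u 0 i * v 0 j * hess e y (delta_mx 0 i) (delta_mx 0 j).
Proof.
move=> [de De] y0; have d1 w z : z != 0 -> differentiable ('D_w e) z by have [+ _] := De w; apply.
have s1 z : slit z -> 'D_v e z = \sum_j v 0 j * 'D_(delta_mx 0 j) e z.
  by move=> z0; rewrite derive_row//; exact: de.
rewrite hessE (open_derive_eq _ open_slit y0 s1) derive_sumc; last by move=> j; exact: d1.
rewrite exchange_big; apply: eq_bigr => j _; rewrite derive_row; last exact: d1.
by rewrite mulr_sumr; apply: eq_bigr => i _; rewrite hessE mulrCA mulrA.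
Qed.

Section SprayOfTransport.
Context {R : realType}.
Local Notation E := 'rV[R]_2.
Variables (f : E * E -> R) (U : set E).
Let A : set (E * E) := [set z | U z.1 /\ z.2 != 0].
Hypothesis oU : open U.
Hypothesis oA : open A.
Hypothesis sf : smooth_on A f.
Let Q := metric_sq f.
Hypothesis Qn : forall x, U x -> norm_sq (fib Q x).

Lemma fundamentalE x y i j :
  fundamental_tensor f (x, y) i j = 2^-1 * hess (fib Q x) y (delta_mx 0 i) (delta_mx 0 j).
Proof.
by rewrite mxE; apply: (congr1 (fun t => 2^-1 * t)); exact: hess_fib.
Qed.

Lemma fundamental_form_hess x y u v : Ck_on 2 slit (fib Q x) -> y != 0 ->
  fundamental_form f (x, y) u v = 2^-1 * hess (fib Q x) y u v.
Proof.
move=> k2 y0; rewrite (hess_sum u v k2 y0) mulr_sumr; apply: eq_bigr => i _.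
by rewrite mulr_sumr; apply: eq_bigr => j _; rewrite fundamentalE -!mulrA mulrCA mulrC !mulrA.
Qed.

Lemma fundamental_formE x y u v : U x -> y != 0 ->
  fundamental_form f (x, y) u v = 2^-1 * hess (fib Q x) y u v.
Proof. by move=> Ux; have [s _ _] := Qn Ux; exact: fundamental_form_hess. Qed.

Lemma fundamental_unit z : A z -> fundamental_tensor f z \in unitmx.
Proof.
case: z => x y [/= Ux y0]; rewrite -row_free_unit -kermx_eq0; apply/eqP/row_matrixP => i.
rewrite row0; apply/eqP/negPn/negP => k0.
have := hess_pos (Qn Ux) y0 k0; set k := row i _.
have kg : k *m fundamental_tensor f (x, y) = 0 by rewrite -row_mul mulmx_ker row0.
have : fundamental_form f (x, y) k k = 0.
  rewrite /fundamental_form exchange_big/=; apply: big1 => j _.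
  move/rowP/(_ j) : kg; rewrite !mxE => kg.
  under eq_bigr do rewrite [_ * k 0 _]mulrC.
  by rewrite -mulr_suml kg mul0r.
by rewrite fundamental_formE// => /eqP; rewrite mulf_eq0 invr_eq0 pnatr_eq0/= => /eqP ->; rewrite ltxx.
Qed.

Lemma smooth_sprayU i : smooth_on A (spray f i).
Proof. by apply: smooth_spray => // z; exact: fundamental_unit. Qed.

Definition spray_row x y : E := \row_i spray f i (x, y).

Variables (x0 : E) (S : E -> 'M[R]_2).
Hypothesis Ux0 : U x0.
Hypothesis St : transport_at Q x0 S.
Let e := fib Q x0.
Let he : norm_sq e := Qn Ux0.

Lemma transportD v w : S (v + w) = S v + S w.
Proof.
by have [lin _] := St; rewrite lin (lin v) (lin w) !mxE !scalerDl addrACA.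
Qed.

Lemma transportZ (a : R) v : S (a *: v) = a *: S v.
Proof. by have [lin _] := St; rewrite lin (lin v) !mxE scalerDr !scalerA. Qed.

Lemma transport_sum v : S v = \sum_k v 0 k *: S (delta_mx 0 k).
Proof. by have [lin _] := St; rewrite lin sum_ord2. Qed.

(** The torsion of the connection, which in dimension 2 is determined by its
    value on the basis; see [torsionE]. *)
Definition torsion : E := e2 *m S e1 - e1 *m S e2.

Lemma torsionE y v : v *m S y - y *m S v = det2 y v *: torsion.
Proof.
have [lin _] := St; rewrite (lin y) (lin v) {1}(row2E v) {3}(row2E y).
rewrite /torsion !mulmxDl !mulmxDr -!scalemxAl -!scalemxAr !scalerA /det2 scalerBr !scalerBl.
apply/rowP => i; rewrite !mxE; ring.
Qed.

Lemma mixed_derivative y k v : y != 0 ->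
  'D_(delta_mx 0 k, 0) ('D_(0, v) Q) (x0, y) =
  hess e y v (y *m S (delta_mx 0 k)) + 'D_(v *m S (delta_mx 0 k)) e y.
Proof.
move=> y0; have Az : A (x0, y) by [].
rewrite (derive_swap _ _ oA Az (smooth_metric_sq oA sf 2)) derive_snd.
apply: (etrans _ (derive_infinitesimal he (S (delta_mx 0 k)) v y0)).
apply: (open_derive_eq _ open_slit y0) => z z0.
by have [_ St2] := St; apply: (etrans (derive_fst _ _ _ _)); exact: St2.
Qed.

(** The Euler-Lagrange equations, written through the infinitesimal transport:
    the spray differs from the quadratic one by a torsion term. *)
Lemma hess_spray y v : y != 0 ->
  hess e y (2 *: spray_row x0 y - y *m S y) v = det2 y v * 'D_torsion e y.
Proof.
move=> y0; have Az : A (x0, y) by [].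
pose rhs j := \sum_k partial_x k (partial_y j Q) (x0, y) * y 0 k - partial_x j Q (x0, y).
have rhsE j : rhs j = hess e y (delta_mx 0 j) (y *m S y) + 'D_(delta_mx 0 j *m S y) e y
    - 'D_(y *m S (delta_mx 0 j)) e y.
  have [_ St2] := St.
  rewrite /rhs /partial_x /partial_y [X in _ - X]derive_fst -/(dxQ _ _ _ _) St2//; congr (_ - _).
  rewrite (transport_sum y) !sum_ord2 !mixed_derivative//.
  rewrite !mulmxDr -!scalemxAr (hessDr he _ _ _ y0) !(hessZr he _ _ _ y0) (deriveDv he _ _ y0) !(deriveZv he _ _ y0).
  move: (hess e y _ _) (hess e y _ _) ('D_(_) e y) ('D_(_) e y) => *; ring.
have gG : fundamental_tensor f (x0, y) *m (spray_row x0 y)^T = 4^-1 *: \col_j rhs j.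
  have -> : (spray_row x0 y)^T = 4^-1 *: (invmx (fundamental_tensor f (x0, y)) *m \col_j rhs j).
    apply/colP => i; rewrite !mxE /spray; congr (_ * _).
    by apply: eq_bigr => j _; rewrite mxE.
  by rewrite -scalemxAr mulKVmx// fundamental_unit.
have hG j : hess e y (delta_mx 0 j) (spray_row x0 y) = 2^-1 * rhs j.
  move/colP/(_ j) : gG; rewrite !mxE sum_ord2 !fundamentalE !mxE => gG.
  rewrite {1}(row2E (spray_row x0 y)) (hessDr he _ _ _ y0) !(hessZr he _ _ _ y0).
  rewrite !mxE; have -> : 2^-1 * rhs j = 2 * (4^-1 * rhs j) by field.
  rewrite -gG; move: (hess e y _ _) (hess e y _ _) => *; by field.
have hGv : 2 * hess e y v (spray_row x0 y) = hess e y v (y *m S y) + 'D_(v *m S y) e y - 'D_(y *m S v) e y.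
  rewrite {1}(row2E v) (hessDl he _ _ _ y0) !(hessZl he _ _ _ y0) !hG !rhsE -/e1 -/e2.
  have [lin _] := St; rewrite (lin v) mulmxDr -!scalemxAr (deriveDv he _ _ y0) !(deriveZv he _ _ y0).
  have -> : hess e y v (y *m S y) = v 0 0 * hess e y e1 (y *m S y) + v 0 1 * hess e y e2 (y *m S y).
    by rewrite -!(hessZl he _ _ _ y0) -(hessDl he _ _ _ y0) -row2E.
  have -> : 'D_(v *m S y) e y = v 0 0 * 'D_(e1 *m S y) e y + v 0 1 * 'D_(e2 *m S y) e y.
    by rewrite -!(deriveZv he _ _ y0) -(deriveDv he _ _ y0) !scalemxAl -mulmxDl -row2E.
  move: (hess e y _ _) (hess e y _ _) ('D_(_) e y) ('D_(_) e y) ('D_(_) e y) ('D_(_) e y) => *; by field.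
rewrite (hessC he _ _ y0) (hessDr he _ _ _ y0) (hessZr he _ _ _ y0) hGv.
rewrite -[- (y *m S y)]scaleN1r (hessZr he _ _ _ y0) -(deriveZv he _ _ y0) -torsionE.
rewrite -[- (y *m S v)]scaleN1r (deriveDv he _ _ y0) (deriveZv he _ _ y0).
ring.
Qed.

Lemma partial_y_slice (g : E * E -> R) i x :
  (fun y => partial_y i g (x, y)) = 'D_(delta_mx 0 i) (fun y => g (x, y)).
Proof. by apply/funext => y; exact: derive_snd. Qed.

Lemma berwald_slice i j k l x y : berwald_coef f i j k l (x, y) =
  'D_(delta_mx 0 j) ('D_(delta_mx 0 k) ('D_(delta_mx 0 l) (fun y => spray f i (x, y)))) y.
Proof.
have step (g : E * E -> R) (g' : E -> R) m : (fun y => g (x, y)) = g' ->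
    (fun y => partial_y m g (x, y)) = 'D_(delta_mx 0 m) g'.
  by move=> <-; exact: partial_y_slice.
exact: (congr1 (fun g => g y) (step _ _ j (step _ _ k (step _ _ l erefl)))).
Qed.

Lemma Ck_spray_y k i x : U x -> Ck_on k slit (fun y => spray f i (x, y)).
Proof.
move=> Ux; have H := @Ck_on_affine _ E (E * E)%type k slit A (spray f i) (fun y => (x, y)) _ open_slit
  (@is_diff_pairl R E E x).
by apply: H => //; exact: smooth_sprayU.
Qed.

Lemma Ck_spray_x k i y : y != 0 -> Ck_on k U (fun x => spray f i (x, y)).
Proof.
move=> y0; have H := @Ck_on_affine _ E (E * E)%type k U A (spray f i) (fun x => (x, y)) _ oU
  (fun x => @is_diff_pairr R E E x y).
by apply: H => //; exact: smooth_sprayU.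
Qed.

(** The Landsberg tensor on the diagonal, as third derivatives of the spray
    contracted with the differential of the squared norm. *)
Lemma landsberg_derive3 y h : y != 0 -> landsberg f (x0, y) h h h = 0 ->
  'D_(\row_i 'D_h ('D_h ('D_h (fun y => 2 * spray f i (x0, y)))) y) e y = 0.
Proof.
move=> y0; have BE : \row_i 'D_h ('D_h ('D_h (fun y => 2 * spray f i (x0, y)))) y = 2 *: berwald f (x0, y) h h h.
  apply/rowP => i; rewrite !mxE.
  have k2 : Ck_on 3 slit (fun y => 2 * spray f i (x0, y)).
    by apply: Ck_onM; [exact: open_slit|exact: Ck_on_cst|exact: Ck_spray_y].
  rewrite derive3_sum// mulr_sumr; apply: eq_bigr => j _.
  rewrite mulr_sumr; apply: eq_bigr => k _; rewrite mulr_sumr; apply: eq_bigr => l _.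
  rewrite berwald_slice.
  have ks := Ck_spray_y 3 i Ux0.
  have s1 v z : z != 0 -> 'D_v (fun y => 2 * spray f i (x0, y)) z = 2 * 'D_v (fun y => spray f i (x0, y)) z.
    by move=> z0; rewrite -[LHS]/('D_v (2 *: (fun y => spray f i (x0, y))) z) deriveZ//; apply: diff_derivable; have [+ _] := ks; apply.
  have s2 w v z : z != 0 -> 'D_w ('D_v (fun y => 2 * spray f i (x0, y))) z = 2 * 'D_w ('D_v (fun y => spray f i (x0, y))) z.
    move=> z0; rewrite (open_derive_eq _ open_slit z0 (s1 v)).
    rewrite -[LHS]/('D_w (2 *: ('D_v (fun y => spray f i (x0, y)))) z) deriveZ//; apply: diff_derivable.
    by have [_ /(_ v)[+ _]] := ks; apply.
  have s3 u w v z : z != 0 -> 'D_u ('D_w ('D_v (fun y => 2 * spray f i (x0, y)))) z =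
      2 * 'D_u ('D_w ('D_v (fun y => spray f i (x0, y)))) z.
    move=> z0; apply: (etrans (open_derive_eq _ open_slit z0 (s2 w v))).
    apply: (@deriveZ _ _ _ ('D_w ('D_v (fun y => spray f i (x0, y)))) 2); apply: diff_derivable.
    by have [_ /(_ v)[_ /(_ w)[+ _]]] := ks; apply.
  apply: (etrans (congr1 (fun t => h 0 j * h 0 k * h 0 l * t)
    (s3 (delta_mx 0 j) (delta_mx 0 k) (delta_mx 0 l) y y0))).
  by move: ('D_(_) _ y) => d; ring.
rewrite BE (deriveZv he _ _ y0) /landsberg fundamental_formE//= (hessC he _ _ y0) (hess_euler he _ y0).
move: ('D_(_) e y) => d /eqP; rewrite !mulf_eq0 oppr_eq0 !invr_eq0 pnatr_eq0/= => /eqP ->.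
by rewrite mulr0.
Qed.

(** A torsion would, by the rigidity of the Landsberg equation along lines,
    force the fibre to be Euclidean. *)
Lemma landsberg_torsion_eq0 : ~ euclidean_fibre e ->
  (forall y h, y != 0 -> landsberg f (x0, y) h h h = 0) -> torsion = 0.
Proof.
move=> ne L; apply/eqP/negPn/negP => tau0; apply: ne.
apply: (hess_cst_of_propagation he) => u h uh um t.
have WE y v : y != 0 -> hess e y (2 *: spray_row x0 y - y *m S y) v = det2 y v * 'D_torsion e y.
  exact: hess_spray.
have GE i y : y != 0 -> 2 * spray f i (x0, y) = (y *m S y) 0 i + (2 *: spray_row x0 y - y *m S y) 0 i.
  move=> _; have mx (X Y : E) : X 0 i = Y 0 i + (X - Y) 0 i by rewrite !mxE subrKC.
  by rewrite -mx !mxE.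
have Qq i (a b : E) : exists c0 c1 c2 : R, forall s : R,
    ((a + s *: b) *m S (a + s *: b)) 0 i = c0 + c1 * s + c2 * s ^+ 2.
  exists ((a *m S a) 0 i), ((a *m S b + b *m S a) 0 i), ((b *m S b) 0 i) => s.
  rewrite transportD transportZ !mulmxDl !mulmxDr -!scalemxAl -!scalemxAr.
  have mx (X Y Z T : E) : (X + s *: Y + (s *: Z + s *: (s *: T))) 0 i = X 0 i + (Y + Z) 0 i * s + T 0 i * s ^+ 2.
    by rewrite !mxE; ring.
  exact: mx.
have LG y k : y != 0 -> 'D_(\row_i 'D_k ('D_k ('D_k (fun y => 2 * spray f i (x0, y)))) y) e y = 0.
  by move=> y0; apply: landsberg_derive3 => //; exact: L.
exact: (torsion_line he WE GE Qq LG uh tau0 (max_disc_phi3 he uh um)).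
Qed.

(** Without torsion the correction term in [hess_spray] vanishes. *)
Lemma spray_quadratic y : torsion = 0 -> y != 0 -> 2 *: spray_row x0 y = y *m S y.
Proof.
move=> tau0 y0; have [h yh] := exists_indep y0.
have Z v : hess e y (2 *: spray_row x0 y - y *m S y) v = 0.
  rewrite hess_spray// tau0 (_ : 'D_0 e y = 0) ?mulr0// derive0//.
have Z0 v : hess e y 0 v = 0 by rewrite -[X in hess e y X v](scale0r 0) (hessZl he _ _ _ y0) mul0r.
apply/eqP; rewrite -subr_eq0; apply/eqP.
by apply: (hess_nondeg he y0 yh); rewrite Z Z0.
Qed.

End SprayOfTransport.

Section SymmetricConnection.
Context {R : realType}.
Local Notation E := 'rV[R]_2.
Variables (f : E * E -> R) (U : set E).
Let A : set (E * E) := [set z | U z.1 /\ z.2 != 0].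
Hypothesis oU : open U.
Hypothesis oA : open A.
Hypothesis sf : smooth_on A f.
Hypothesis Qn : forall x, U x -> norm_sq (fib (metric_sq f) x).
Hypothesis Qne : forall x, U x -> ~ euclidean_fibre (fib (metric_sq f) x).
Hypothesis L : forall x y h, U x -> y != 0 -> landsberg f (x, y) h h h = 0.
Variable Gam : E -> E -> 'M[R]_2.
Hypothesis GamP : forall x, U x -> transport_at (metric_sq f) x (Gam x).

Lemma torsion_eq0 x : U x -> torsion (Gam x) = 0.
Proof.
move=> Ux; apply: (landsberg_torsion_eq0 oA sf Qn Ux (GamP Ux)); first exact: Qne.
by move=> y h; exact: L.
Qed.

Lemma connection_sym x v y : U x -> v *m Gam x y = y *m Gam x v.
Proof.
move=> Ux; apply/eqP; rewrite -subr_eq0 (torsionE (GamP Ux)) torsion_eq0//.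
by rewrite scaler0.
Qed.

(** The spray determines the symmetric connection by polarization, and the spray
    is smooth. *)
Lemma connection_smooth v i j : smooth_on U (fun x => Gam x v i j).
Proof.
move=> k; have e10 := @e1_neq0 R; have e20 := @e2_neq0 R.
have e120 : (e1 + e2 : E) != 0.
  by apply/eqP => /rowP/(_ 1); rewrite !mxE/= add0r => /eqP; rewrite oner_eq0.
have sq x y l : U x -> y != 0 -> (y *m Gam x y) 0 l = 2 * spray f l (x, y).
  by move=> Ux y0; rewrite -(spray_quadratic oA sf Qn Ux (GamP Ux) (torsion_eq0 Ux) y0) !mxE.
have k11 l : Ck_on k U (fun x => (e1 *m Gam x e1) 0 l).
  apply: Ck_on_eq (Ck_onM oU (Ck_on_cst (W := R) k U 2) (Ck_spray_x oU oA sf Qn k l e10)) => // x Ux.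
  by rewrite sq.
have k22 l : Ck_on k U (fun x => (e2 *m Gam x e2) 0 l).
  apply: Ck_on_eq (Ck_onM oU (Ck_on_cst (W := R) k U 2) (Ck_spray_x oU oA sf Qn k l e20)) => // x Ux.
  by rewrite sq.
have k12 l : Ck_on k U (fun x => (e1 *m Gam x e2) 0 l).
  apply: Ck_on_eq (Ck_onD oU (Ck_spray_x oU oA sf Qn k l e120) (Ck_onN oU
    (Ck_onD oU (Ck_spray_x oU oA sf Qn k l e10) (Ck_spray_x oU oA sf Qn k l e20)))) => // x Ux.
  have := sq x _ l Ux e120; rewrite (transportD (GamP Ux)) mulmxDl !mulmxDr (connection_sym e2 e1)//.
  have := sq x _ l Ux e10; have := sq x _ l Ux e20.
  move: (e1 *m Gam x e1) (e2 *m Gam x e2) (e1 *m Gam x e2) => X Y Z; rewrite !mxE => H2 H1 H3.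
  have : 2 * Z 0 l = 2 * (spray f l (x, e1 + e2) - (spray f l (x, e1) + spray f l (x, e2))).
    by rewrite mulrBr mulrDr -H1 -H2 -H3; ring.
  by move=> /(mulfI _) ->//; rewrite pnatr_eq0.
have kvw l : Ck_on k U (fun x => ((delta_mx 0 i : E) *m Gam x v) 0 l).
  have k21 : Ck_on k U (fun x => (e2 *m Gam x e1) 0 l).
    by apply: Ck_on_eq (k12 l) => // x Ux; rewrite connection_sym.
  have k1 : Ck_on k U (fun x => ((delta_mx 0 i : E) *m Gam x e1) 0 l).
    by have [->|->] := ord2P i; [exact: (Ck_on_eq oU _ (k11 l))|exact: (Ck_on_eq oU _ k21)].
  have k2 : Ck_on k U (fun x => ((delta_mx 0 i : E) *m Gam x e2) 0 l).
    by have [->|->] := ord2P i; [exact: (Ck_on_eq oU _ (k12 l))|exact: (Ck_on_eq oU _ (k22 l))].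
  have K := Ck_onD oU (Ck_onM oU (Ck_on_cst (W := R) k U (v 0 0)) k1)
    (Ck_onM oU (Ck_on_cst (W := R) k U (v 0 1)) k2).
  apply: (Ck_on_eq oU _ K) => x Ux.
  have [lin _] := GamP Ux; rewrite [in RHS]lin mulmxDr -!scalemxAr.
  by move: (_ *m _) (_ *m _) => X Y; rewrite !mxE.
by apply: Ck_on_eq (kvw j) => // x Ux; rewrite -rowE mxE.
Qed.

End SymmetricConnection.

(** * The Poincare lemma in the plane *)

Section Integrals.
Context {R : realType}.
Local Notation mu := (@lebesgue_measure R).

Lemma integrable_itv (f : R -> R) (a b : R) : (forall t, a <= t <= b -> {for t, continuous f}) ->
  mu.-integrable `[a, b] (EFin \o f).
Proof.
move=> cf; apply: continuous_compact_integrable; first exact: segment_compact.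
by apply: continuous_in_subspaceT => t; rewrite inE/= in_itv/=; exact: cf.
Qed.

Lemma derive_primitive (f : R -> R) (a u t : R) : (forall t, a <= t <= u -> {for t, continuous f}) ->
  a < t < u -> is_derive t 1 (fun t => \int[mu]_(s in `[a, t]) f s) (f t).
Proof.
move=> cf /andP[at_ tu].
have cft : {for t, continuous f} by apply: cf; rewrite !ltW.
have [d e] := continuous_FTC1_closed tu (integrable_itv cf) at_ cft.
by apply: DeriveDef; [exact: d|rewrite -e -derive1E].
Qed.

Lemma integral_derivative (f F : R -> R) (a b : R) : a < b ->
  (forall t, a <= t <= b -> {for t, continuous f}) ->
  (forall t, a <= t <= b -> is_derive t 1 F (f t)) ->
  \int[mu]_(s in `[a, b]) f s = F b - F a.
Proof.
move=> ab cf dF.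
have cF t : a <= t <= b -> {for t, continuous F}.
  by move=> /dF[d _]; apply: differentiable_continuous; apply/derivable1_diffP.
have i01 : a <= a <= b by rewrite lexx ltW.
have i11 : a <= b <= b by rewrite lexx ltW.
rewrite /Rintegral (@continuous_FTC2 _ f F)//.
- by apply: continuous_in_subspaceT => t; rewrite inE/= in_itv/=; exact: cf.
- split.
  + by move=> t; rewrite in_itv/= => /andP[ta tb]; have [] := dF t; rewrite ?ltW.
  + by apply: cvg_at_right_filter; exact: cF.
  + by apply: cvg_at_left_filter; exact: cF.
- by move=> t; rewrite in_itv/= => /andP[ta tb]; have [|_ <-] := dF t; rewrite ?ltW// derive1E.
Qed.

Lemma derive_integral (h dh : R -> R -> R) (s0 s1 a b M s : R) :
  s0 < s < s1 ->
  (forall x t, s0 < x < s1 -> a <= t <= b -> {for t, continuous (h x)}) ->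
  (forall x t, s0 < x < s1 -> a <= t <= b -> is_derive x 1 (h^~ t) (dh x t)) ->
  (forall x t, s0 < x < s1 -> a <= t <= b -> `|dh x t| <= M) ->
  is_derive s 1 (fun x => \int[mu]_(t in `[a, b]) h x t) (\int[mu]_(t in `[a, b]) dh s t).
Proof.
move=> ss ch hd hM.
have mB : measurable (`[a, b]%classic : set (measurableTypeR R)) by exact: measurable_itv.
have Is : `]s0, s1[%classic s by rewrite /= in_itv.
have I1 x : `]s0, s1[%classic x -> mu.-integrable `[a, b] (EFin \o h x).
  by rewrite /= in_itv/= => xs; apply: integrable_itv => t; exact: ch.
have I2 x y : `]s0, s1[%classic x -> `[a, b]%classic y -> derivable (h^~ y) x 1.
  by rewrite /= !in_itv/= => xs ys; have [] := hd x y xs ys.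
have I3 (y : R) : 0 <= (fun=> `|M|) y by [].
have I4 : mu.-integrable `[a, b] (EFin \o (fun=> `|M|)).
  by apply: integrable_itv => t _; exact: cst_continuous.
have I5 x y : `]s0, s1[%classic x -> `[a, b]%classic y -> `|partial1of2 h x y| <= `|M|.
  rewrite /= !in_itv/= => xs ys; rewrite partial1of2E; have [_ ->] := hd x y xs ys.
  by rewrite (le_trans (hM _ _ xs ys))// ler_norm.
apply: DeriveDef.
  have H := @derivable_under_integral _ _ _ mu h _ mB _ _ _ Is I1 I2 _ I3 I4 I5. exact: H.
rewrite -derive1E (differentiation_under_integral mB Is I1 I2 I3 I4 I5).
apply: eq_Rintegral => y; rewrite inE/= in_itv/= => ys.
by rewrite partial1of2E; have [_ ->] := hd s y ss ys.
Qed.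

End Integrals.

Lemma mean_value_real (R : realType) (g dg : R -> R) (s h : R) :
  (forall t : R, 0 <= t <= 1 -> is_derive (s + t * h) 1 g (dg (s + t * h))) ->
  exists2 t : R, 0 < t < 1 & g (s + h) - g s = h * dg (s + t * h).
Proof.
move=> dgt.
have dd (t : R) : 0 <= t <= 1 -> differentiable g (s + t * h).
  by move=> /dgt[d _]; apply/derivable1_diffP.
have [|t t01 E] := @mean_value_line R R g s h.
  by move=> t t01; apply: diff_derivable; exact: dd.
have t01' : 0 <= t <= 1 by case/andP: t01 => ? ?; rewrite !ltW.
exists t => //; rewrite E deriveE; last exact: dd.
have [_ <-] := dgt t t01'; rewrite deriveE; last exact: dd.
set L := 'd g _; move: L => L.
have := linearZ_LR L h (1 : R); rewrite /GRing.scale/= mulr1 => H; exact: H.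
Qed.

Section Poincare.
Context {R : realType}.
Local Notation E := 'rV[R]_2.
Local Notation mu := (@lebesgue_measure R).

Definition pt (s t : R) : E := s *: e1 + t *: e2.

Lemma ptE (x : E) : x = pt (x 0 0) (x 0 1).
Proof. exact: row2E. Qed.

Lemma pt_fst s t : (pt s t) 0 0 = s.
Proof. by rewrite !mxE/= mulr1 mulr0 addr0. Qed.

Lemma pt_snd s t : (pt s t) 0 1 = t.
Proof. by rewrite !mxE/= mulr1 mulr0 add0r. Qed.

Lemma derive_pt1 (b : E -> R) s t : differentiable b (pt s t) ->
  is_derive s 1 (fun s => b (pt s t)) ('D_e1 b (pt s t)).
Proof.
move=> db; have ptC s' : pt s' t = t *: e2 + s' *: e1 by rewrite /pt addrC.
have -> : (fun s' => b (pt s' t)) = (fun s' => b (t *: e2 + s' *: e1)).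
  by apply/funext => s'; rewrite ptC.
apply: DeriveDef; last by rewrite derive_line -ptC.
by apply: derivable_line; apply: diff_derivable; rewrite -ptC.
Qed.

Lemma derive_pt2 (b : E -> R) s t : differentiable b (pt s t) ->
  is_derive t 1 (fun t => b (pt s t)) ('D_e2 b (pt s t)).
Proof.
move=> db; apply: DeriveDef; last by rewrite derive_line.
by apply: derivable_line; apply: diff_derivable.
Qed.

Lemma cont_pt2 (b : E -> R) s t : {for pt s t, continuous b} -> {for t, continuous (fun t => b (pt s t))}.
Proof.
move=> cb; apply: (@continuous_comp _ _ _ (fun t => pt s t) b) => //.
by apply: cvgD; [exact: cvg_cst|apply: cvgZr_tmp; exact: cvg_id].
Qed.

Lemma cont_pt1 (b : E -> R) s t : {for pt s t, continuous b} -> {for s, continuous (fun s => b (pt s t))}.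
Proof.
move=> cb; apply: (@continuous_comp _ _ _ (fun s => pt s t) b) => //.
by apply: cvgD; [apply: cvgZr_tmp; exact: cvg_id|exact: cvg_cst].
Qed.

(** The closed form b1 dx1 + b2 dx2 is integrated along a horizontal side and
    then along a vertical one; by closedness the derivative of the vertical
    integral in the horizontal direction is a difference of values of b1. *)
Lemma poincare (p : E) (d : R) (b1 b2 : E -> R) : 0 < d ->
  Ck_on 1 [set x | `|x - p| < d] b1 -> Ck_on 1 [set x | `|x - p| < d] b2 ->
  (forall x, `|x - p| < d -> 'D_e1 b2 x = 'D_e2 b1 x) ->
  exists g : E -> R, exists2 r : R, 0 < r & forall x, `|x - p| < r -> forall e : R, 0 < e ->
    \forall h \near (0 : E), `|g (h + x) - g x - (h 0 0 * b1 x + h 0 1 * b2 x)| <= e * `|h|.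
Proof.
move=> d0 [db1 Db1] [db2 Db2] closed.
pose r := d / 2; have r0 : 0 < r by rewrite divr_gt0.
have rd : r < d by rewrite /r; lra.
pose a1 := p 0 0 - r; pose u1 := p 0 0 + r; pose a2 := p 0 1 - r; pose u2 := p 0 1 + r.
have inV s t : a1 <= s <= u1 -> a2 <= t <= u2 -> `|pt s t - p| < d.
  move=> sI tI; apply: le_lt_trans rd; apply: mx_norm_le => [|i j]; first exact: ltW.
  rewrite ord1 mx_subE.
  by have [->|->] := ord2P j; rewrite ?pt_fst ?pt_snd ler_distl.
have cb1 s t : a1 <= s <= u1 -> a2 <= t <= u2 -> {for pt s t, continuous b1}.
  by move=> sI tI; apply/differentiable_continuous/db1/inV.
have cb2 s t : a1 <= s <= u1 -> a2 <= t <= u2 -> {for pt s t, continuous b2}.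
  by move=> sI tI; apply/differentiable_continuous/db2/inV.
have cD12 s t : a1 <= s <= u1 -> a2 <= t <= u2 -> {for pt s t, continuous ('D_e1 b2)}.
  by move=> sI tI; apply: Db2; exact: inV.
have cD21 s t : a1 <= s <= u1 -> a2 <= t <= u2 -> {for pt s t, continuous ('D_e2 b1)}.
  by move=> sI tI; apply: Db1; exact: inV.
have a1u1 : a1 <= u1 by rewrite /a1 /u1; lra.
have a2u2 : a2 <= u2 by rewrite /a2 /u2; lra.
have [M HM] : exists M : R, forall s t, a1 <= s <= u1 -> a2 <= t <= u2 -> `|'D_e1 b2 (pt s t)| <= M.
  pose K := [set x : E | a1 <= x 0 0 <= u1 /\ a2 <= x 0 1 <= u2].
  have cK : compact K.
    have := @rV_compact R 2 (fun i => if i == 0 then `[a1, u1]%classic else `[a2, u2]%classic).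
    rewrite (_ : [set v | _] = K); last first.
      apply/seteqP; split => [v /= H|v [H1 H2] i].
        by split; [have := H 0|have := H 1]; rewrite /= in_itv.
      by have [->|->] := ord2P i; rewrite /= in_itv.
    by apply => i; case: ifP => _; exact: segment_compact.
  have [||c cK' cmax] := @EVT_max_rV R 2 (fun x => `|'D_e1 b2 x|) K _ cK.
  - by exists (pt a1 a2); rewrite /K/= pt_fst pt_snd !lexx.
  - apply: continuous_in_subspaceT => x; rewrite inE => -[x1 x2].
    apply: (@continuous_comp _ _ _ ('D_e1 b2) (fun y : R => `|y|)); last exact: norm_continuous.
    by rewrite (ptE x); exact: cD12.
  exists `|'D_e1 b2 c| => s t sI tI.
  by apply: (cmax (pt s t)); rewrite inE /K/= pt_fst pt_snd.
pose g1 s := \int[mu]_(t in `[a1, s]) b1 (pt t a2).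
pose g2 s t := \int[mu]_(t' in `[a2, t]) b2 (pt s t').
pose G s t := g1 s + g2 s t.
have dGt s t : a1 <= s <= u1 -> a2 < t < u2 -> is_derive t 1 (G s) (b2 (pt s t)).
  move=> sI tI; have H : is_derive t 1 (g2 s) (b2 (pt s t)).
    apply: (@derive_primitive R (fun t => b2 (pt s t)) a2 u2 t) => // t' t'I.
    by apply: cont_pt2; exact: cb2.
  by have := is_deriveD (is_derive_cst (g1 s) t (1 : R)) H; rewrite add0r.
have dGs s t : a1 < s < u1 -> a2 < t < u2 -> is_derive s 1 (fun s => G s t) (b1 (pt s t)).
  move=> sI /andP[at_ tu]; have sI' : a1 <= s <= u1 by case/andP: sI => ? ?; rewrite !ltW.
  have ia2 : a2 <= a2 <= u2 by rewrite lexx.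
  have H1 : is_derive s 1 g1 (b1 (pt s a2)).
    apply: (@derive_primitive R (fun t => b1 (pt t a2)) a1 u1 s) => // t' t'I.
    by apply: cont_pt1; exact: cb1.
  have tI' t' : a2 <= t' <= t -> a2 <= t' <= u2.
    by move=> /andP[-> t't]; rewrite (le_trans t't)// ltW.
  have H2 : is_derive s 1 (fun s => g2 s t) (\int[mu]_(t' in `[a2, t]) 'D_e1 b2 (pt s t')).
    have xI' x : a1 < x < u1 -> a1 <= x <= u1 by move=> /andP[? ?]; rewrite !ltW.
    apply: (@derive_integral R (fun s t' => b2 (pt s t')) (fun s t' => 'D_e1 b2 (pt s t')) a1 u1 a2 t M) => //.
    - by move=> x t' /xI' xI /tI' t'I; apply: cont_pt2; exact: cb2.
    - by move=> x t' /xI' xI /tI' t'I; apply: derive_pt1; apply: db2; exact: inV.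
    - by move=> x t' /xI' xI /tI' t'I; exact: HM.
  have I2 : \int[mu]_(t' in `[a2, t]) 'D_e1 b2 (pt s t') = b1 (pt s t) - b1 (pt s a2).
    apply: etrans (@integral_derivative R (fun t' => 'D_e2 b1 (pt s t')) (fun t' => b1 (pt s t')) a2 t at_ _ _).
    - apply: eq_Rintegral => t'; rewrite inE/= in_itv/= => /tI' t'I.
      by apply: closed; exact: inV.
    - by move=> t' /tI' t'I; exact: (@cont_pt2 ('D_e2 b1) s t' (cD21 s t' sI' t'I)).
    - by move=> t' /tI' t'I; exact: (@derive_pt2 b1 s t' (db1 _ (inV s t' sI' t'I))).
  by have := is_deriveD H1 H2; rewrite I2 subrKC.
exists (fun x => G (x 0 0) (x 0 1)), r => // x xr e e0.
have xp : x = pt (x 0 0) (x 0 1) by exact: ptE.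
have xI (i : 'I_2) : `|x 0 i - p 0 i| < r.
  by have := entry_le_norm (x - p) 0 i; rewrite !mxE => /le_lt_trans; apply.
have x1I : a1 <= x 0 0 <= u1 by have := xI 0; rewrite -ler_distl => /ltW.
have x2I : a2 <= x 0 1 <= u2 by have := xI 1; rewrite -ler_distl => /ltW.
have e20 : 0 < e / 2 by rewrite divr_gt0.
have c1 : {for x, continuous b1} by rewrite xp; exact: cb1.
have c2 : {for x, continuous b2} by rewrite xp; exact: cb2.
have [s1 s10 B1] := cont_delta c1 e20.
have [s2 s20 B2] := cont_delta c2 e20.
apply/nbhs_ballP; exists (Num.min (r - `|x - p|) (Num.min s1 s2)) => /=.
  by rewrite !lt_min subr_gt0 xr s10.
move=> h; rewrite -ball_normE/= sub0r normrN !lt_min => /and3P[hr hs1 hs2].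
set x1 := x 0 0; set x2 := x 0 1; set h1 := h 0 0; set h2 := h 0 1.
have h1n : `|h1| <= `|h| by exact: entry_le_norm.
have h2n : `|h2| <= `|h| by exact: entry_le_norm.
have small (i : 'I_2) (t : R) : 0 <= t <= 1 -> `|x 0 i + t * h 0 i - p 0 i| < r.
  move=> /andP[t0 t1]; have := entry_le_norm (x - p) 0 i; rewrite !mxE => xpi.
  have -> : x 0 i + t * h 0 i - p 0 i = (x 0 i - p 0 i) + t * h 0 i by ring.
  rewrite (le_lt_trans (ler_normD _ _))// normrM ger0_norm//.
  have := entry_le_norm h 0 i; have := normr_ge0 (h 0 i) => ? ?.
  rewrite (le_lt_trans (lerD xpi (_ : _ <= `|h|)))//; last by rewrite -ltrBrDl.
  by apply: le_trans (entry_le_norm h 0 i); exact: ler_piMl.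
have i01 : 0 <= (1 : R) <= 1 by rewrite ler01 lexx.
have bnd (q c t : R) : `|t - q| < c -> q - c < t < q + c by rewrite ltr_distl.
have bnd' (q c t : R) : `|t - q| < c -> q - c <= t <= q + c by rewrite ltr_distl => /andP[? ?]; rewrite !ltW.
have [|t t01 E1] := @mean_value_real R (fun s => G s (x2 + h2)) (fun s => b1 (pt s (x2 + h2))) x1 h1.
  move=> t t01; apply: dGs; first exact/bnd/small.
  by have := small 1 1 i01; rewrite mul1r => /bnd.
have [|t' t'01 E2] := @mean_value_real R (G x1) (fun t => b2 (pt x1 t)) x2 h2.
  by move=> t' t'01; apply: dGt => //; exact/bnd/small.
have hx i : (h + x) 0 i = x 0 i + h 0 i by rewrite mxE addrC.
rewrite !hx -/x1 -/x2 -/h1 -/h2.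
have -> : G (x1 + h1) (x2 + h2) - G x1 x2 - (h1 * b1 x + h2 * b2 x) =
   h1 * (b1 (pt (x1 + t * h1) (x2 + h2)) - b1 x) + h2 * (b2 (pt x1 (x2 + t' * h2)) - b2 x).
  by rewrite !mulrBr -E1 -E2; ring.
have near1 (a b : R) : `|a| <= `|h1| -> `|b| <= `|h2| -> `|pt (x1 + a) (x2 + b) - x| <= `|h|.
  move=> ah bh; apply: mx_norm_le => // i j; rewrite ord1 mx_subE.
  have [->|->] := ord2P j; rewrite ?pt_fst ?pt_snd addrAC subrr add0r; exact: le_trans _ h1n || exact: le_trans _ h2n.
have th (t0 h0 : R) : 0 < t0 < 1 -> `|t0 * h0| <= `|h0|.
  by move=> /andP[t00 t01_]; rewrite normrM (ger0_norm (ltW t00)); apply: ler_piMl => //; exact: ltW.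
have P1 : `|b1 (pt (x1 + t * h1) (x2 + h2)) - b1 x| <= e / 2.
  by apply/ltW/B1; apply: le_lt_trans hs1; apply: near1 => //; exact: th.
have P2 : `|b2 (pt x1 (x2 + t' * h2)) - b2 x| <= e / 2.
  apply/ltW/B2; apply: le_lt_trans hs2; rewrite -[x1]addr0; apply: near1; last exact: th.
  by rewrite normr0.
rewrite (le_trans (ler_normD _ _))// !normrM {1}(splitr e) mulrDl.
by apply: lerD; rewrite mulrC; apply: ler_pM.
Qed.

End Poincare.

(** * Inverse function theorem near the identity *)

Section NearIdentity.
Context {R : realType} (n : nat).
Local Notation E := 'rV[R]_n.
Variables (p : E) (r : R) (z : E -> E) (B : E -> 'M[R]_n).
Hypothesis r0 : 0 < r.
Let O : set E := [set x | `|x - p| < r].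
Hypothesis dz : forall x, O x -> differentiable z x.
Hypothesis Dz : forall x v, O x -> 'D_v z x = v *m B x.
Hypothesis sB : forall i j, smooth_on O (fun x => B x i j).
Hypothesis B1 : forall x, O x -> n%:R * `|B x - 1%:M| <= 2^-1.

Lemma open_norm_ball : open O.
Proof.
rewrite (_ : O = ball p r); first exact: ball_open.
by apply/seteqP; split => x; rewrite -ball_normE/= distrC.
Qed.
Let oO := open_norm_ball.

Lemma segment_in_ball x v (t : R) : O x -> O (x + v) -> 0 <= t <= 1 -> O (x + t *: v).
Proof.
move=> xO vO /andP[t0 t1]; rewrite /O/=.
have -> : x + t *: v - p = (1 - t) *: (x - p) + t *: (x + v - p).
  by apply/rowP => i; rewrite !mxE; ring.
have t1' : 0 <= 1 - t by rewrite subr_ge0.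
rewrite (le_lt_trans (ler_normD _ _))// !normrZ (ger0_norm t0) (ger0_norm t1').
have [->|tn0] := eqVneq t 0; first by rewrite subr0 mul0r mul1r addr0.
have -> : r = (1 - t) * r + t * r by ring.
apply: ler_ltD; first by apply: ler_wpM2l => //; exact: ltW.
by rewrite ltr_pM2l// lt_neqAle eq_sym tn0.
Qed.

(** The mean value inequality for z - id, whose differential has norm at most
    1/2 by the bound on B. *)
Lemma near_identity x v : O x -> O (x + v) -> `|z (x + v) - z x - v| <= 2^-1 * `|v|.
Proof.
move=> xO vO; apply: mx_norm_le => [|i j]; first by rewrite mulr_ge0.
rewrite ord1 => {i}; pose f (y : E) : R := z y 0 j - y 0 j.
have df y : O y -> differentiable (fun y : E => z y 0 j) y.
  move=> Oy; apply: (@differentiable_comp _ _ _ _ z (fun M : E => M 0 j)); first exact: dz.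
  exact: differentiable_coord.
have [|t t01 E1] := @mean_value_line R E f x v.
  move=> t t01; have Oy := segment_in_ball xO vO t01.
  by apply: derivableB; apply: diff_derivable; [exact: df|exact: differentiable_coord].
have t01' : 0 <= t <= 1 by case/andP: t01 => ? ?; rewrite !ltW.
have Oy := segment_in_ball xO vO t01'; move: E1 Oy; set y := x + t *: v => E1 Oy.
have E2 : 'D_v f y = (v *m (B y - 1%:M)) 0 j.
  rewrite deriveB; last first.
  - by apply: diff_derivable; exact: differentiable_coord.
  - by apply: diff_derivable; exact: df.
  rewrite -(@derive_coord _ _ _ z y v j); last exact/diff_derivable/dz.
  rewrite -(@derive_coord _ _ _ id y v j); last exact: derivable_id.
  by rewrite derive_id Dz// mulmxBr mulmx1 mx_subE.
have -> : (z (x + v) - z x - v) 0 j = f (x + v) - f x.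
  by rewrite /f !mxE; ring.
rewrite E1 E2; apply: le_trans (entry_le_norm _ _ _) _; apply: le_trans (mx_norm_mul _ _) _.
by rewrite mulrAC; apply: ler_wpM2r => //; exact: B1.
Qed.

Lemma expand x v : O x -> O (x + v) -> `|v| <= 2 * `|z (x + v) - z x|.
Proof.
move=> xO vO; have H1 := near_identity xO vO.
have := ler_normB (z (x + v) - z x) (z (x + v) - z x - v); rewrite opprB addrC subrK => H2.
lra.
Qed.

Lemma near_identity_inj x x' : O x -> O x' -> z x = z x' -> x = x'.
Proof.
move=> Ox Ox' e; have : `|x' - x| <= 2 * `|z (x + (x' - x)) - z x|.
  by apply: expand => //; rewrite subrKC.
rewrite subrKC e subrr normr0 mulr0 normr_le0 subr_eq0 => /eqP->//.
Qed.

(** A point c of the closed ball minimizes the distance of z c to y.  If the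
    minimum were positive, the Newton step c + (y - z c), which stays in the
    ball, would at least halve it. *)
Lemma near_identity_onto x s y : O x -> 0 < s -> (forall x', `|x' - x| <= s -> O x') ->
  `|y - z x| <= s / 2 -> exists2 x', `|x' - x| <= s & z x' = y.
Proof.
move=> Ox s0 sO yx.
pose K := [set x' : E | `|x' - x| <= s].
have cK : compact K.
  have cc := @closed_ball_mx_compact R 1 n s.
  suff <- : (fun h => h + x) @` [set h : E | `|h| <= s] = K.
    apply: continuous_compact cc; apply: continuous_subspaceT => h.
    exact: (continuousD (@cvg_id _ (nbhs h)) (@cst_continuous _ _ x h)).
  apply/seteqP; split => [_ [h hs <-]|x' x's]; first by rewrite /K/= addrK.
  by exists (x' - x); rewrite ?subrK.
have [||c cK' cmin] := @EVT_min_rV R n (fun x' => `|z x' - y|) K _ cK.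
- by exists x; rewrite /K/= subrr normr0 ltW.
- apply: continuous_in_subspaceT => x' /set_mem Kx'.
  apply: (@continuous_comp _ _ _ (fun x' => z x' - y) (fun y : E => `|y|)); last exact: norm_continuous.
  apply: continuousB; last exact: cst_continuous.
  by apply: differentiable_continuous; apply: dz; exact: sO.
have Kc : K c by exact: set_mem.
exists c => //; apply/eqP; rewrite -subr_eq0 -normr_eq0.
have [//|cn0] := boolP (`|z c - y| == 0).
pose w := y - z c; have Oc := sO _ Kc.
have Kw : K (c + w).
  rewrite /K/=; have := @near_identity x (c - x) Ox; rewrite subrKC => /(_ Oc) H.
  have -> : c + w - x = (y - z x) - (z c - z x - (c - x)).
    by rewrite /w; apply/rowP => i; rewrite !mxE; ring.
  have H2 := ler_normB (y - z x) (z c - z x - (c - x)); have H3 : `|c - x| <= s := Kc.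
  lra.
have := cmin (c + w) (mem_set Kw); rewrite leNgt => /negP[].
have := near_identity Oc (sO _ Kw).
have -> : z (c + w) - z c - w = z (c + w) - y.
  by rewrite /w; apply/rowP => i; rewrite !mxE; ring.
move=> /le_lt_trans; apply; rewrite /w distrC; have : 0 < `|z c - y| by rewrite normr_gt0 -normr_eq0.
lra.
Qed.

Lemma near_identity_nbhs x : O x -> exists2 s : R, 0 < s & forall x', `|x' - x| <= s -> O x'.
Proof.
move=> Ox; have rx : 0 < r - `|x - p| by rewrite subr_gt0.
exists ((r - `|x - p|) / 2) => [|x' xx']; first by rewrite divr_gt0.
rewrite /O/=; have := ler_normD (x' - x) (x - p); rewrite addrA subrK.
lra.
Qed.

Lemma near_identity_open : open (z @` O).
Proof.
rewrite openE => _ [x Ox <-]; have [s s0 sO] := near_identity_nbhs Ox.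
have s20 : 0 < s / 2 by rewrite divr_gt0.
apply/nbhs_ballP; exists (s / 2) => //= y; rewrite -ball_normE/= distrC => /ltW yx.
have [x' x's <-] := near_identity_onto Ox s0 sO yx.
by exists x' => //; exact: sO.
Qed.

Lemma near_identity_unit x : O x -> B x \in unitmx.
Proof.
move=> Ox; rewrite -row_free_unit -kermx_eq0; apply/eqP/row_matrixP => i; rewrite row0.
set v := row i _; have vB : v *m B x = 0 by rewrite -row_mul mulmx_ker row0.
have Ev : - v = v *m (B x - 1%:M) by rewrite mulmxBr vB mulmx1 sub0r.
have := mx_norm_mul v (B x - 1%:M); rewrite -Ev normrN mulrAC => H.
have H2 : n%:R * `|B x - 1%:M| * `|v| <= 2^-1 * `|v| by apply: ler_wpM2r => //; exact: B1.
apply/eqP; rewrite -normr_le0; lra.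
Qed.

Lemma smooth_of_jacobian : smooth_on O z.
Proof.
case=> [x Ox|k]; first exact/differentiable_continuous/dz.
split=> // v; apply/Ck_on_coord => // j.
have H : Ck_on k O (fun x => \sum_i v 0 i * B x i j).
  by apply: Ck_on_sum => // i _; apply: Ck_onM => //; [exact: Ck_on_cst|exact: sB].
by apply: (Ck_on_eq oO _ H) => x Ox; rewrite Dz// mxE.
Qed.

(** The local inverse is differentiable with Jacobian matrix the inverse of B;
    it is smooth because this formula expresses its derivatives through
    itself. *)
Theorem inverse_function : exists zi : E -> E,
  [/\ forall x, O x -> zi (z x) = x, open (z @` O), smooth_on (z @` O) zi &
      forall x v, O x -> 'D_v zi (z x) = v *m invmx (B x)].
Proof.
have /choice[zi ziP] : forall y, exists x, (z @` O) y -> O x /\ z x = y.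
  move=> y; have [[x Ox xy]|nO] := pselect ((z @` O) y); first by exists x.
  by exists 0 => /nO.
have ziK x : O x -> zi (z x) = x.
  move=> Ox; have [|Oz e] := ziP (z x); first by exists x.
  exact: near_identity_inj.
have oI := near_identity_open.
have dzi x : O x -> differentiable zi (z x) /\ forall v, 'D_v zi (z x) = v *m invmx (B x).
  move=> Ox; have uB := near_identity_unit Ox; have [s s0 sO] := near_identity_nbhs Ox.
  have zE k : z x + k = k + z x by rewrite addrC.
  have [|df Df] := @eps_diff_mx R 1 n n zi (z x) (fun i => row i (invmx (B x))).
    move=> e e0; pose c := 2 * (n%:R * `|invmx (B x)| + 1).
    have c0 : 0 < c by rewrite /c mulr_gt0// ltr_wpDl// mulr_ge0.
    have ec0 : 0 < e / c by rewrite divr_gt0.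
    have [d d0 dd] := near_delta (diff_eps (dz Ox) ec0).
    apply/nbhs_ballP; exists (Num.min (s / 2) (d / 2)) => /=; first by rewrite lt_min !divr_gt0.
    move=> k; rewrite -ball_normE/= sub0r normrN lt_min => /andP[ks kd].
    have [|x' x's zx'] := @near_identity_onto x s (k + z x) Ox s0 sO; first by rewrite addrK ltW.
    rewrite -zx' ziK; last exact: sO.
    rewrite ziK// -(_ : k *m invmx (B x) = \sum_i _); last first.
      by rewrite mulmx_sum_row.
    set h := x' - x; have xh : x + h = x' by rewrite /h subrKC.
    have hk : `|h| <= 2 * `|k|.
      have := @expand x h Ox; rewrite xh zx' addrK; apply; exact: sO.
    have := dd h; rewrite subr0 [h + x]addrC xh zx' addrK -deriveE; last exact: dz.
    rewrite Dz// => /(_ _)H.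
    have {}H : `|k - h *m B x| <= e / c * `|h| by apply: H; lra.
    have -> : h - k *m invmx (B x) = - ((k - h *m B x) *m invmx (B x)).
      by rewrite mulmxBl mulmxK// opprB.
    rewrite normrN; apply: le_trans (mx_norm_mul _ _) _; rewrite mulrAC.
    have ib : n%:R * `|invmx (B x)| <= c / 2 by rewrite /c; lra.
    have H2 : `|k - h *m B x| <= e / c * (2 * `|k|) by apply: le_trans H _; rewrite ler_pM2l.
    have -> : e * `|k| = c / 2 * (e / c * (2 * `|k|)) by field; rewrite gt_eqF.
    by apply: ler_pM => //; rewrite mulr_ge0.
  by split=> // v; rewrite Df mulmx_sum_row.
exists zi; split=> // [k|x v /dzi[]//].
have dI y : (z @` O) y -> differentiable zi y by move=> [x Ox <-]; have [] := dzi x Ox.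
have inO y : (z @` O) y -> O (zi y) by move=> /ziP[].
elim: k => [y Iy|k IH]; first exact/differentiable_continuous/dI.
split=> // v; apply/Ck_on_coord => // j.
have kB i l : Ck_on k (z @` O) (fun y => B (zi y) i l).
  exact: (@Ck_on_comp_scalar R _ _ k (z @` O) O (fun x => B x i l) zi oI inO (sB i l k) IH).
have H : Ck_on k (z @` O) (fun y => \sum_i v 0 i * invmx (B (zi y)) i j).
  apply: Ck_on_sum => // i _; apply: Ck_onM => //; first exact: Ck_on_cst.
  apply: (@Ck_on_invmx R _ k (z @` O) n (fun y => B (zi y)) oI) => // y /inO.
  exact: near_identity_unit.
apply: (Ck_on_eq oI _ H) => _ [x Ox <-]; have [_ ->] := dzi x Ox.
by rewrite ziK// mxE.
Qed.

End NearIdentity.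

(** * Flat coordinates *)

Section Flattening.
Context {R : realType}.
Local Notation E := 'rV[R]_2.
Variables (p : E) (d : R) (Gam : E -> E -> 'M[R]_2) (B : E -> 'M[R]_2).
Let O : set E := [set x | `|x - p| < d].
Hypothesis d0 : 0 < d.
Hypothesis Gsym : forall x v y, O x -> v *m Gam x y = y *m Gam x v.
Hypothesis sG : forall v i j, smooth_on O (fun x => Gam x v i j).
Hypothesis dB : forall x, O x -> differentiable B x.
Hypothesis DB : forall x v, O x -> 'D_v B x = Gam x v *m B x.
Hypothesis B1 : forall x, O x -> 2%:R * `|B x - 1%:M| <= 2^-1.

Let oO : open O. Proof. exact: open_norm_ball. Qed.

Lemma differentiable_entry i j x : O x -> differentiable (fun x => B x i j) x.
Proof.
move=> Ox; apply: (@differentiable_comp _ _ _ _ B (fun M : 'M[R]_2 => M i j)); first exact: dB.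
exact: differentiable_coord.
Qed.

Lemma derive_entry i j x v : O x -> 'D_v (fun x => B x i j) x = (Gam x v *m B x) i j.
Proof.
move=> Ox; rewrite -DB// derive_mx ?mxE//.
by apply: diff_derivable; exact: dB.
Qed.

(** The equation for the derivatives of B gains one order of differentiability
    at each step. *)
Lemma smooth_frame i j : smooth_on O (fun x => B x i j).
Proof.
move=> k; elim: k i j => [|k IH] i j.
  by move=> x Ox; apply/differentiable_continuous/differentiable_entry.
split=> [x Ox|v]; first exact: differentiable_entry.
have H : Ck_on k O (fun x => \sum_l Gam x v i l * B x l j).
  by apply: Ck_on_sum => // l _; apply: Ck_onM => //; exact: sG.
by apply: (Ck_on_eq oO _ H) => x Ox; rewrite derive_entry// mxE.
Qed.

(** Symmetry of the connection is closedness of the columns of B. *)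
Lemma frame_closed a x : O x ->
  'D_e1 (fun x => B x 1 a) x = 'D_e2 (fun x => B x 0 a) x.
Proof.
move=> Ox; rewrite !derive_entry//.
have rowe (i : 'I_2) (M : 'M[R]_2) : M i a = ((delta_mx 0 i : E) *m M) 0 a by rewrite -rowE mxE.
by rewrite (rowe 1) (rowe 0) !mulmxA -[delta_mx 0 1]/(e2) -[delta_mx 0 0]/(e1) Gsym.
Qed.

Lemma exists_flat_coord : exists z : E -> E, exists2 r : R, 0 < r & forall x, `|x - p| < r ->
  [/\ O x, differentiable z x & forall v, 'D_v z x = v *m B x].
Proof.
have prim a := poincare d0 (smooth_frame 0 a 1) (smooth_frame 1 a 1) (@frame_closed a).
have [g0 [r0 r00 H0]] := prim 0; have [g1 [r1 r10 H1]] := prim 1.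
exists (fun x => \row_a (if a == 0 then g0 x else g1 x)), (Num.min d (Num.min r0 r1)).
  by rewrite !lt_min d0 r00.
move=> x; rewrite !lt_min => /and3P[xd xr0 xr1].
have [|dz Dz] := @eps_diff_mx R 1 2 2 (fun x => \row_a (if a == 0 then g0 x else g1 x)) x
    (fun i => row i (B x)).
  move=> e e0; have [s0 s00 K0] := near_delta (H0 x xr0 e e0).
  have [s1 s10 K1] := near_delta (H1 x xr1 e e0).
  apply/nbhs_ballP; exists (Num.min s0 s1) => /=; first by rewrite lt_min s00.
  move=> w; rewrite -ball_normE/= sub0r normrN lt_min => /andP[w0 w1].
  apply: mx_norm_le => [|i a]; first by rewrite mulr_ge0// ltW.
  have := K0 w; rewrite subr0 => /(_ w0); have := K1 w; rewrite subr0 => /(_ w1).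
  rewrite ord1 sum_ord2 !mxE.
  by have [->|->] := ord2P a.
by split=> // v; rewrite Dz mulmx_sum_row.
Qed.

Theorem exists_flat_chart : exists (z zi : E -> E), exists2 r : R, 0 < r &
  let O' := [set x : E | `|x - p| < r] in
  [/\ forall x, O' x -> O x /\ zi (z x) = x, open (z @` O'), smooth_on O' z, smooth_on (z @` O') zi &
    forall x v, O' x -> 'D_v z x = v *m B x].
Proof.
have [z [r r0 H]] := exists_flat_coord.
pose O' := [set x : E | `|x - p| < r].
have O'O : O' `<=` O by move=> x /H[].
have dz x : O' x -> differentiable z x by move=> /H[].
have Dz x v : O' x -> 'D_v z x = v *m B x by move=> /H[].
have sB i j : smooth_on O' (fun x => B x i j) by move=> k; apply: Ck_onS (smooth_frame i j k).
have [zi [ziK oI szi _]] := inverse_function dz Dz sB (fun x xr => B1 (O'O x xr)).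
exists z, zi, r => //; split=> //.
  by move=> x xr; split; [exact: O'O|exact: ziK].
exact: smooth_of_jacobian dz Dz sB.
Qed.

End Flattening.

Section FlatMetric.
Context {R : realType}.
Local Notation E := 'rV[R]_2.
Variables (f : E * E -> R) (U : set E).
Local Notation Q := (metric_sq f).
Hypothesis oU : open U.
Hypothesis oA : open [set z : E * E | U z.1 /\ z.2 != 0].
Hypothesis sf : smooth_on [set z : E * E | U z.1 /\ z.2 != 0] f.
Hypothesis Qcx : forall x y, U x -> {for x, continuous (fun x' => Q (x', y))}.
Hypothesis Qcy : forall x y, U x -> {for y, continuous (fib Q x)}.
Hypothesis Qdx : forall x y, U x -> y != 0 -> differentiable (fun x' => Q (x', y)) x.
Hypothesis Q0 : forall x, U x -> Q (x, 0) = 0.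
Hypothesis Qn : forall x, U x -> norm_sq (fib Q x).
Hypothesis Qne : forall x, U x -> ~ euclidean_fibre (fib Q x).
Hypothesis Qiso : forall x x', U x -> U x' -> exists C, fibre_iso Q x x' C.
Hypothesis L : forall x y h, U x -> y != 0 -> landsberg f (x, y) h h h = 0.

(** All fibres are carried to the fibre at p by the differential of one map z. *)
Theorem landsberg_flat p : U p -> exists (z zi : E -> E), exists2 r : R, 0 < r &
  let O := [set x : E | `|x - p| < r] in
  [/\ O `<=` U, forall x, O x -> zi (z x) = x, open (z @` O), smooth_on O z /\ smooth_on (z @` O) zi &
    forall x v, O x -> Q (p, 'D_v z x) = Q (x, v)].
Proof.
move=> Up; have [Gam GamP] := exists_connection oU Qcx Qcy Qdx Q0 Qn Qne Qiso.
have Gsym := connection_sym oA sf Qn Qne L GamP.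
have sG := connection_smooth oU oA sf Qn Qne L GamP.
(* The bound 1/2 on the differential of z - id needs 2 * |B - 1| <= 1/2. *)
have e80 : 0 < 8^-1 :> R by [].
have [B [d d0 HB]] := exists_frame oU Qcx Qcy Qdx Q0 Qn Qne Qiso Up e80 GamP.
pose O := [set x : E | `|x - p| < d].
have OU : O `<=` U by move=> x /HB[].
have [|||||z [zi [r r0 [H1 H2 H3 H4 H5]]]] := @exists_flat_chart R p d Gam B d0.
- by move=> x v y /OU; exact: Gsym.
- by move=> v i j k; apply: Ck_onS (sG v i j k).
- by move=> x /HB[].
- by move=> x v /HB[].
- by move=> x /HB[_ _ b1 _ _]; lra.
exists z, zi, r => //; split=> //.
- by move=> x /H1[/OU].
- by move=> x /H1[].
- move=> x v Ox; rewrite H5//; have [/HB[_ isoB _ _ _] _] := H1 x Ox.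
  exact: isoB.
Qed.

End FlatMetric.

(** * Charts and their transitions *)

Lemma diff_inverse (R : realType) (V W : normedModType R) (A : set V) (f : V -> W) (g : W -> V) x w :
  open A -> A x -> (forall x', A x' -> g (f x') = x') -> differentiable f x ->
  differentiable g (f x) -> 'd g (f x) ('d f x w) = w.
Proof.
move=> oA Ax gf df dg.
have dgf : differentiable (g \o f) x by exact: differentiable_comp.
have : 'D_w (g \o f) x = 'D_w id x by apply: (open_derive_eq _ oA Ax) => x'; exact: gf.
by rewrite derive_id deriveE// diff_comp.
Qed.

Section ChartCalculus.
Context {R : realType} {n : nat} {T : topologicalType}.
Local Notation E := 'rV[R]_n.
Implicit Types c d : chart R n T.

Lemma cimgP c x : cimg c x -> cdom c (cinv c x) /\ cfun c (cinv c x) = x.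
Proof. by move=> [q qc <-]; rewrite cfunK ?inE. Qed.

Lemma cimg_cfun c q : cdom c q -> cimg c (cfun c q).
Proof. by move=> qc; exists q. Qed.

Lemma image_chartE c (D : set T) :
  cfun c @` (cdom c `&` D) = [set x | cimg c x /\ D (cinv c x)].
Proof.
apply/seteqP; split=> [_ [q [qc qD] <-]|x [/cimgP[xc e] xD]] /=.
  by split; [exact: cimg_cfun|rewrite cfunK ?inE].
by exists (cinv c x).
Qed.

(** The domain of a transition is open, since it is a preimage under the inverse
    of the chart. *)
Lemma open_image_chart c (D : set T) : open D -> open (cfun c @` (cdom c `&` D)).
Proof.
move=> oD; rewrite image_chartE openE => x [xc xD].
have oc := @open_cimg _ _ _ c.
have n1 : nbhs x (cimg c) by exact: open_nbhs_nbhs.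
have n2 : nbhs x (cinv c @^-1` D) by apply: (cinv_continuous xc); exact: open_nbhs_nbhs.
exact: (filterI n1 n2).
Qed.

Lemma smooth_on_diff (V W : normedModType R) (A : set V) (f : V -> W) x :
  smooth_on A f -> A x -> differentiable f x.
Proof. by move=> /(_ 1%N)[df _] /df. Qed.

Section Transition.
Variables (c d : chart R n T) (q : T).
Hypothesis cd : smooth_transition c d.
Hypothesis dc : smooth_transition d c.
Hypothesis qc : cdom c q.
Hypothesis qd : cdom d q.

Lemma transition_diff : differentiable (cfun d \o cinv c) (cfun c q).
Proof. by apply: (smooth_on_diff cd); exists q. Qed.

Lemma transition_dK w :
  'd (cfun c \o cinv d) (cfun d q) ('d (cfun d \o cinv c) (cfun c q) w) = w.
Proof.
have dqE : cfun d q = (cfun d \o cinv c) (cfun c q) by rewrite /= cfunK ?inE.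
rewrite [in X in 'd _ X _]dqE.
apply: (@diff_inverse _ _ _ (cfun c @` (cdom c `&` cdom d))).
- exact: open_image_chart (@open_cdom _ _ _ d).
- by exists q.
- by move=> _ [q' [q'c q'd] <-]; rewrite /= cfunK ?inE// cfunK ?inE.
- exact: transition_diff.
- rewrite -dqE; apply: (smooth_on_diff dc).
  by exists q.
Qed.

End Transition.

(** Shrinking a chart and composing it with a diffeomorphism between open
    subsets of the model space. *)
Section ComposeChart.
Variables (c : chart R n T) (O : set E) (z zi : E -> E).
Hypothesis oO : open O.
Hypothesis Oc : O `<=` cimg c.
Hypothesis zK : forall x, O x -> zi (z x) = x.
Hypothesis oI : open (z @` O).
Hypothesis cz : forall x, O x -> {for x, continuous z}.
Hypothesis czi : forall y, (z @` O) y -> {for y, continuous zi}.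

Let D : set T := cdom c `&` cfun c @^-1` O.

Lemma compose_open : open D.
Proof.
rewrite openE => q [qc qO].
have n1 : nbhs q (cdom c) by apply: open_nbhs_nbhs; split=> //; exact: open_cdom.
have n2 : nbhs q (cfun c @^-1` O) by apply: (cfun_continuous qc); exact: open_nbhs_nbhs.
exact: (filterI n1 n2).
Qed.

Lemma compose_img : (z \o cfun c) @` D = z @` O.
Proof.
apply/seteqP; split=> [_ [q [_ qO] <-]|_ [x xO <-]]; first by exists (cfun c q).
have [xc e] := cimgP (Oc xO).
by exists (cinv c x); rewrite /D /preimage/= e.
Qed.

Lemma compose_open_img : open ((z \o cfun c) @` D).
Proof. by rewrite compose_img. Qed.

Lemma compose_funK : {in D, cancel (z \o cfun c) (cinv c \o zi)}.
Proof. by move=> q /set_mem[qc qO] /=; rewrite zK// cfunK ?inE. Qed.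

Lemma compose_cont q : D q -> {for q, continuous (z \o cfun c)}.
Proof.
by move=> [qc qO]; apply: continuous_comp; [exact: cfun_continuous|exact: cz].
Qed.

Lemma compose_contV y : ((z \o cfun c) @` D) y -> {for y, continuous (cinv c \o zi)}.
Proof.
rewrite compose_img => yI; apply: continuous_comp; first exact: czi.
by case: yI => x xO <-; rewrite zK//; apply: cinv_continuous; exact: Oc.
Qed.

Definition compose_chart : chart R n T :=
  Chart compose_open compose_open_img compose_funK compose_cont compose_contV.

End ComposeChart.

End ChartCalculus.

Section SmoothCharts.
Context {R : realType} {n : nat} {M : manifold R n}.
Local Notation E := 'rV[R]_n.
Implicit Types c : chart R n M.

Lemma smooth_chart_at (p : M) : smooth_chart (chart_at p).
Proof. by move=> d ad; split; apply: atlas_smooth => //; exact: atlas_chart_at. Qed.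

Lemma smooth_compose_chart c (O : set E) (z zi : E -> E) (oO : open O) (Oc : O `<=` cimg c)
    (zK : forall x, O x -> zi (z x) = x) (oI : open (z @` O))
    (cz : forall x, O x -> {for x, continuous z})
    (czi : forall y, (z @` O) y -> {for y, continuous zi}) :
  smooth_chart c -> smooth_on O z -> smooth_on (z @` O) zi ->
  smooth_chart (compose_chart oO Oc zK oI cz czi).
Proof.
move=> sc sz szi d ad; have [cd dc] := sc d ad; split=> k.
  pose A := cfun (compose_chart oO Oc zK oI cz czi) @`
    (cdom (compose_chart oO Oc zK oI cz czi) `&` cdom d).
  have oA : open A by apply: open_image_chart; exact: open_cdom.
  have oB : open (cfun c @` (cdom c `&` cdom d)) by apply: open_image_chart; exact: open_cdom.
  have AI : A `<=` z @` O by move=> _ [q [[qc qO] qd] <-]; exists (cfun c q).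
  have AB y : A y -> (cfun c @` (cdom c `&` cdom d)) (zi y).
    by move=> [q [[qc qO] qd] <-]; exists q => //=; rewrite zK.
  exact: (Ck_on_comp oA oB AB (cd k) (Ck_onS AI (szi k))).
pose A := cfun d @` (cdom d `&` cdom (compose_chart oO Oc zK oI cz czi)).
have oA : open A by apply: open_image_chart; exact: open_cdom.
have AB y : A y -> O ((cfun c \o cinv d) y).
  by move=> [q [qd [qc qO]] <-]; rewrite /= cfunK ?inE.
have AA : A `<=` cfun d @` (cdom d `&` cdom c) by move=> _ [q [qd [qc qO]] <-]; exists q.
exact: (Ck_on_comp oA oO AB (sz k) (Ck_onS AA (dc k))).
Qed.

End SmoothCharts.

(** * Homogeneous Finsler surfaces *)

Section Fibres.
Context {R : realType} {M : manifold R 2} (F : finsler_metric M).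
Local Notation E := 'rV[R]_2.
Implicit Types c : chart R 2 M.

(** The tangent types of different points are all the model space; forgetting
    the base point allows rewriting with equations between points. *)
Let norm_at (p : M) (v : E) : R := F p (v : tangent p).

Lemma norm_at_scale p (a : R) (v : E) : 0 < a -> norm_at p (a *: v) = a * norm_at p v.
Proof. by move=> a0; exact: finsler_homogeneous. Qed.

Lemma norm_at0 p : norm_at p 0 = 0.
Proof.
have := @norm_at_scale p 2 0 (ltr0Sn _ _); rewrite scaler0 => /eqP.
by rewrite -subr_eq0 (_ : _ - _ = - norm_at p 0) ?oppr_eq0 => [/eqP|]; [|ring].
Qed.

Lemma in_coordE c x y :
  in_coord F c (x, y) = norm_at (cinv c x) ('d (cfun (chart_at (cinv c x)) \o cinv c) x y).
Proof. by []. Qed.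

Lemma in_coord_scale c x (a : R) y : 0 < a -> in_coord F c (x, a *: y) = a * in_coord F c (x, y).
Proof. by move=> a0; rewrite !in_coordE linearZ norm_at_scale. Qed.

Lemma in_coord0 c x : in_coord F c (x, 0) = 0.
Proof. by rewrite in_coordE linear0 norm_at0. Qed.

Lemma in_coord_ge0 c z : 0 <= in_coord F c z.
Proof. exact: finsler_ge0. Qed.

Section InChart.
Variable c : chart R 2 M.
Hypothesis sc : smooth_chart c.
Local Notation f := (in_coord F c).
Local Notation U := (cimg c).
Local Notation Q := (metric_sq f).

Lemma open_U : open U. Proof. exact: open_cimg. Qed.

Lemma open_UxS : open [set z : E * E | U z.1 /\ z.2 != 0].
Proof.
rewrite openE => -[x y] /= [xU y0].
have n1 : nbhs x U by apply: open_nbhs_nbhs; split=> //; exact: open_U.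
have n2 : nbhs y (@slit R) by apply: open_nbhs_nbhs; split=> //; exact: open_slit.
by exists (U, @slit R).
Qed.

Lemma coord_smooth : smooth_on [set z : E * E | U z.1 /\ z.2 != 0] f.
Proof. exact: finsler_smooth. Qed.

Lemma coord_sq_cont x y : U x -> {for (x, y), continuous Q}.
Proof.
move=> xU; have cf : {for (x, y), continuous f} by apply: (finsler_continuous sc).
have -> : Q = (fun z => f z * f z) by apply/funext => z; rewrite /metric_sq expr2.
exact: continuousM.
Qed.

Lemma coord_sq_cont_x x y : U x -> {for x, continuous (fun x' => Q (x', y))}.
Proof.
move=> xU; apply: (@continuous_comp _ _ _ (fun x' : E => (x', y)) Q); last exact: coord_sq_cont.
have [d _] := @is_diff_pairr R E E x y; exact: differentiable_continuous.
Qed.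

Lemma coord_sq_cont_y x y : U x -> {for y, continuous (fib Q x)}.
Proof.
move=> xU; apply: (@continuous_comp _ _ _ (fun y' : E => (x, y')) Q); last exact: coord_sq_cont.
have [d _] := @is_diff_pairl R E E x y; exact: differentiable_continuous.
Qed.

Lemma coord_sq_diff x y : U x -> y != 0 -> differentiable (fun x' => Q (x', y)) x.
Proof.
move=> xU y0; have [d _] := @is_diff_pairr R E E x y.
apply: (@differentiable_comp _ _ _ _ (fun x' : E => (x', y)) Q) => //.
by apply: (smooth_on_diff (smooth_metric_sq open_UxS coord_smooth)).
Qed.

Lemma coord_sq0 x : U x -> Q (x, 0) = 0.
Proof. by move=> _; rewrite /metric_sq in_coord0 expr0n. Qed.

Lemma fibre_smooth x : U x -> smooth_on slit (fib Q x).
Proof.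
move=> xU k; have H := @Ck_on_affine _ E (E * E)%type k (@slit R) [set z : E * E | U z.1 /\ z.2 != 0] Q
  (fun y => (x, y)) _ (@open_slit R) (@is_diff_pairl R E E x).
by apply: H => //; exact: (smooth_metric_sq open_UxS coord_smooth).
Qed.

Lemma fibre_norm_sq x : U x -> norm_sq (fib Q x).
Proof.
move=> xU; split; first exact: fibre_smooth.
- by move=> y a y0 a0; rewrite /fib /metric_sq in_coord_scale// exprMn.
- move=> y u y0 u0.
  have := finsler_posdef F sc (conj xU y0 : coord_slit_tangent c (x, y)) u0.
  rewrite (fundamental_form_hess _ _ (fibre_smooth xU 2) y0).
  by rewrite pmulr_rgt0 ?invr_gt0.
Qed.

End InChart.

Lemma coord_tangent_inverse c x : smooth_chart c -> cimg c x -> exists S : 'M[R]_2,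
  forall w, 'd (cfun (chart_at (cinv c x)) \o cinv c) x (w *m S) = w.
Proof.
move=> sc xU; have [qc e] := cimgP xU; set q := cinv c x in qc e *.
have [cq qc'] := sc _ (atlas_chart_at q).
exists (lin1_mx ('d (cfun c \o cinv (chart_at q)) (cfun (chart_at q) q))) => w.
rewrite mul_rV_lin1.
by have := transition_dK qc' cq (cdom_chart_at q) qc w; rewrite e.
Qed.

Lemma mul_lin1_comp (L P : {linear E -> E}) (S : 'M[R]_2) y :
  y *m (lin1_mx L *m lin1_mx P *m S) = P (L y) *m S.
Proof. by rewrite !mulmxA mul_rV_lin1 mul_rV_lin1. Qed.

(** The differential of an isometry of M mapping one base point to the other,
    read in the charts. *)
Lemma homogeneous_fibres c c' x x' : is_homogeneous F ->
  smooth_chart c -> smooth_chart c' -> cimg c x -> cimg c' x' ->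
  exists A : 'M[R]_2, forall y, in_coord F c' (x', y *m A) = in_coord F c (x, y).
Proof.
move=> homF sc sc' xU xU'.
have [phi [_ isophi] phiE] := homF (cinv c x) (cinv c' x').
have [S' S'K] := coord_tangent_inverse sc' xU'.
pose L : {linear E -> E} := 'd (cfun (chart_at (cinv c x)) \o cinv c) x.
pose P : {linear E -> E} := 'd (cfun (chart_at (phi (cinv c x))) \o phi \o cinv (chart_at (cinv c x)))
  (cfun (chart_at (cinv c x)) (cinv c x)).
have PE v : norm_at (phi (cinv c x)) (P v) = norm_at (cinv c x) v by exact: isophi.
move: P PE; rewrite phiE => P PE.
exists (lin1_mx L *m lin1_mx P *m S') => y.
have SE := etrans (congr1 ('d (cfun (chart_at (cinv c' x')) \o cinv c') x') (mul_lin1_comp L P S' y)) (S'K (P (L y))).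
exact: (etrans (congr1 (norm_at _) SE) (PE (L y))).
Qed.

Section HomogeneousInChart.
Variable c : chart R 2 M.
Hypothesis sc : smooth_chart c.
Local Notation f := (in_coord F c).
Local Notation U := (cimg c).
Local Notation Q := (metric_sq f).

Lemma fibres_isometric : is_homogeneous F ->
  forall x x', U x -> U x' -> exists C, fibre_iso Q x x' C.
Proof.
move=> homF x x' xU xU'; have [A AE] := homogeneous_fibres homF sc sc xU' xU.
by exists A => y; rewrite /fib /metric_sq AE.
Qed.

Lemma landsberg_flat_coord p : is_homogeneous F -> is_landsberg F ->
  (forall x, U x -> ~ euclidean_fibre (fib Q x)) -> U p ->
  exists (z zi : E -> E), exists2 r : R, 0 < r &
  let O := [set x : E | `|x - p| < r] in
  [/\ O `<=` U, forall x, O x -> zi (z x) = x, open (z @` O), smooth_on O z /\ smooth_on (z @` O) zi &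
    forall x v, O x -> Q (p, 'D_v z x) = Q (x, v)].
Proof.
move=> homF LF Qne pU.
have LF' x y h : U x -> y != 0 -> landsberg f (x, y) h h h = 0.
  by move=> xU y0; exact: (LF c sc (x, y) (conj xU y0)).
exact: (landsberg_flat (@open_U c) (@open_UxS c) (coord_smooth sc) (coord_sq_cont_x sc)
  (coord_sq_cont_y sc) (coord_sq_diff sc) (@coord_sq0 c) (fibre_norm_sq sc) Qne
  (fibres_isometric homF) LF' pU).
Qed.

Lemma in_coord_compose (O : set E) (z zi : E -> E) (oO : open O) (OU : O `<=` U)
    (zK : forall x, O x -> zi (z x) = x) (oI : open (z @` O))
    (cz : forall x, O x -> {for x, continuous z})
    (czi : forall y, (z @` O) y -> {for y, continuous zi}) x y :
  O x -> differentiable zi (z x) ->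
  in_coord F (compose_chart oO OU zK oI cz czi) (z x, y) = in_coord F c (x, 'd zi (z x) y).
Proof.
move=> xO dzi; have zx := zK x xO; have [qc e] := cimgP (OU x xO).
have dT : differentiable (cfun (chart_at (cinv c (zi (z x)))) \o cinv c) (zi (z x)).
  have [cq _] := sc (atlas_chart_at (cinv c x)).
  by have := transition_diff cq qc (cdom_chart_at (cinv c x)); rewrite e zx.
have chain : 'd (cfun (chart_at (cinv c (zi (z x)))) \o (cinv c \o zi)) (z x) y =
    'd (cfun (chart_at (cinv c (zi (z x)))) \o cinv c) (zi (z x)) ('d zi (z x) y).
  exact: (congr1 (fun h : E -> E => h y) (diff_comp dzi dT)).
apply: (etrans (congr1 (norm_at (cinv c (zi (z x)))) chain)).
exact: (congr1 (fun x' => in_coord F c (x', 'd zi (z x) y)) zx).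
Qed.

(** The chart c followed by the flat coordinates of [landsberg_flat]. *)
Lemma minkowski_chart q : is_homogeneous F -> is_landsberg F ->
  (forall x, U x -> ~ euclidean_fibre (fib Q x)) -> cdom c q ->
  exists c' : chart R 2 M, [/\ smooth_chart c', cdom c' q &
    forall x x' y : E, cimg c' x -> cimg c' x' -> in_coord F c' (x, y) = in_coord F c' (x', y)].
Proof.
move=> homF LF Qne qc; have pU := cimg_cfun qc; set p := cfun c q in pU.
have [z [zi [r r0 [OU zK oI [sz szi] iso]]]] := landsberg_flat_coord homF LF Qne pU.
set O := [set x : E | _] in OU zK oI sz szi iso.
have oO : open O by exact: open_norm_ball.
have dz x (xO : O x) := smooth_on_diff sz xO.
have dzi y (yI : (z @` O) y) := smooth_on_diff szi yI.
have cz x (xO : O x) := differentiable_continuous (dz x xO).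
have czi y (yI : (z @` O) y) := differentiable_continuous (dzi y yI).
pose c' := compose_chart oO OU zK oI cz czi.
exists c'; split.
- exact: smooth_compose_chart.
- by split=> //=; rewrite /O/= subrr normr0.
suff key x y : cimg c' x -> metric_sq (in_coord F c') (x, y) = Q (p, y).
  have sqI (a b : R) : 0 <= a -> 0 <= b -> a ^+ 2 = b ^+ 2 -> a = b.
    by move=> a0 b0 /eqP; rewrite eqrXn2// => /eqP.
  move=> x x' y xI xI'; apply: (sqI _ _ (in_coord_ge0 c' _) (in_coord_ge0 c' _)).
  exact: (etrans (key x y xI) (esym (key x' y xI'))).
move=> [q0 [q0c xO] <-] {x}; move: xO; rewrite /preimage/=; move: (cfun c q0) => x0 xO.
have Iz : (z @` O) (z x0) by exists x0.
have dzx := dz x0 xO; have dzix := dzi _ Iz.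
have zzi : 'd z x0 ('d zi (z x0) y) = y.
  have := @diff_inverse _ _ _ (z @` O) zi z (z x0) y oI Iz; rewrite zK//; apply=> //.
  by move=> _ [x1 x1O <-]; rewrite zK.
have iso0 := iso x0 ('d zi (z x0) y) xO; rewrite (etrans (deriveE _ dzx) zzi) in iso0.
apply: (etrans _ (esym iso0)); apply: (congr1 (fun t : R => t ^+ 2)).
by rewrite /c'; apply: in_coord_compose.
Qed.

End HomogeneousInChart.

Lemma euclidean_fibre_linear (e e' : E -> R) (A : 'M[R]_2) : norm_sq e -> norm_sq e' ->
  e 0 = 0 -> (forall y, e (y *m A) = e' y) -> euclidean_fibre e -> euclidean_fibre e'.
Proof.
move=> he he' e0 eA eucl.
have yA0 (y : E) : y != 0 -> y *m A != 0.
  move=> y0; apply/eqP => yA; have : 0 < e' y by exact: norm_sq_gt0.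
  by rewrite -eA yA e0 ltxx.
have DA (g : E -> R) (y v : E) : (forall y : E, y != 0 -> differentiable g y) -> y != 0 ->
    'D_v (fun y : E => g (y *m A)) y = 'D_(v *m A) g (y *m A).
  move=> dg y0; have [dA EA] := derive_linear_mx A y v.
  have dgA : differentiable g (y *m A) by exact/dg/yA0.
  rewrite [LHS]deriveE; last exact: (@differentiable_comp _ _ _ _ (fun z : E => z *m A) g).
  rewrite -[fun y : E => g _]/(g \o (fun z : E => z *m A)) diff_comp//= -deriveE// -EA.
  by rewrite -(deriveE v dA).
have hA (y v w : E) : y != 0 -> hess e' y v w = hess e (y *m A) (v *m A) (w *m A).
  move=> y0; apply: (etrans _ (DA ('D_(w *m A) e) y v (fun z z0 => norm_sq_diff1 he _ z0) y0)).
  apply: (open_derive_eq _ open_slit y0) => z z0.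
  have := DA e z w (fun z' z'0 => norm_sq_diff he z'0) z0.
  by rewrite (funext eA : (fun y : E => e (y *m A)) = e').
move=> y z v w y0 z0; apply: (etrans (hA y v w y0) (etrans _ (esym (hA z v w z0)))).
by apply: eucl; exact: yA0.
Qed.

End Fibres.

Theorem theorem1p1 (R : realType) (M : manifold R 2) (F : finsler_metric M) :
  is_homogeneous F -> is_landsberg F -> is_riemannian F \/ locally_minkowskian F.
Proof.
move=> homF LF.
have [[c [sc [x xU eucl]]]|neucl] := pselect (exists c : chart R 2 M, smooth_chart c /\
    exists2 x, cimg c x & euclidean_fibre (fib (metric_sq (in_coord F c)) x)).
  left=> c' sc' x' y y' xU' y0 y'0.
  have [A AE] := homogeneous_fibres homF sc' sc xU' xU.
  have eucl' : euclidean_fibre (fib (metric_sq (in_coord F c')) x').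
    apply: (@euclidean_fibre_linear _ (fib (metric_sq (in_coord F c)) x) _ A _ _ _ _ eucl).
    - exact: fibre_norm_sq.
    - exact: fibre_norm_sq.
    - exact: coord_sq0.
    - by move=> v; rewrite /fib /metric_sq AE.
  apply/matrixP => i j; apply: (etrans (fundamentalE _ _ _ _ _)).
  apply: (etrans (congr1 (fun t => 2^-1 * t) (eucl' y y' _ _ y0 y'0))).
  exact: (esym (fundamentalE _ _ _ _ _)).
right=> p; apply: (minkowski_chart (smooth_chart_at p)) => //; last exact: cdom_chart_at.
by move=> x xU eucl; apply: neucl; exists (chart_at p); split; [exact: smooth_chart_at|exists x].
Qed.
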